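(* Let $\mathbf{X}$ be a Köthe reflexive $\mathbf{F}^n$-directional Banach function space over $\mathbf{R}^d$ for which both $\mathbf{X}$ and $\mathbf{X}'$ are component-wise saturated. Then the following are equivalent: (i) $\mathbf{X}\in A$; (ii) $\mathbf{X}'\in A$; (iii) $T_Q:\mathbf{X}[\mathcal{K}]\to\mathbf{X}[\mathcal{K}]$ for all cubes $Q$, and $[\mathbf{X}]_{A[\mathcal{K}]}:=\sup_Q\|T_Q\|_{\mathbf{X}[\mathcal{K}]\to\mathbf{X}[\mathcal{K}]}<\infty$; (iv) $T_Q:\mathbf{X}'[\mathcal{K}]\to\mathbf{X}'[\mathcal{K}]$ for all cubes $Q$, and $[\mathbf{X}']_{A[\mathcal{K}]}:=\sup_Q\|T_Q\|_{\mathbf{X}'[\mathcal{K}]\to\mathbf{X}'[\mathcal{K}]}<\infty$; (v) $\mathbf{1}_Q u\in\mathbf{X}$ and $\mathbf{1}_Qu\in\mathbf{X}'$ for all cubes $Q$ and $u\in\mathbf{F}^n$, and $[\mathbf{X}]_{A_R}:=\sup_Q|Q|^{-1}\|A_{\mathbf{X},Q}A_{\mathbf{X}',Q}\|_{\mathbf{F}^{n\times n}}<\infty$; (vi) $\mathbf{1}_Q u\in\mathbf{X}$ and $\mathbf{1}_Qu\in\mathbf{X}'$ for all cubes $Q$ and $u\in\mathbf{F}^n$, and there is a $C_1>0$ such that for all cubes $Q$ and all $u\in\mathbf{F}^n$ there is a non-zero $v\in\mathbf{F}^n$ for which $$|Q|^{-1}\|\mathbf{1}_Q u\|_{\mathbf{X}}\|\mathbf{1}_Q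 v\|_{\mathbf{X}'}\leq C_1|u\cdot v|;$$ (vii) $\mathbf{1}_Q u\in\mathbf{X}$ and $\mathbf{1}_Qu\in\mathbf{X}'$ for all cubes $Q$ and $u\in\mathbf{F}^n$, and there is a $C_2>0$ such that for all cubes $Q$ and all $v\in\mathbf{F}^n$ there is a non-zero $u\in\mathbf{F}^n$ for which $$|Q|^{-1}\|\mathbf{1}_Q u\|_{\mathbf{X}}\|\mathbf{1}_Q v\|_{\mathbf{X}'}\leq C_2|u\cdot v|.$$ Moreover, for the optimal (smallest) $C_1$, $C_2$ we have $[\mathbf{X}]_A=[\mathbf{X}']_A=C_1=C_2$, and the quantities $[\mathbf{X}]_A$, $[\mathbf{X}]_{A_R}$, $[\mathbf{X}]_{A[\mathcal{K}]}$, $[\mathbf{X}']_{A[\mathcal{K}]}$ are comparable with comparability constants depending only on $n$.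
   Context: **Basic notation.** $d,n\ge 1$ are fixed integers, $\mathbf{F}$ is $\mathbf{R}$ or $\mathbf{C}$, $u\cdot v=\sum_{k=1}^n u_k\overline{v_k}$ and $|u|=|u\cdot u|^{1/2}$ on $\mathbf{F}^n$, $(e_k)_{k=1}^n$ is the standard basis, $\|\cdot\|_{\mathbf{F}^{n\times n}}$ is the operator norm. $L^0(\mathbf{R}^d;\mathbf{F}^n)$ is the space of measurable functions $\mathbf{R}^d\to\mathbf{F}^n$ (modulo a.e. equality; Lebesgue measure). A cube is a cube in $\mathbf{R}^d$ with sides parallel to the coordinate axes. **Convex-set valued maps.** $\mathcal{K}$ is the collection of non-empty closed convex $K\subseteq\mathbf{F}^n$ that are symmetric: $\lambda u\in K$ for $u\in K$, $\lambda\in\mathbf{F}$, $|\lambda|=1$. For $u\in\mathbf{F}^n$, $\mathcal{K}(u)=\{\lambda u:|\lambda|\le1\}$, and for a function $f$, $\mathcal{K}(f)(x):=\mathcal{K}(f(x))$. $L^0(\mathbf{R}^d;\mathcal{K})$ is the set of $F:\mathbf{R}^d\to\mathcal{K}$ such that $\{x:F(x)\cap E\ne\emptyset\}$ is measurable for every measurable (equivalently, every open) $E\subseteq\mathbf{F}^n$. $S^0(\mathbf{R}^d;F)$ is the set of $f\in L^0(\mathbf{R}^d;\mathbf{F}^n)$ with $f(x)\in F(x)$ a.e. **Directional Banach function spaces.** An $\mathbf{F}^n$-directional Banach function space $\mathbf{X}$ over $\mathbf{R}^d$ is a complete normed subspace of $L^0(\mathbf{R}^d;\mathbf{F}^n)$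 with: (directional ideal property) if $f\in\mathbf{X}$, $g\in L^0(\mathbf{R}^d;\mathbf{F}^n)$ and $\mathcal{K}(g)(x)\subseteq\mathcal{K}(f)(x)$ a.e., then $g\in\mathbf{X}$ and $\|g\|_{\mathbf{X}}\le\|f\|_{\mathbf{X}}$; (non-degeneracy) if $g\in L^0(\mathbf{R}^d;\mathbf{F}^n)$ and $\int f\cdot g\,dx=0$ for all $f\in\mathbf{X}$, then $g=0$ a.e. Its Köthe dual $\mathbf{X}'$ consists of the $g\in L^0(\mathbf{R}^d;\mathbf{F}^n)$ with $\|g\|_{\mathbf{X}'}:=\sup_{\|f\|_{\mathbf{X}}=1}\int|f\cdot g|\,dx<\infty$; $\mathbf{X}$ is Köthe reflexive if $\mathbf{X}''=\mathbf{X}$ with equal norm. $\mathbf{X}$ is component-wise saturated if for every $k\in\{1,\dots,n\}$ and every $E\subseteq\mathbf{R}^d$ with $|E|>0$ there is $G\subseteq E$ with $|G|>0$ and $\mathbf{1}_Ge_k\in\mathbf{X}$. $\mathbf{X}[\mathcal{K}]$ is the set of $F\in L^0(\mathbf{R}^d;\mathcal{K})$ for which $S^0(\mathbf{R}^d;F)$ is a bounded subset of $\mathbf{X}$, with $\|F\|_{\mathbf{X}[\mathcal{K}]}:=\sup_{f\in S^0(\mathbf{R}^d;F)}\|f\|_{\mathbf{X}}$. **Averaging operators.** For $f$ integrable over $Q$, $T_Qf:=\langle f\rangle_Q\mathbf{1}_Q$ with $\langle f\rangle_Q=\frac1{|Q|}\int_Qf\,dx$. For $F\in L^0(\mathbf{R}^d;\mathcal{K})$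 with $S^0(\mathbf{R}^d;F\mathbf{1}_Q)$ bounded in $L^1(\mathbf{R}^d;\mathbf{F}^n)$ (where $F\mathbf{1}_Q$ equals $F$ on $Q$ and $\{0\}$ off $Q$), $T_QF(x):=\langle F\rangle_Q\mathbf{1}_Q(x)$ with $\langle F\rangle_Q:=\{\langle f\rangle_Q:f\in S^0(\mathbf{R}^d;F\mathbf{1}_Q)\}$. Writing $T_Q:\mathbf{X}\to\mathbf{X}$ or $T_Q:\mathbf{X}[\mathcal{K}]\to\mathbf{X}[\mathcal{K}]$ means $T_Q$ is well-defined on the whole space and satisfies a norm bound with finite constant; the smallest constant is the operator norm. $\mathbf{X}\in A$ means that $\mathbf{1}_Qu\in\mathbf{X}$ and $\mathbf{1}_Qu\in\mathbf{X}'$ for all cubes $Q$ and $u\in\mathbf{F}^n$, and $T_Q:\mathbf{X}\to\mathbf{X}$ for all cubes $Q$ with $[\mathbf{X}]_A:=\sup_Q\|T_Q\|_{\mathbf{X}\to\mathbf{X}}<\infty$. **Reducing matrices.** If $\mathbf{1}_Qu\in\mathbf{X}$ for all $u\in\mathbf{F}^n$, then $A_{\mathbf{X},Q}\in\mathbf{F}^{n\times n}$ denotes a Hermitian positive definite matrix (existing by the John ellipsoid theorem) with $\|\mathbf{1}_Qu\|_{\mathbf{X}}\le|A_{\mathbf{X},Q}u|\le n^{1/2}\|\mathbf{1}_Qu\|_{\mathbf{X}}$ for all $u\in\mathbf{F}^n$; similarly $A_{\mathbf{X}',Q}$. *)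

(* Defs.v *)
From HB Require Import structures.
From mathcomp Require Import all_boot all_order all_algebra.
From mathcomp Require Import all_classical all_reals all_analysis.
From mathcomp Require Import complex.
Set Implicit Arguments.
Unset Strict Implicit.
Unset Printing Implicit Defensive.
Import Order.TTheory GRing.Theory Num.Theory.
Import numFieldNormedType.Exports.
Local Open Scope classical_set_scope.
Local Open Scope ring_scope.

Section LebesgueMeasure.
Variable R : realType.
Notation Rm := (measurableTypeR R).

Section step.
Variables (d : nat) (m : {sigma_finite_measure set (d.-tuple Rm) -> \bar R}).

Definition cons_measure : set (d.+1.-tuple Rm) -> \bar R :=
  pushforward (@lebesgue_measure R \x m)%E (fun p => cons_tuple p.1 p.2).

Let cons_mfun : measurable_fun setT
  (fun p : Rm * d.-tuple Rm => cons_tuple p.1 p.2).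
Proof. exact: (measurable_cons measurable_fst measurable_snd). Qed.

Let cons_measure0 : cons_measure set0 = 0%E.
Proof. by rewrite /cons_measure /pushforward preimage_set0 measure0. Qed.

Let cons_measure_ge0 A : (0 <= cons_measure A)%E.
Proof. exact: measure_ge0. Qed.

Let cons_measure_sigma_additive : semi_sigma_additive cons_measure.
Proof.
pose g : {mfun (Rm * d.-tuple Rm)%type >-> d.+1.-tuple Rm} :=
  HB.pack (fun p : Rm * d.-tuple Rm => cons_tuple p.1 p.2)
    (isMeasurableFun.Build _ _ _ _ _ cons_mfun).
exact: (@measure_semi_sigma_additive _ _ _
  (pushforward (@lebesgue_measure R \x m)%E g)).
Qed.

HB.instance Definition _ := isMeasure.Build _ _ _ cons_measure
  cons_measure0 cons_measure_ge0 cons_measure_sigma_additive.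

Let cons_measure_sigma_finite : sigma_finite setT cons_measure.
Proof.
have /sigma_finiteP[F [TF ndF mF]] := sigma_finiteT (@lebesgue_measure R).
have /sigma_finiteP[G [TG ndG mG]] := sigma_finiteT m.
pose g (t : d.+1.-tuple Rm) : Rm * d.-tuple Rm := (thead t, behead_tuple t).
have mg : measurable_fun setT g.
  apply/measurable_fun_pair; first exact: measurable_tnth.
  exact: measurable_behead.
have gK p : g (cons_tuple p.1 p.2) = p.
  by case: p => x t; congr pair; apply: val_inj.
exists (fun k => g @^-1` (F k `*` G k)).
  apply/esym/seteqP; split => // t _.
  have [i _ Fi] : (\bigcup_i F i) (g t).1 by rewrite -TF.
  have [j _ Gj] : (\bigcup_i G i) (g t).2 by rewrite -TG.
  exists (maxn i j) => //; split.
    by apply/(subsetPset _ _): Fi; apply/ndF/leq_maxl.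
  by apply/(subsetPset _ _): Gj; apply/ndG/leq_maxr.
move=> k; have [mFk Fkoo] := mF k; have [mGk Gkoo] := mG k.
have mFG : measurable (F k `*` G k) by exact: measurableX.
split; first by rewrite -[X in measurable X]setTI; exact: mg.
rewrite /cons_measure /pushforward (_ : _ @^-1` _ = F k `*` G k).
  by rewrite product_measure1E// lte_mul_pinfty// ge0_fin_numE.
by apply/funext => p; rewrite -[in RHS](gK p).
Qed.

HB.instance Definition _ := Measure_isSigmaFinite.Build _ _ _ cons_measure
  cons_measure_sigma_finite.
End step.

(* Lebesgue measure on the Borel sets of R^d, as an iterated product. *)
Fixpoint borel_lebesgue (d : nat) :
    {sigma_finite_measure set (d.-tuple Rm) -> \bar R} :=
  if d is e.+1 then cons_measure (borel_lebesgue e)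
  else \d_(nil_tuple Rm).

(* R^d with its Lebesgue (that is, completed Borel) sigma-algebra, in
   Caratheodory's form, and Lebesgue measure on it. *)
Definition Rd (d : nat) := caratheodory_type ((borel_lebesgue d)^*)%mu.

Definition leb (d : nat) : set (Rd d) -> \bar R :=
  @completed_measure_extension _ _ _ (borel_lebesgue d).

HB.instance Definition _ d := Measure.on (@leb d).
HB.instance Definition _ d := Measurable.on (Rd d).

Definition box d (a b : d.-tuple R) : set (d.-tuple Rm) :=
  [set x | forall i, tnth a i <= (tnth x i : R) <= tnth b i].

Lemma measurable_box d (a b : d.-tuple R) : measurable (box a b).
Proof.
rewrite (_ : box a b = \bigcap_(i in [set: 'I_d])
    ((fun x : d.-tuple Rm => tnth x i) @^-1` `[tnth a i, tnth b i])).
  apply: fin_bigcap_measurable => // i _; rewrite -[X in measurable X]setTI.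
  by apply: measurable_tnth => //; exact: measurable_itv.
by apply/seteqP; split=> x /= h i; have := h i; rewrite /= in_itv/=; [|apply].
Qed.

Lemma borel_lebesgue_box d (a b : d.-tuple R) :
  (forall i, tnth a i <= tnth b i) ->
  borel_lebesgue d (box a b) = (\prod_(i < d) (tnth b i - tnth a i))%:E.
Proof.
elim: d a b => [|d IH] a b ab.
  rewrite big_ord0 /= diracE mem_set//; by case.
case/tupleP: a ab => a0 a; case/tupleP: b => b0 b ab.
rewrite /= /cons_measure /pushforward.
rewrite (_ : _ @^-1` _ = `[a0, b0]%classic `*` box a b); last first.
  apply/seteqP; split=> -[x t] /=.
    move=> h; split; first by have := h ord0; rewrite in_itv /= !tnth0.
    by move=> i; have := h (lift ord0 i); rewrite !tnthS.
  move=> [+ h] i; rewrite in_itv /= => h0.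
  by case: (unliftP ord0 i) => [j|] ->; rewrite ?tnthS ?tnth0.
rewrite product_measure1E//; [|exact: measurable_box].
rewrite IH => [|i]; last by have := ab (lift ord0 i); rewrite !tnthS.
have := ab ord0; rewrite !tnth0 => ab0.
have itvE : lebesgue_measure (`[a0, b0]%classic : set Rm) = (b0 - a0)%:E.
  rewrite lebesgue_measure_itv/= lte_fin; case: ltgtP ab0 => // -> _.
  by rewrite subrr.
transitivity ((b0 - a0)%:E * (\prod_(i < d) (tnth b i - tnth a i))%:E)%E.
  by congr (_ * _)%E.
rewrite -EFinM big_ord_recl !tnth0; congr (_ * _)%:E.
by apply: eq_bigr => i _; rewrite !tnthS.
Qed.

Lemma leb_box d (a b : d.-tuple R) : (forall i, tnth a i <= tnth b i) ->
  @leb d (box a b) = (\prod_(i < d) (tnth b i - tnth a i))%:E.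
Proof.
move=> ab; rewrite -borel_lebesgue_box//.
exact: (@measurable_mu_extE _ _ _ (borel_lebesgue d) _ (measurable_box a b)).
Qed.
End LebesgueMeasure.

(* The scalar field F is R or C; every notion below is uniform in the choice. *)
Variant scalar_kind := RealScalars | ComplexScalars.

Section Scalars.
Variables (R : realType) (k : scalar_kind).

Definition scalar : numFieldType := if k is RealScalars then R else R[i].

Definition sRe : scalar -> R :=
  match k return (if k is RealScalars then R : numFieldType else R[i]) -> R with
  | RealScalars => fun z => z
  | ComplexScalars => fun z => complex.Re z
  end.

Definition sIm : scalar -> R :=
  match k return (if k is RealScalars then R : numFieldType else R[i]) -> R with
  | RealScalars => fun=> 0
  | ComplexScalars => fun z => complex.Im z
  end.

(* a + ib; over F = R the second argument is ignored *)
Definition sMk : R -> R -> scalar :=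
  match k return R -> R -> (if k is RealScalars then R : numFieldType else R[i])
  with
  | RealScalars => fun a _ => a
  | ComplexScalars => fun a b => Complex a b
  end.

Definition sreal (a : R) : scalar := sMk a 0.

Definition sconj (z : scalar) : scalar := sMk (sRe z) (- sIm z).

(* the modulus as an element of R: the library norm takes values in F *)
Definition smod (z : scalar) : R := sRe `|z|.

End Scalars.

Section Cubes.
Variables (R : realType) (d : nat).

(* closed cubes of side length > 0; their boundaries are null sets *)
Record cube := Cube {
  corner : d.-tuple R ;
  side : R ;
  side_gt0 : 0 < side }.

Definition cube_set (Q : cube) : set (Rd R d) :=
  [set x | forall i, tnth (corner Q) i <= (tnth x i : R) <= tnth (corner Q) i + side Q].

Definition vol (A : set (Rd R d)) : R := fine (@leb R d A).

End Cubes.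
Coercion cube_set : cube >-> set.

Section DirectionalSpaces.
Variables (R : realType) (k : scalar_kind) (n d : nat).
Local Notation F := (scalar R k).
Local Notation V := 'cV[F]_n.
Local Notation Rd := (Rd R d).
Local Notation mu := (@leb R d).
Implicit Types (u v : V) (f g : Rd -> V) (Q : cube R d).

Definition dot u v : F := \sum_i u i 0 * sconj (v i 0).
Definition vnorm u : R := Num.sqrt (sRe (dot u u)).
Definition basis_vec (i : 'I_n) : V := delta_mx i 0.

Definition mx_opnorm (A : 'M[F]_n) : \bar R :=
  ereal_sup [set (vnorm (A *m u))%:E | u in [set u | vnorm u <= 1]].

(* In F, 0 < z holds iff z is real and positive, also when F = C. *)
Definition hermitian_posdef (A : 'M[F]_n) : Prop :=
  (forall i j, A i j = sconj (A j i)) /\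
  (forall u, u != 0 -> 0 < dot (A *m u) u).

(* Measurable functions into F^n; equality almost everywhere is not quotiented
   out. For a space X as in [directional_bfs] the ideal property forces the
   carrier and the norm to be invariant under equality almost everywhere. *)
Definition L0 : set (Rd -> V) :=
  [set f | forall i, measurable_fun setT (fun x => sRe (f x i 0)) /\
                     measurable_fun setT (fun x => sIm (f x i 0))].

Definition sintegrable (D : set Rd) (h : Rd -> F) : Prop :=
  mu.-integrable D (fun x => (sRe (h x))%:E) /\
  mu.-integrable D (fun x => (sIm (h x))%:E).

Definition sintegral (D : set Rd) (h : Rd -> F) : F :=
  sMk k (Rintegral mu D (fun x => sRe (h x)))
        (Rintegral mu D (fun x => sIm (h x))).

Definition vintegrable (D : set Rd) f : Prop :=
  forall i, sintegrable D (fun x => f x i 0).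

(* the function 1_D u *)
Definition ind (D : set Rd) u : Rd -> V := fun x => if x \in D then u else 0.

Definition avg Q f : V :=
  \col_i (sreal k (vol Q)^-1 * sintegral Q (fun x => f x i 0)).

Definition TQ Q f : Rd -> V := ind Q (avg Q f).

(* A vector space of functions with its norm; [fnorm] is only meaningful on
   the carrier. *)
Record fspace := FSpace {
  fcarrier :> (Rd -> V) -> Prop ;
  fnorm : (Rd -> V) -> R }.
Implicit Type X : fspace.

Definition segK u : set V := [set a *: u | a in [set a : F | `|a| <= 1]].

Record directional_bfs X : Prop := DirectionalBFS {
  dbfs_measurable : forall f, X f -> L0 f ;
  dbfs_zero : X (fun=> 0) ;
  dbfs_add : forall f g, X f -> X g -> X (fun x => f x + g x) ;
  dbfs_scale : forall (a : F) f, X f -> X (fun x => a *: f x) ;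
  dbfs_norm_ge0 : forall f, X f -> 0 <= fnorm X f ;
  dbfs_norm_eq0 : forall f, X f -> fnorm X f = 0 ->
    {ae mu, forall x, f x = 0} ;
  dbfs_norm_add : forall f g, X f -> X g ->
    fnorm X (fun x => f x + g x) <= fnorm X f + fnorm X g ;
  dbfs_norm_scale : forall (a : F) f, X f ->
    fnorm X (fun x => a *: f x) = smod a * fnorm X f ;
  dbfs_complete : forall s : nat -> Rd -> V, (forall m, X (s m)) ->
    (forall e, 0 < e -> exists N, forall p q, (N <= p)%N -> (N <= q)%N ->
       fnorm X (fun x => s p x - s q x) < e) ->
    exists2 f, X f & fnorm X (fun x => s m x - f x) @[m --> \oo] --> (0 : R) ;
  dbfs_ideal : forall f g, X f -> L0 g ->
    {ae mu, forall x, segK (g x) `<=` segK (f x)} ->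
    X g /\ fnorm X g <= fnorm X f ;
  dbfs_nondegenerate : forall g, L0 g ->
    (forall f, X f -> sintegrable setT (fun x => dot (f x) (g x)) /\
                      sintegral setT (fun x => dot (f x) (g x)) = 0) ->
    {ae mu, forall x, g x = 0} }.

Definition kothe_norm X g : \bar R :=
  ereal_sup [set (\int[mu]_x (smod (dot (f x) (g x)))%:E)%E
            | f in [set f | X f /\ fnorm X f = 1]].

Definition kothe X : fspace :=
  FSpace [set g | L0 g /\ (kothe_norm X g < +oo)%E]
         (fun g => fine (kothe_norm X g)).

Definition kothe_reflexive X : Prop :=
  fcarrier (kothe (kothe X)) = fcarrier X /\
  forall f, X f -> fnorm (kothe (kothe X)) f = fnorm X f.

Definition componentwise_saturated X : Prop :=
  forall (i : 'I_n) (E : set Rd), measurable E -> (0 < mu E)%E ->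
    exists G : set Rd, [/\ measurable G, G `<=` E, (0 < mu G)%E &
                          X (ind G (basis_vec i))].

(* 0 <= t <= 1 forces t to be real, also when F = C *)
Definition calK (K : set V) : Prop :=
  [/\ K !=set0,
      closed K,
      (forall u v (t : F), K u -> K v -> 0 <= t <= 1 ->
         K (t *: u + (1 - t) *: v)) &
      (forall u (a : F), K u -> `|a| = 1 -> K (a *: u))].

Definition L0K : set (Rd -> set V) :=
  [set S | (forall x, calK (S x)) /\
           (forall E : set V, open E -> measurable [set x | S x `&` E !=set0])].

Definition S0 (S : Rd -> set V) : set (Rd -> V) :=
  [set f | L0 f /\ {ae mu, forall x, S x (f x)}].

Definition XK X : set (Rd -> set V) :=
  [set S | [/\ L0K S, (forall f, S0 S f -> X f) &
               exists M : R, forall f, S0 S f -> fnorm X f <= M]].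

Definition XK_norm X (S : Rd -> set V) : \bar R :=
  ereal_sup [set (fnorm X f)%:E | f in S0 S].

(* the map S 1_Q *)
Definition truncK Q (S : Rd -> set V) : Rd -> set V :=
  fun x => if x \in (Q : set _) then S x else [set 0].

Definition L1_boundedK (S : Rd -> set V) : Prop :=
  exists M : R, forall f, S0 S f -> (\int[mu]_x (vnorm (f x))%:E <= M%:E)%E.

Definition avgK Q (S : Rd -> set V) : set V :=
  [set avg Q f | f in S0 (truncK Q S)].

Definition TQK Q (S : Rd -> set V) : Rd -> set V :=
  truncK Q (fun=> avgK Q S).

(* the C for which T_Q : X -> X is well defined and bounded with constant C *)
Definition TQ_bounds X Q : set R :=
  [set C | 0 <= C /\ forall f, X f ->
     [/\ vintegrable Q f, X (TQ Q f) & fnorm X (TQ Q f) <= C * fnorm X f]].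

Definition TQ_maps X Q : Prop := TQ_bounds X Q !=set0.

Definition TQ_norm X Q : \bar R := ereal_inf [set C%:E | C in TQ_bounds X Q].

Definition A_const X : \bar R := ereal_sup [set TQ_norm X Q | Q in [set: cube R d]].

Definition TQK_bounds X Q : set R :=
  [set C | 0 <= C /\ forall S, XK X S ->
     [/\ L1_boundedK (truncK Q S), XK X (TQK Q S) &
         (XK_norm X (TQK Q S) <= C%:E * XK_norm X S)%E]].

Definition TQK_maps X Q : Prop := TQK_bounds X Q !=set0.

Definition TQK_norm X Q : \bar R := ereal_inf [set C%:E | C in TQK_bounds X Q].

Definition AK_const X : \bar R := ereal_sup [set TQK_norm X Q | Q in [set: cube R d]].

Definition contains_indicators X : Prop := forall Q u, X (ind Q u).

Definition inA X : Prop :=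
  [/\ contains_indicators X, contains_indicators (kothe X),
      (forall Q, TQ_maps X Q) & (A_const X < +oo)%E].

Definition inAK X : Prop :=
  (forall Q, TQK_maps X Q) /\ (AK_const X < +oo)%E.

Definition is_reducing X Q (A : 'M[F]_n) : Prop :=
  hermitian_posdef A /\
  forall u, fnorm X (ind Q u) <= vnorm (A *m u) <=
            Num.sqrt n%:R * fnorm X (ind Q u).

(* A choice of a reducing matrix (the default is irrelevant, since one exists
   by the John ellipsoid theorem when X contains the 1_Q u). *)
Definition reducing_mx X Q : 'M[F]_n := xget 1%:M (is_reducing X Q).

Definition AR_const X : \bar R :=
  ereal_sup [set ((vol Q)^-1%:E *
                  mx_opnorm (reducing_mx X Q *m reducing_mx (kothe X) Q))%E
            | Q in [set: cube R d]].

Definition inAR X : Prop :=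
  [/\ contains_indicators X, contains_indicators (kothe X) &
      (AR_const X < +oo)%E].

Definition C1_consts X : set R :=
  [set C | 0 < C /\ forall Q u, exists2 v, v != 0 &
     (vol Q)^-1 * fnorm X (ind Q u) * fnorm (kothe X) (ind Q v)
       <= C * smod (dot u v)].

Definition C2_consts X : set R :=
  [set C | 0 < C /\ forall Q v, exists2 u, u != 0 &
     (vol Q)^-1 * fnorm X (ind Q u) * fnorm (kothe X) (ind Q v)
       <= C * smod (dot u v)].

Definition C1_cond X : Prop :=
  [/\ contains_indicators X, contains_indicators (kothe X) &
      C1_consts X !=set0].

Definition C2_cond X : Prop :=
  [/\ contains_indicators X, contains_indicators (kothe X) &
      C2_consts X !=set0].

Definition is_smallest (c : R) (A : set R) : Prop := A c /\ lbound A c.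

End DirectionalSpaces.

(* Main.v *)
From HB Require Import structures.
Require Import Defs.
From mathcomp Require Import all_boot all_order all_algebra.
From mathcomp Require Import all_classical all_reals all_analysis.
From mathcomp Require Import complex ring lra measurable_realfun perm.
Import Defs.
Set Implicit Arguments.
Unset Strict Implicit.
Unset Printing Implicit Defensive.
Import Order.TTheory GRing.Theory Num.Theory.
Import numFieldNormedType.Exports.
Local Open Scope classical_set_scope.
Local Open Scope ring_scope.

(** Averaging is self-adjoint: [|Q| dot (avg Q f) v] is the integral of
    [dot f v] over [Q]. For a pair of spaces [X], [Y], each the Koethe dual of
    the other, and containing the functions [1_Q u], this shows that a constant
    bounds [T_Q] on [X] if and only if it bounds [T_Q] on [Y]
    ([TQ_bounds_dual]). So one may work with symmetric pairs ([dual_pair]) and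
    prove each implication for one member only. All conditions are compared with
    the same one: [X] and [Y] contain the [1_Q u], and a single constant bounds
    every [T_Q] ([bounded_averages]).

    Pairs of vectors. The norm of [1_Q v] in [Y] is the supremum of
    [|Q| |dot (avg Q f) v|] over the unit ball of [X] ([ind_dual_norm_le]), so it
    equals [|Q|] times the dual norm of [v] with respect to [u |-> |1_Q u|_X], up
    to the bound of [T_Q]. Given [u], the Hahn-Banach theorem supplies a [v] in
    the dual ball with [dot u v = |1_Q u|_X], which is the vector required by the
    condition on pairs; the constant is the same in both directions
    ([TQ_bounds_test], [test_TQ_bounds]).

    Reducing matrices exist by John's theorem ([john]). They are self-adjoint and
    comparable to the two norms on constants, so the operator norm of their
    product measures [T_Q]; each of the two matrices costs a factor [sqrt n], in
    one of the two estimates only ([reducing_upper], [reducing_lower]).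

    Convex bodies. To pass from [T_Q] on [X] to [T_Q] on [X[K]] one has to bound
    every measurable selection [g] of the constant body [K = <F>_Q]. Choose in a
    small neighbourhood of [K] vectors [u_1, ..., u_n] of almost maximal
    determinant; by Cramer's rule all points of [K] have coordinates of modulus at
    most 2 with respect to them ([near_maximal_basis]). Then
    [g = \sum_j a_j 1_Q u_j] with [|a_j| <= 2], and the ideal property bounds [g]
    by [2 n] times the norms of the averages [1_Q u_j]. Conversely, a function [f]
    yields the segments [K(f)], and [f] itself is one of their selections
    ([TQK_bounds_TQ]). That the [1_Q u] belong to [X] follows from saturation, since
    [T_Q (1_G e_i)] is a multiple of [1_Q e_i], and that they belong to [Y] then
    follows by duality ([TQ_maps_indicators]).

    For [<F>_Q] to be a body at all, the set of integrals of the selections of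
    [F] must be closed ([aumann_integral_closed]). This is obtained by minimising
    a weighted [L^2] norm over the selections whose integral is near a given
    limit point. The parallelogram law makes a minimising sequence converge almost
    everywhere, and the weight comes from an integrable function dominating all
    selections at once, which exists because selections can be glued along
    measurable sets ([max_stable_dominated]). *)

(** * The scalar field *)

Section ScalarTheory.
Variables (R : realType) (k : scalar_kind).
Local Notation F := (scalar R k).
Implicit Types (z w : F) (a b : R).

(** The factor by which [sMk] multiplies the imaginary part. It lets one formula
    serve both fields. *)
Definition is_complex : R := if k is ComplexScalars then 1 else 0.

Lemma sMkE z : sMk k (sRe z) (sIm z) = z.
Proof. by case: k z => //= -[]. Qed.

Lemma sRe_sMk a b : sRe (sMk k a b) = a.
Proof. by case: k. Qed.

Lemma sIm_sMk a b : sIm (sMk k a b) = is_complex * b.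
Proof. by rewrite /is_complex; case: k => /=; rewrite ?mul0r ?mul1r. Qed.

Lemma sIm_sMk0 a : sIm (sMk k a 0) = 0.
Proof. by rewrite sIm_sMk mulr0. Qed.

Lemma is_complex_sIm z : is_complex * sIm z = sIm z.
Proof. by rewrite /is_complex; case: k z => /= z; rewrite ?mul0r ?mul1r. Qed.

Lemma sRe_is_zmod_morphism : zmod_morphism (@sRe R k).
Proof. by move=> z w; case: k z w => //= -[a b] [a' b']. Qed.
HB.instance Definition _ :=
  GRing.isZmodMorphism.Build F R (@sRe R k) sRe_is_zmod_morphism.

Lemma sIm_is_zmod_morphism : zmod_morphism (@sIm R k).
Proof. by move=> z w; case: k z w => //= [*|[a b] [a' b']]; rewrite ?subr0. Qed.
HB.instance Definition _ :=
  GRing.isZmodMorphism.Build F R (@sIm R k) sIm_is_zmod_morphism.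

Lemma sReM z w : sRe (z * w) = sRe z * sRe w - sIm z * sIm w.
Proof. by case: k z w => //= [z w|[a b] [a' b']]; rewrite ?mul0r ?subr0. Qed.

Lemma sImM z w : sIm (z * w) = sRe z * sIm w + sIm z * sRe w.
Proof. by case: k z w => //= [z w|[a b] [a' b']]; rewrite ?mul0r ?mulr0 ?addr0. Qed.

Lemma sRe1 : sRe (1 : F) = 1. Proof. by case: k. Qed.
Lemma sIm1 : sIm (1 : F) = 0. Proof. by case: k. Qed.

Lemma sextP z w : sRe z = sRe w -> sIm z = sIm w -> z = w.
Proof. by move=> rE iE; rewrite -(sMkE z) -(sMkE w) rE iE. Qed.

Lemma sreal_is_zmod_morphism : zmod_morphism (@sreal R k).
Proof.
by move=> a b; apply: sextP; rewrite raddfB /= /sreal ?sRe_sMk ?sIm_sMk0 ?subr0.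
Qed.
HB.instance Definition _ :=
  GRing.isZmodMorphism.Build R F (@sreal R k) sreal_is_zmod_morphism.

Lemma sreal_is_monoid_morphism : monoid_morphism (@sreal R k).
Proof.
split; first by apply: sextP; rewrite /sreal ?sRe_sMk ?sIm_sMk0 ?sRe1 ?sIm1.
by move=> a b; apply: sextP;
  rewrite ?sReM ?sImM /= /sreal ?sRe_sMk ?sIm_sMk0 ?mul0r ?mulr0 ?subr0 ?addr0.
Qed.
HB.instance Definition _ :=
  GRing.isMonoidMorphism.Build R F (@sreal R k) sreal_is_monoid_morphism.

Lemma sRe_sreal a : sRe (sreal k a) = a. Proof. exact: sRe_sMk. Qed.
Lemma sIm_sreal a : sIm (sreal k a) = 0. Proof. exact: sIm_sMk0. Qed.

Lemma sRe_sconj z : sRe (sconj z) = sRe z. Proof. exact: sRe_sMk. Qed.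
Lemma sIm_sconj z : sIm (sconj z) = - sIm z.
Proof. by rewrite /sconj sIm_sMk mulrN is_complex_sIm. Qed.

Lemma sconj_is_zmod_morphism : zmod_morphism (@sconj R k).
Proof.
by move=> z w; apply: sextP;
  rewrite raddfB /= ?sRe_sconj ?sIm_sconj raddfB /= ?opprD.
Qed.
HB.instance Definition _ :=
  GRing.isZmodMorphism.Build F F (@sconj R k) sconj_is_zmod_morphism.

Lemma sconj_is_monoid_morphism : monoid_morphism (@sconj R k).
Proof.
split; first by apply: sextP; rewrite ?sRe_sconj ?sIm_sconj ?sIm1 ?oppr0.
move=> z w; apply: sextP;
  rewrite ?sRe_sconj ?sIm_sconj ?sReM ?sImM ?sRe_sconj ?sIm_sconj; ring.
Qed.
HB.instance Definition _ :=
  GRing.isMonoidMorphism.Build F F (@sconj R k) sconj_is_monoid_morphism.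

Lemma sconjK : involutive (@sconj R k).
Proof. by move=> z; apply: sextP; rewrite ?sRe_sconj ?sIm_sconj ?opprK. Qed.

Lemma sconj_sreal a : sconj (sreal k a) = sreal k a.
Proof. by apply: sextP; rewrite ?sRe_sconj ?sIm_sconj // sIm_sreal oppr0. Qed.

Lemma normE z : `|z| = sreal k (smod z).
Proof.
by rewrite /smod /sreal; case: k z => //= -[a b].
Qed.

Lemma smodE z : smod z = Num.sqrt (sRe z ^+ 2 + sIm z ^+ 2).
Proof.
rewrite /smod; case: k z => /= [z|[a b]]; last by [].
by rewrite expr0n addr0 sqrtr_sqr.
Qed.

Lemma smod_sqr z : smod z ^+ 2 = sRe z ^+ 2 + sIm z ^+ 2.
Proof. by rewrite smodE sqr_sqrtr// addr_ge0 ?sqr_ge0. Qed.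

Lemma smod_ge0 z : 0 <= smod z. Proof. by rewrite smodE sqrtr_ge0. Qed.

Lemma sreal_inj : injective (@sreal R k).
Proof. by move=> a b /(congr1 (@sRe R k)); rewrite !sRe_sreal. Qed.

Lemma ler_sreal a b : (sreal k a <= sreal k b) = (a <= b).
Proof. by rewrite /sreal; case: k => //=; rewrite lecR. Qed.

Lemma ltr_sreal a b : (sreal k a < sreal k b) = (a < b).
Proof. by rewrite /sreal; case: k => //=; rewrite ltcR. Qed.

Lemma smodM z w : smod (z * w) = smod z * smod w.
Proof. by apply: sreal_inj; rewrite rmorphM /= -!normE normrM. Qed.

Lemma smod_eq0 z : (smod z == 0) = (z == 0).
Proof. by rewrite -(inj_eq sreal_inj) -normE raddf0 normr_eq0. Qed.

Lemma smod0 : smod (0 : F) = 0. Proof. by apply/eqP; rewrite smod_eq0. Qed.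
Lemma smod1 : smod (1 : F) = 1. Proof. by rewrite /smod normr1 sRe1. Qed.

Lemma smodD z w : smod (z + w) <= smod z + smod w.
Proof. by rewrite -ler_sreal raddfD /= -!normE ler_normD. Qed.

Lemma smodN z : smod (- z) = smod z. Proof. by rewrite /smod normrN. Qed.

Lemma smod_sreal a : smod (sreal k a) = `|a|.
Proof. by rewrite smodE sRe_sreal sIm_sreal expr0n addr0 sqrtr_sqr. Qed.

Lemma smod_sconj z : smod (sconj z) = smod z.
Proof. by rewrite !smodE sRe_sconj sIm_sconj sqrrN. Qed.

Lemma smodV z : smod z^-1 = (smod z)^-1.
Proof. by rewrite {1}/smod normfV normE -fmorphV sRe_sreal. Qed.

Lemma le_norm1 z : (`|z| <= 1) = (smod z <= 1).
Proof. by rewrite normE -[X in _ <= X](rmorph1 (@sreal R k)) ler_sreal. Qed.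

Lemma ge0_sreal z : 0 <= z -> z = sreal k (sRe z).
Proof.
by move=> z0; rewrite -{1}(ger0_norm z0) normE /smod ger0_norm.
Qed.

Lemma sRe_le_smod z : `|sRe z| <= smod z.
Proof.
by rewrite smodE -[leLHS]sqrtr_sqr ler_wsqrtr// lerDl sqr_ge0.
Qed.

Lemma sIm_le_smod z : `|sIm z| <= smod z.
Proof.
by rewrite smodE -[leLHS]sqrtr_sqr ler_wsqrtr// lerDr sqr_ge0.
Qed.

Lemma smod_le_ReIm z : smod z <= `|sRe z| + `|sIm z|.
Proof.
have le0 : 0 <= `|sRe z| + `|sIm z| by rewrite addr_ge0.
rewrite -(@ler_pXn2r _ 2) ?nnegrE ?smod_ge0// smod_sqr sqrrD.
rewrite !real_normK ?num_real//.
by rewrite -addrA [X in _ <= _ + X]addrC addrA lerDl mulrn_wge0 ?mulr_ge0.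
Qed.

Lemma mulz_conj z : z * sconj z = sreal k (smod z ^+ 2).
Proof.
apply: sextP; rewrite ?sReM ?sImM ?sRe_sconj ?sIm_sconj ?sRe_sreal ?sIm_sreal
  ?smod_sqr; ring.
Qed.

(** The conjugate of the sign of [z], with value 1 at 0 so as to be unimodular
    everywhere. *)
Definition sphase z : F := if z == 0 then 1 else sconj z * sreal k (smod z)^-1.

Lemma smod_sphase z : smod (sphase z) = 1.
Proof.
rewrite /sphase; case: eqP => [_|/eqP z0]; first exact: smod1.
rewrite smodM smod_sconj smod_sreal normfV ger0_norm ?smod_ge0// divff//.
by rewrite smod_eq0.
Qed.

Lemma sphaseM z : sphase z * z = sreal k (smod z).
Proof.
rewrite /sphase; case: eqP => [->|/eqP z0]; first by rewrite mulr0 smod0 raddf0.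
rewrite mulrAC [_ * z]mulrC mulz_conj -rmorphM /=; congr sreal.
by rewrite expr2 mulfK// smod_eq0.
Qed.

Lemma smod_sum (I : Type) (r : seq I) (P : pred I) (f : I -> F) :
  smod (\sum_(i <- r | P i) f i) <= \sum_(i <- r | P i) smod (f i).
Proof.
elim/big_ind2: _ => //; first by rewrite smod0.
by move=> z a w b za wb; rewrite (le_trans (smodD _ _))// lerD.
Qed.

Lemma smod_prod (I : Type) (r : seq I) (P : pred I) (f : I -> F) :
  smod (\prod_(i <- r | P i) f i) = \prod_(i <- r | P i) smod (f i).
Proof. exact: (big_morph _ smodM smod1). Qed.

End ScalarTheory.

(** * The inner product *)

Section DotTheory.
Variables (R : realType) (k : scalar_kind).
Local Notation F := (scalar R k).

Section vectors.
Variable n : nat.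
Local Notation V := 'cV[F]_n.
Implicit Types (u v w : V) (c : F).

Lemma dotDl u v w : dot (u + v) w = dot u w + dot v w.
Proof. by rewrite /dot -big_split /=; apply: eq_bigr => i _; rewrite mxE mulrDl. Qed.

Lemma dotZl c u w : dot (c *: u) w = c * dot u w.
Proof. by rewrite /dot big_distrr /=; apply: eq_bigr => i _; rewrite mxE mulrA. Qed.

Lemma dotC u v : dot u v = sconj (dot v u).
Proof.
rewrite /dot raddf_sum /=; apply: eq_bigr => i _.
by rewrite rmorphM /= sconjK mulrC.
Qed.

Lemma dotDr u v w : dot w (u + v) = dot w u + dot w v.
Proof. by rewrite dotC dotDl raddfD /= -!(dotC w). Qed.

Lemma dotZr c u w : dot w (c *: u) = sconj c * dot w u.
Proof. by rewrite dotC dotZl rmorphM /= -(dotC w). Qed.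

Lemma dot0l w : dot 0 w = 0.
Proof. by rewrite -(scale0r 0) dotZl mul0r. Qed.

Lemma dot0r w : dot w 0 = 0.
Proof. by rewrite dotC dot0l raddf0. Qed.

Lemma dotNl u w : dot (- u) w = - dot u w.
Proof. by rewrite -scaleN1r dotZl mulN1r. Qed.

Lemma dotNr u w : dot w (- u) = - dot w u.
Proof. by rewrite dotC dotNl raddfN /= -dotC. Qed.

Lemma dotBl u v w : dot (u - v) w = dot u w - dot v w.
Proof. by rewrite dotDl dotNl. Qed.

Lemma dotBr u v w : dot w (u - v) = dot w u - dot w v.
Proof. by rewrite dotC dotBl raddfB /= -!(dotC w). Qed.

Lemma dot_basis u i : dot u (basis_vec R k i) = u i 0.
Proof.
rewrite /dot (bigD1 i)//= big1 ?addr0 => [|j ji].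
  by rewrite /basis_vec mxE !eqxx rmorph1 mulr1.
by rewrite /basis_vec mxE (negbTE ji) raddf0 mulr0.
Qed.

Lemma smod_dotC u v : smod (dot u v) = smod (dot v u).
Proof. by rewrite dotC smod_sconj. Qed.

Lemma sRe_dotuu u : sRe (dot u u) = \sum_i smod (u i 0) ^+ 2.
Proof.
by rewrite /dot raddf_sum; apply: eq_bigr => i _; rewrite /= mulz_conj sRe_sreal.
Qed.

Lemma vnorm_sqr u : vnorm u ^+ 2 = \sum_i smod (u i 0) ^+ 2.
Proof.
rewrite /vnorm sqr_sqrtr sRe_dotuu// sumr_ge0// => i _; exact: sqr_ge0.
Qed.

Lemma dotuu u : dot u u = sreal k (vnorm u ^+ 2).
Proof.
by rewrite vnorm_sqr /dot raddf_sum; apply: eq_bigr => i _; rewrite /= mulz_conj.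
Qed.

Lemma vnorm_ge0 u : 0 <= vnorm u. Proof. exact: sqrtr_ge0. Qed.

Lemma vnorm_eq0 u : (vnorm u == 0) = (u == 0).
Proof.
apply/eqP/eqP => [u0|->]; last by rewrite /vnorm dot0l raddf0 sqrtr0.
apply/matrixP => i j; rewrite ord1 mxE; apply/eqP; rewrite -smod_eq0.
move: (vnorm_sqr u); rewrite u0 expr0n /= => /esym/eqP.
by rewrite psumr_eq0 => [/allP/(_ i (mem_index_enum _))|l _];
  rewrite /= ?sqrf_eq0 ?sqr_ge0.
Qed.

Lemma vnorm0 : vnorm (0 : V) = 0.
Proof. by apply/eqP; rewrite vnorm_eq0. Qed.

Lemma vnorm_gt0 u : (0 < vnorm u) = (u != 0).
Proof. by rewrite lt_def vnorm_ge0 andbT vnorm_eq0. Qed.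

Lemma vnormZ c u : vnorm (c *: u) = smod c * vnorm u.
Proof.
apply/eqP; rewrite -(@eqrXn2 _ 2)// ?mulr_ge0 ?vnorm_ge0 ?smod_ge0//.
rewrite exprMn !vnorm_sqr mulr_sumr; apply/eqP; apply: eq_bigr => i _.
by rewrite mxE smodM exprMn.
Qed.

Lemma smod_coord_le u i : smod (u i 0) <= vnorm u.
Proof.
rewrite -(@ler_pXn2r _ 2) ?nnegrE ?smod_ge0 ?vnorm_ge0// vnorm_sqr (bigD1 i)//=.
by rewrite lerDl sumr_ge0// => j _; exact: sqr_ge0.
Qed.

Lemma vnorm_le_sum u : vnorm u <= \sum_i smod (u i 0).
Proof.
have s0 : 0 <= \sum_i smod (u i 0) by apply: sumr_ge0 => i _; exact: smod_ge0.
rewrite -(@ler_pXn2r _ 2) ?nnegrE ?vnorm_ge0// vnorm_sqr.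
rewrite [leRHS]expr2 mulr_suml; apply: ler_sum => i _; rewrite expr2.
apply: ler_wpM2l; first exact: smod_ge0.
by rewrite (bigD1 i)//= lerDl sumr_ge0// => j _; exact: smod_ge0.
Qed.

(** Cauchy-Schwarz, from the squared norm of the part of [u] orthogonal to [v]. *)
Lemma dot_le u v : smod (dot u v) <= vnorm u * vnorm v.
Proof.
have [->|v0] := eqVneq v 0; first by rewrite dot0r smod0 vnorm0 mulr0.
have nv0 : 0 < vnorm v by rewrite vnorm_gt0.
pose c := dot u v * sreal k (vnorm v ^+ 2)^-1.
have cv : dot (u - c *: v) v = 0.
  rewrite dotBl dotZl dotuu /c -mulrA -rmorphM /= mulVf ?rmorph1 ?mulr1 ?subrr//.
  by rewrite sqrf_eq0 gt_eqF.
have : 0 <= vnorm (u - c *: v) ^+ 2 by exact: sqr_ge0.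
have -> : vnorm (u - c *: v) ^+ 2 = vnorm u ^+ 2 - smod (dot u v) ^+ 2 / vnorm v ^+ 2.
  apply: (@sreal_inj R k); rewrite -dotuu.
  rewrite dotBr dotZr cv mulr0 subr0 dotBl dotuu dotZl [dot v u]dotC.
  by rewrite raddfB /= [sreal k (_ / _)]rmorphM /= /c -mulz_conj mulrAC.
rewrite subr_ge0 ler_pdivrMr ?exprn_gt0// -exprMn.
by rewrite ler_pXn2r ?nnegrE ?mulr_ge0 ?vnorm_ge0 ?smod_ge0.
Qed.

Lemma vnormD_sqr u v :
  vnorm (u + v) ^+ 2 = vnorm u ^+ 2 + vnorm v ^+ 2 + (sRe (dot u v)) *+ 2.
Proof.
rewrite -[LHS](@sRe_sreal R k) -dotuu dotDl !dotDr !dotuu !raddfD /= !sRe_sreal.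
by rewrite [dot v u]dotC sRe_sconj mulr2n; ring.
Qed.

End vectors.

Definition adjmx m n (A : 'M[F]_(m, n)) : 'M[F]_(n, m) := (map_mx (@sconj R k) A)^T.

Lemma dot_mulmx m n (A : 'M[F]_(m, n)) (u : 'cV[F]_n) (v : 'cV[F]_m) :
  dot (A *m u) v = dot u (adjmx A *m v).
Proof.
rewrite /dot.
under eq_bigr do rewrite mxE big_distrl /=.
rewrite exchange_big /=; apply: eq_bigr => j _.
rewrite mxE raddf_sum big_distrr /=; apply: eq_bigr => i _.
by rewrite !mxE rmorphM /= sconjK mulrCA mulrA.
Qed.

Lemma adjmxK m n (A : 'M[F]_(m, n)) : adjmx (adjmx A) = A.
Proof. by apply/matrixP => i j; rewrite !mxE sconjK. Qed.

Lemma adjmxM m n p (A : 'M[F]_(m, n)) (B : 'M[F]_(n, p)) :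
  adjmx (A *m B) = adjmx B *m adjmx A.
Proof. by rewrite /adjmx map_mxM trmx_mul. Qed.

End DotTheory.

(** * The Hahn-Banach theorem in finite dimension *)

Section HahnBanach.
Variables (R : realType) (k : scalar_kind) (n : nat).
Local Notation F := (scalar R k).
Local Notation V := 'cV[F]_n.
Implicit Types (u v w e : V) (p q N : V -> R).

Definition sublinear p : Prop :=
  (forall u v, p (u + v) <= p u + p v) /\
  (forall (t : R) u, 0 <= t -> p (sreal k t *: u) = t * p u).

(** A sublinear functional below [p] whose value at [- e] is at most [- p e];
    being sublinear it is then additive in the direction [e]. Doing this for every
    vector of a real basis leaves a linear functional. *)
Definition linearize_along p e w : R :=
  inf [set p (w + sreal k t *: e) - t * p e | t in [set t : R | 0 <= t]].

Lemma sublinear0 p : sublinear p -> p 0 = 0.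
Proof. by case=> _ /(_ 0 0 (lexx _)); rewrite scaler0 mul0r. Qed.

Lemma sublinear_opp p w : sublinear p -> - p (- w) <= p w.
Proof.
move=> sp; have := sp.1 w (- w); rewrite subrr sublinear0//.
by rewrite -lerBlDr sub0r.
Qed.

Lemma linearize_along_lb p e w : sublinear p ->
  lbound [set p (w + sreal k t *: e) - t * p e | t in [set t : R | 0 <= t]]
    (- p (- w)).
Proof.
move=> sp _ [t /= t0 <-]; have := sp.1 (w + sreal k t *: e) (- w).
by rewrite addrAC subrr add0r sp.2//; lra.
Qed.

Lemma linearize_along_le p e w t : sublinear p -> 0 <= t ->
  linearize_along p e w <= p (w + sreal k t *: e) - t * p e.
Proof.
move=> sp t0; apply: ge_inf; last by exists t.
by exists (- p (- w)); exact: linearize_along_lb.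
Qed.

Lemma le_linearize_along p e w c :
  (forall t, 0 <= t -> c <= p (w + sreal k t *: e) - t * p e) ->
  c <= linearize_along p e w.
Proof.
move=> H; apply: lb_le_inf; last by move=> _ [t t0 <-]; exact: H.
by exists (p (w + sreal k 0 *: e) - 0 * p e), 0 => /=.
Qed.

Lemma linearize_along_le_self p e w : sublinear p ->
  linearize_along p e w <= p w.
Proof.
move=> sp; apply: (le_trans (linearize_along_le e w sp (lexx 0))).
by rewrite raddf0 scale0r addr0 mul0r subr0.
Qed.

Lemma linearize_along_opp p e : sublinear p ->
  linearize_along p e (- e) <= - p e.
Proof.
move=> sp; apply: (le_trans (linearize_along_le e (- e) sp ler01)).
by rewrite rmorph1 scale1r addNr mul1r sublinear0// sub0r.
Qed.

Lemma linearize_along_sublinear p e : sublinear p ->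
  sublinear (linearize_along p e).
Proof.
move=> sp; split=> [u v|s u].
  rewrite -lerBlDr; apply: le_linearize_along => t t0.
  rewrite lerBlDr -lerBlDl; apply: le_linearize_along => s s0.
  rewrite lerBlDl.
  apply: (le_trans (linearize_along_le e (u + v) sp (addr_ge0 t0 s0))).
  have := sp.1 (u + sreal k t *: e) (v + sreal k s *: e).
  by rewrite raddfD scalerDl addrACA; lra.
rewrite le_eqVlt => /predU1P[<-|s0].
  rewrite raddf0 scale0r mul0r; apply/eqP; rewrite eq_le; apply/andP; split.
    by rewrite (le_trans (linearize_along_le_self _ _ _))// sublinear0.
  apply: le_linearize_along => t t0.
  by rewrite add0r sp.2// subrr.
have s0' := ltW s0; have sn0 : s != 0 by rewrite gt_eqF.
apply/eqP; rewrite eq_le; apply/andP; split.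
  rewrite -ler_pdivrMl//; apply: le_linearize_along => t t0.
  rewrite ler_pdivrMl//.
  apply: (le_trans (linearize_along_le e _ sp (mulr_ge0 s0' t0))).
  rewrite rmorphM -scalerA -scalerDr sp.2//.
  by rewrite mulrBr mulrA.
apply: le_linearize_along => t t0.
have := linearize_along_le e u sp (divr_ge0 t0 s0').
move=> /(ler_wpM2l s0'); rewrite mulrBr -sp.2// scalerDr scalerA -rmorphM.
have st : s * (t / s) = t by rewrite mulrCA divff// mulr1.
by rewrite /= [s * (_ * p e)]mulrA st.
Qed.

(** Linearising along one vector keeps what was achieved for the earlier ones,
    since the functional only decreases. *)
Lemma sublinear_minorant (s : seq V) p : sublinear p ->
  exists q, [/\ sublinear q, forall w, q w <= p w &
                {in s, forall e, q (- e) <= - q e}].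
Proof.
move=> sp; elim: s => [|e s [q [sq qp qs]]]; first by exists p; split.
exists (linearize_along q e); split.
- exact: linearize_along_sublinear.
- by move=> w; apply: le_trans (qp w); exact: linearize_along_le_self.
- move=> e'; rewrite inE => /predU1P[->|e's].
    apply: (le_trans (linearize_along_opp _ sq)).
    by rewrite lerN2; exact: linearize_along_le_self.
  apply: (le_trans (linearize_along_le_self _ _ sq)).
  apply: (le_trans (qs _ e's)).
  by rewrite lerN2; exact: linearize_along_le_self.
Qed.

(** Zero over the reals, where the vectors [imag_unit *: e_i] below then add
    nothing to the basis. *)
Definition imag_unit : F := sMk k 0 1.

Lemma scalar_decomp (z : F) : z = sreal k (sRe z) + sreal k (sIm z) * imag_unit.
Proof.
apply: sextP; rewrite raddfD /= ?sReM ?sImM ?sRe_sreal ?sIm_sreal sRe_sMk sIm_sMk.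
  by rewrite mulr0 mul0r subr0 addr0.
by rewrite mul0r addr0 mulr1 add0r mulrC is_complex_sIm.
Qed.

Record seminorm N : Prop := Seminorm {
  seminormD : forall u v, N (u + v) <= N u + N v ;
  seminormZ : forall (c : F) u, N (c *: u) = smod c * N u }.

Lemma seminorm_ge0 N u : seminorm N -> 0 <= N u.
Proof.
move=> sN; have := seminormD sN u (- u); rewrite subrr.
have -> : N 0 = 0 by rewrite -(scale0r 0) seminormZ// smod0 mul0r.
by rewrite -scaleN1r seminormZ// smodN smod1 mul1r; lra.
Qed.

Lemma seminorm0 N : seminorm N -> N 0 = 0.
Proof. by move=> sN; rewrite -(scale0r 0) seminormZ// smod0 mul0r. Qed.

Lemma seminorm_sublinear N : seminorm N -> sublinear N.
Proof.
move=> sN; split; first exact: seminormD.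
by move=> t u t0; rewrite seminormZ// smod_sreal ger0_norm.
Qed.

Lemma seminorm_sum N (I : Type) (r : seq I) (f : I -> V) : seminorm N ->
  N (\sum_(i <- r) f i) <= \sum_(i <- r) N (f i).
Proof.
move=> sN; elim/big_ind2: _ => //; first by rewrite seminorm0.
by move=> u a v b ua vb; rewrite (le_trans (seminormD sN _ _))// lerD.
Qed.

Definition dual_ball N : set V := [set v | forall w, smod (dot w v) <= N w].

(** The vectors [w] with [q (- w) <= - q w] are those in whose direction [q] is
    additive, and they form a real subspace; it contains a real basis. *)
Lemma sublinear_linear (q : V -> R) : sublinear q ->
  (forall i, q (- basis_vec R k i) <= - q (basis_vec R k i)) ->
  (forall i, q (- (imag_unit *: basis_vec R k i)) <= - q (imag_unit *: basis_vec R k i)) ->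
  exists v, forall w, sRe (dot w v) = q w.
Proof.
move=> sq qe qi.
pose T w := q (- w) <= - q w.
have qT x w : T w -> q (x + w) = q x + q w.
  move=> Tw; apply/eqP; rewrite eq_le sq.1 /=.
  have := sq.1 (x + w) (- w); rewrite addrK.
  by move: Tw; rewrite /T; lra.
have TD w w' : T w -> T w' -> T (w + w').
  rewrite /T => Tw Tw'; rewrite opprD.
  have := sq.1 (- w) (- w'); have := sq.1 w w'; lra.
have TN w : T w -> T (- w) by rewrite /T opprK; lra.
have T0 : T 0 by rewrite /T oppr0 sublinear0// oppr0.
have TZ t w : T w -> T (sreal k t *: w) /\ q (sreal k t *: w) = t * q w.
  move=> Tw.
  have Tp s : 0 <= s -> T (sreal k s *: w).
    move=> s0; rewrite /T -scalerN !sq.2// -mulrN.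
    exact: ler_wpM2l.
  have [t0|t0] := leP 0 t; first by split; [exact: Tp|rewrite sq.2].
  have t1 : 0 <= - t by rewrite oppr_ge0 ltW.
  have E : sreal k t *: w = - (sreal k (- t) *: w).
    by rewrite raddfN scaleNr opprK.
  split; first by rewrite E; apply: TN; exact: Tp.
  have := qT (sreal k t *: w) _ (Tp _ t1).
  rewrite {1}E addrC subrr sublinear0// (sq.2 (- t))//; lra.
pose v : V := \col_j sMk k (q (basis_vec R k j)) (q (imag_unit *: basis_vec R k j)).
pose tm w i := sreal k (sRe (w i 0)) *: basis_vec R k i +
               sreal k (sIm (w i 0)) *: (imag_unit *: basis_vec R k i).
have wE w : w = \sum_i tm w i.
  apply/matrixP => i j; rewrite ord1 summxE (bigD1 i)//= big1 ?addr0.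
    rewrite !mxE !eqxx /= mulr1 mulr1; exact: scalar_decomp.
  by move=> l li; rewrite !mxE eq_sym (negbTE li) /= !mulr0 addr0.
have qtm w i : T (tm w i) /\ q (tm w i) = sRe (w i 0) * q (basis_vec R k i) +
                 sIm (w i 0) * q (imag_unit *: basis_vec R k i).
  have [Ta qa] := TZ (sRe (w i 0)) _ (qe i).
  have [Tb qb] := TZ (sIm (w i 0)) _ (qi i).
  by split; [exact: TD|rewrite /tm qT// qa qb].
exists v => w.
have qsum : q (\sum_i tm w i) = \sum_i q (tm w i) /\ T (\sum_i tm w i).
  elim/big_rec2: _ => [|i y1 y2 _ [IH IT]]; first by rewrite sublinear0.
  split; last by apply: TD => //; exact: (qtm _ _).1.
  by rewrite addrC qT ?IH 1?addrC//; exact: (qtm _ _).1.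
rewrite [in RHS](wE w) qsum.1 /dot raddf_sum /=; apply: eq_bigr => i _.
rewrite (qtm w i).2 sReM sRe_sconj sIm_sconj mxE sRe_sMk sIm_sMk mulrN opprK.
by rewrite mulrA [sIm _ * is_complex _ _]mulrC is_complex_sIm.
Qed.

(** Linearising first along [u] itself forces the value [N u] at [u]. The real
    part of the functional is bounded by [N]; rotating the argument by a phase
    bounds the modulus. *)
Lemma hahn_banach N u : seminorm N ->
  exists2 v, dual_ball N v & dot u v = sreal k (N u).
Proof.
move=> sN; have slN := seminorm_sublinear sN.
have [q [sq qN qs]] := sublinear_minorant
  ([seq basis_vec R k i | i <- enum 'I_n] ++
   [seq imag_unit *: basis_vec R k i | i <- enum 'I_n])
  (linearize_along_sublinear u slN).
have [||v vq] := sublinear_linear sq.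
- by move=> i; apply: qs; rewrite mem_cat map_f ?mem_enum.
- by move=> i; apply: qs; rewrite mem_cat [X in _ || X]map_f ?mem_enum ?orbT.
have qN' w : q w <= N w by apply: (le_trans (qN w)); exact: linearize_along_le_self.
have Dv : dual_ball N v.
  move=> w; pose s := sphase (dot w v).
  have -> : smod (dot w v) = sRe (dot (s *: w) v).
    by rewrite dotZl sphaseM sRe_sreal.
  by rewrite vq (le_trans (qN' _))// seminormZ// smod_sphase mul1r.
exists v => //.
have uv : sRe (dot u v) = N u.
  apply/eqP; rewrite eq_le vq qN' /=.
  have := sublinear_opp u sq; have := qN (- u); have := linearize_along_opp u slN.
  lra.
(* the modulus of [dot u v] is at most its real part, so it is real *)
have := Dv u; rewrite -(@ler_pXn2r _ 2) ?nnegrE ?smod_ge0 ?seminorm_ge0//.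
rewrite smod_sqr uv gerDl => i0.
have {}i0 : sIm (dot u v) = 0.
  by apply/eqP; rewrite -sqrf_eq0 eq_le i0 sqr_ge0.
by apply: sextP; rewrite ?sRe_sreal ?sIm_sreal.
Qed.

End HahnBanach.

(** * Extreme values and equivalence of norms *)

Section MatrixOptimisation.
Variables (R : realType) (k : scalar_kind).
Local Notation F := (scalar R k).

Section continuity.
Variable T : topologicalType.
Implicit Types g h : T -> F.

Definition scontinuous h : Prop :=
  continuous (fun x => sRe (h x) : R) /\ continuous (fun x => sIm (h x) : R).

Lemma scontinuous_cst (c : F) : scontinuous (fun=> c).
Proof. by split=> x; exact: cvg_cst. Qed.

Lemma scontinuousD g h : scontinuous g -> scontinuous h ->
  scontinuous (fun x => g x + h x).
Proof.
move=> [gr gi] [hr hi]; split=> x.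
  have -> : (fun x => sRe (g x + h x)) = (fun x => sRe (g x) + sRe (h x)).
    by apply/funext => y; rewrite raddfD.
  by apply: cvgD; [exact: gr|exact: hr].
have -> : (fun x => sIm (g x + h x)) = (fun x => sIm (g x) + sIm (h x)).
  by apply/funext => y; rewrite raddfD.
by apply: cvgD; [exact: gi|exact: hi].
Qed.

Lemma scontinuousM g h : scontinuous g -> scontinuous h ->
  scontinuous (fun x => g x * h x).
Proof.
move=> [gr gi] [hr hi]; split=> x.
  rewrite (_ : (fun x => _) = (fun x => sRe (g x) * sRe (h x) - sIm (g x) * sIm (h x))).
    by apply: cvgB; apply: cvgM; [exact: gr|exact: hr|exact: gi|exact: hi].
  by apply/funext => y; rewrite sReM.
rewrite (_ : (fun x => _) = (fun x => sRe (g x) * sIm (h x) + sIm (g x) * sRe (h x))).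
  by apply: cvgD; apply: cvgM; [exact: gr|exact: hi|exact: gi|exact: hr].
by apply/funext => y; rewrite sImM.
Qed.

Lemma scontinuous_sum (I : Type) (r : seq I) (P : pred I) (h : I -> T -> F) :
  (forall i, P i -> scontinuous (h i)) ->
  scontinuous (fun x => \sum_(i <- r | P i) h i x).
Proof.
move=> ch; rewrite (_ : (fun x => _) = \big[(fun a b => fun x => a x + b x)/(fun=> 0)]_(i <- r | P i) h i).
  elim/big_ind: _ => //; [exact: scontinuous_cst|exact: scontinuousD].
apply/funext => x; elim/big_rec2: _ => // i f1 f2 _ ->; by [].
Qed.

Lemma scontinuous_prod (I : Type) (r : seq I) (P : pred I) (h : I -> T -> F) :
  (forall i, P i -> scontinuous (h i)) ->
  scontinuous (fun x => \prod_(i <- r | P i) h i x).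
Proof.
move=> ch; rewrite (_ : (fun x => _) = \big[(fun a b => fun x => a x * b x)/(fun=> 1)]_(i <- r | P i) h i).
  elim/big_ind: _ => //; [exact: scontinuous_cst|exact: scontinuousM].
apply/funext => x; elim/big_rec2: _ => // i f1 f2 _ ->; by [].
Qed.

Lemma scontinuous_det n (B : T -> 'M[F]_n) :
  (forall i j, scontinuous (fun x => B x i j)) ->
  scontinuous (fun x => \det (B x)).
Proof.
move=> cB; apply: scontinuous_sum => s _; apply: scontinuousM.
  exact: scontinuous_cst.
by apply: scontinuous_prod => i _; exact: cB.
Qed.

Lemma continuous_smod h : scontinuous h -> continuous (fun x => smod (h x) : R).
Proof.
move=> [hr hi] x.
rewrite (_ : (fun x => _) = Num.sqrt \o (fun x => sRe (h x) * sRe (h x) + sIm (h x) * sIm (h x))).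
  apply: (@continuous_comp _ _ _ _ Num.sqrt); last exact: sqrt_continuous.
  by apply: cvgD; apply: cvgM; [exact: hr|exact: hr|exact: hi|exact: hi].
by apply/funext => y; rewrite /= smodE !expr2.
Qed.

(** Continuity from a modulus [G], used for norms known only through their
    values on the basis. *)
Lemma continuous_modulus (h : T -> R) (G : T -> T -> R) :
  (forall x, continuous (G x)) -> (forall x, G x x = 0) ->
  (forall x y, `|h x - h y| <= G x y) -> continuous h.
Proof.
move=> cG G0 hG x; apply/cvgrPdist_lt => e e0.
have : \forall y \near x, G x y < e.
  by apply: (cvgr_lt (G x x)); [exact: cG|rewrite G0].
by apply: filterS => y /=; exact: le_lt_trans.
Qed.

Lemma continuousMcst (h : T -> R) (c : R) :
  continuous h -> continuous (fun x => h x * c).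
Proof. by move=> ch x; apply: cvgMr_tmp; exact: ch. Qed.

Lemma continuous_sumr (I : Type) (r : seq I) (h : I -> T -> R) :
  (forall i, continuous (h i)) -> continuous (fun x => \sum_(i <- r) h i x).
Proof.
by move=> ch x; apply: cvg_big => [|i _]; [exact: add_continuous|exact: ch].
Qed.

End continuity.

Section parametrisation.
Variables p q : nat.
Local Notation idx := ('I_p * 'I_q * bool)%type.

(** Matrices over either field are parametrised by real row vectors, whose
    bounded closed sets are compact. Over the reals the second half of the
    coordinates is ignored. *)
Definition mx_of_coords (x : 'rV[R]_#|{: idx}|) : 'M[F]_(p, q) :=
  \matrix_(i, j) sMk k (x 0 (enum_rank (i, j, true))) (x 0 (enum_rank (i, j, false))).

Definition coords_of_mx (A : 'M[F]_(p, q)) : 'rV[R]_#|{: idx}| :=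
  \row_l let: (i, j, b) := enum_val l in
         if b then sRe (A i j) else sIm (A i j).

Lemma coords_of_mxK A : mx_of_coords (coords_of_mx A) = A.
Proof. by apply/matrixP => i j; rewrite !mxE !enum_rankK sMkE. Qed.

Lemma scontinuous_mx_of_coords i j : scontinuous (fun x => mx_of_coords x i j).
Proof.
split=> x.
  rewrite (_ : (fun x => _) = (fun x : 'rV[R]_#|{: idx}| => x 0 (enum_rank (i, j, true)))).
    exact: coord_continuous.
  by apply/funext => y; rewrite !mxE sRe_sMk.
rewrite (_ : (fun x => _) = (fun x : 'rV[R]_#|{: idx}| =>
   is_complex R k * x 0 (enum_rank (i, j, false)))).
  exact: (cvgM (@cvg_cst _ (is_complex R k) _ _ _) (@coord_continuous _ _ _ _ _ _)).
by apply/funext => y; rewrite !mxE sIm_sMk.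
Qed.

Lemma coords_of_mx_le (A : 'M[F]_(p, q)) (c : R) : 0 <= c ->
  (forall i j, smod (A i j) <= c) -> `|coords_of_mx A| <= c.
Proof.
move=> c0 Ac; rewrite -[`|_|]/(mx_norm _).
have [->//|/mx_norm_neq0[[i l] ->]] := eqVneq (mx_norm (coords_of_mx A)) 0.
rewrite mxE /=; case: (enum_val l) => -[i' j] b.
case: b; apply: le_trans (Ac i' j).
  exact: sRe_le_smod.
exact: sIm_le_smod.
Qed.

(** The preimage of [P] in coordinates need not be bounded, because over the
    reals half of the coordinates are ignored; the maximum is therefore taken over
    a ball, which suffices because [coords_of_mx] maps [P] into it. *)
Lemma mx_extreme_value (P : set 'M[F]_(p, q)) (f : 'M[F]_(p, q) -> R) (c : R) :
  P !=set0 -> (forall A, P A -> forall i j, smod (A i j) <= c) ->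
  closed (mx_of_coords @^-1` P) ->
  continuous (f \o mx_of_coords) ->
  exists2 A, P A & forall B, P B -> f B <= f A.
Proof.
move=> [A0 PA0] Pc cP cf.
pose c' := Num.max c 0.
have c'0 : 0 <= c' by rewrite le_max lexx orbT.
have cc' : c <= c' by rewrite le_max lexx.
pose K := [set x : 'rV[R]_#|{: idx}| | `|x| <= c'] `&` (mx_of_coords @^-1` P).
have PK A : P A -> K (coords_of_mx A).
  move=> PA; split; last by rewrite /= coords_of_mxK.
  by apply: coords_of_mx_le => // i j; exact: le_trans (Pc _ PA _ _) _.
have cK : compact K.
  apply: bounded_closed_compact.
    exists c'; split; first exact: num_real.
    by move=> M cM x [xc _]; apply: le_trans xc _; exact: ltW.
  apply: closedI => //.
  apply: (@closed_comp _ _ (fun x : 'rV[R]_#|{: idx}| => `|x|) [set y | y <= c']).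
    by move=> x _; exact: norm_continuous.
  exact: closed_le.
have [||x xK xmax] := EVT_max_rV (f := f \o mx_of_coords) _ cK.
- by exists (coords_of_mx A0); exact: PK.
- exact: continuous_subspaceT.
exists (mx_of_coords x); first by move: xK; rewrite inE => -[].
move=> B PB; have := xmax (coords_of_mx B); rewrite inE /= coords_of_mxK.
by apply; exact: PK.
Qed.

End parametrisation.
End MatrixOptimisation.

Section NormEquivalence.
Variables (R : realType) (k : scalar_kind) (n : nat).
Local Notation F := (scalar R k).
Local Notation V := 'cV[F]_n.
Implicit Types (u v w : V) (N : V -> R).

Lemma seminorm_le_sum N u : seminorm N ->
  N u <= \sum_i smod (u i 0) * N (basis_vec R k i).
Proof.
move=> sN; have uE : u = \sum_i u i 0 *: basis_vec R k i.
  apply/matrixP => i j; rewrite ord1 summxE (bigD1 i)//= big1 ?addr0.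
    by rewrite !mxE !eqxx /= mulr1.
  by move=> l li; rewrite !mxE eq_sym (negbTE li) mulr0.
rewrite {1}uE (le_trans (seminorm_sum _ _ sN))//.
by apply: ler_sum => i _; rewrite seminormZ.
Qed.

Lemma seminorm_le_vnorm N u : seminorm N ->
  N u <= (\sum_i N (basis_vec R k i)) * vnorm u.
Proof.
move=> sN; rewrite (le_trans (seminorm_le_sum u sN))// mulr_suml.
apply: ler_sum => i _; rewrite mulrC ler_wpM2l ?seminorm_ge0//.
exact: smod_coord_le.
Qed.

Lemma seminorm_distance N u v : seminorm N -> `|N u - N v| <= N (u - v).
Proof.
move=> sN; rewrite ler_norml; apply/andP; split.
  have := seminormD sN (v - u) u; rewrite subrK.
  have -> : N (v - u) = N (u - v).
    by rewrite -opprB -scaleN1r seminormZ// smodN smod1 mul1r.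
  lra.
by have := seminormD sN (u - v) v; rewrite subrK; lra.
Qed.

(** [N] attains a positive minimum on the Euclidean sphere. *)
Lemma norm_ge_vnorm N : seminorm N -> (forall u, N u = 0 -> u = 0) ->
  exists2 c : R, 0 < c & forall u, vnorm u <= c * N u.
Proof.
move=> sN N0.
pose P := [set A : V | vnorm A = 1].
(* the sphere is empty when [n = 0] *)
have [P0|/set0P PA] := eqVneq P set0.
  exists 1 => // u; have [->|u0] := eqVneq u 0.
    by rewrite vnorm0 mul1r seminorm_ge0.
  suff : P (sreal k (vnorm u)^-1 *: u) by rewrite P0.
  rewrite /P /= vnormZ smod_sreal ger0_norm ?invr_ge0 ?vnorm_ge0// mulVf//.
  by rewrite vnorm_eq0.
have cV : continuous (fun x : 'rV[R]__ => vnorm (mx_of_coords (p:=n) (q:=1) k x) : R).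
  move=> x; rewrite (_ : (fun x => _) = Num.sqrt \o (fun x => \sum_i smod (mx_of_coords (p:=n) (q:=1) k x i 0) * smod (mx_of_coords (p:=n) (q:=1) k x i 0))).
    apply: (@continuous_comp _ _ _ _ Num.sqrt); last exact: sqrt_continuous.
    apply: continuous_sumr => i {}x.
    have cs := continuous_smod (@scontinuous_mx_of_coords R k n 1 i 0).
    exact: (cvgM (cs x) (cs x)).
  by apply/funext => y; rewrite /= /vnorm sRe_dotuu.
have cN : continuous (fun x : 'rV[R]__ => N (mx_of_coords (p:=n) (q:=1) k x)).
  apply: (@continuous_modulus _ _ _ (fun x y : 'rV[R]__ =>
    \sum_i smod (mx_of_coords (p:=n) (q:=1) k x i 0 - mx_of_coords k y i 0)
      * N (basis_vec R k i))).
  - move=> x; apply: continuous_sumr => i; apply: continuousMcst.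
    apply: continuous_smod; apply: scontinuousD; first exact: scontinuous_cst.
    rewrite (_ : (fun y => _) = (fun y => (-1) * mx_of_coords (p:=n) (q:=1) k y i 0)).
      apply: scontinuousM; first exact: scontinuous_cst.
      exact: scontinuous_mx_of_coords.
    by apply/funext => z; rewrite mulN1r.
  - by move=> x; rewrite big1// => i _; rewrite subrr smod0 mul0r.
  - move=> x y; apply: (le_trans (seminorm_distance _ _ sN)).
    apply: (le_trans (seminorm_le_sum _ sN)).
    by apply: ler_sum => i _; rewrite !mxE.
have [|||A PA' Amin] := @mx_extreme_value R k n 1 P (fun A => - N A) 1 PA.
- by move=> A PA' i j; rewrite ord1; move: PA' => /= <-; exact: smod_coord_le.
- apply: (@closed_comp _ _ (fun x : 'rV[R]__ => vnorm (mx_of_coords (p:=n) (q:=1) k x) : R) [set 1]).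
    by move=> x _; exact: cV.
  exact: closed_eq.
- by move=> x; exact: cvgN (cN x).
have NA : 0 < N A.
  rewrite lt_def seminorm_ge0// andbT; apply/eqP => /N0 A0.
  by move: PA'; rewrite /P /= A0 vnorm0 => /esym/eqP; rewrite oner_eq0.
exists (N A)^-1; first by rewrite invr_gt0.
move=> u; have [->|u0] := eqVneq u 0.
  by rewrite vnorm0 mulr_ge0 ?invr_ge0 ?seminorm_ge0.
have nu : 0 < vnorm u by rewrite vnorm_gt0.
have := Amin (sreal k (vnorm u)^-1 *: u).
rewrite /P /= vnormZ smod_sreal ger0_norm ?invr_ge0 ?vnorm_ge0// mulVf ?gt_eqF//.
move=> /(_ erefl); rewrite lerN2 seminormZ// smod_sreal ger0_norm ?invr_ge0 ?vnorm_ge0//.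
by rewrite !ler_pdivlMl// mulrC.
Qed.

End NormEquivalence.

(** * Square roots of positive matrices *)

Section HermitianCalculus.
Lemma poly_interpolation (R : fieldType) (f : R -> R) (s : seq R) :
  exists p : {poly R}, {in s, forall x, p.[x] = f x}.
Proof.
elim: s => [|x s [p ps]]; first by exists 0.
have [xs|xs] := boolP (x \in s).
  by exists p => y; rewrite inE => /predU1P[->|]; exact: ps.
pose q := \prod_(y <- s) ('X - y%:P).
have qx : q.[x] != 0.
  by rewrite -rootE root_prod_XsubC.
exists (p + ((f x - p.[x]) / q.[x])%:P * q) => y.
rewrite inE => /predU1P[->|ys]; rewrite hornerD hornerM hornerC.
  by rewrite divfK// addrC subrK.
have : root q y by rewrite root_prod_XsubC.
by rewrite rootE => /eqP ->; rewrite mulr0 addr0 ps.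
Qed.

Variables (R F : fieldType) (C : numClosedFieldType).
Variables (r : {rmorphism R -> F}) (emb : {rmorphism F -> C}) (conjF : F -> F).
Hypothesis emb_conj : forall z, emb (conjF z) = (emb z)^*.
Hypothesis emb_real : forall c : C, c \is Num.real -> exists a, c = emb (r a).
Hypothesis real_emb : forall a, emb (r a) \is Num.real.
Variable m : nat.
Local Notation n := m.+1.
Local Notation M := 'M[F]_n.
Local Open Scope sesquilinear_scope.
Implicit Types A H : M.

Let adj A : M := (map_mx conjF A)^T.

(** The functional calculus [f |-> f(H)]. On the finite spectrum [f] agrees with
    a real polynomial, and evaluating this at [H] gives a matrix over [F]; that the
    calculus is multiplicative is then seen over [C], where [H] is diagonal in a
    unitary basis. Passing through polynomials keeps the result over [F] when
    [F] is the field of real numbers. *)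
Lemma hermitian_calculus H : adj H = H ->
  exists Phi : (R -> R) -> M,
  [/\ forall f, adj (Phi f) = Phi f,
      forall f g, Phi (fun x => f x * g x) = Phi f *m Phi g,
      forall f g, Phi (fun x => f x - g x) = Phi f - Phi g &
      Phi id = H].
Proof.
move=> hH; pose HC := map_mx emb H.
have map_adj A : map_mx emb (adj A) = (map_mx emb A)^t*.
  by apply/matrixP => i j; rewrite !mxE emb_conj.
have hHC : HC^t* = HC by rewrite /HC -map_adj hH.
have nHC : HC \is normalmx by apply/normalmxP; rewrite hHC.
have [P [sp [uP HE]]] : exists P : 'M[C]_n, exists sp : 'rV[C]_n,
    P \is unitarymx /\ HC = invmx P *m diag_mx sp *m P.
  exists (spectralmx HC), (spectral_diag HC); split; first exact: spectral_unitarymx.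
  exact/orthomx_spectralP.
have iP : invmx P = P^t* := invmx_unitary uP.
have unP : P \in unitmx := unitarymx_unit uP.
have sp_real i : exists a, sp 0 i = emb (r a).
  apply: emb_real; apply/CrealP.
  have diagE : diag_mx sp = (diag_mx sp)^t*.
    have -> : diag_mx sp = P *m HC *m P^t*.
      by rewrite HE -iP !mulmxA mulmxV// mul1mx mulmxK.
    by rewrite !trmx_mul !map_mxM trmxCK /= hHC mulmxA.
  by move/matrixP: diagE => /(_ i i); rewrite !mxE eqxx !mulr1n.
have [lam lamE] := choice sp_real.
pose D (f : R -> R) : 'rV[C]_n := \row_i emb (r (f (lam i))).
have exPhi f : exists A : M, map_mx emb A = invmx P *m diag_mx (D f) *m P.
  have [p ps] := poly_interpolation f [seq lam i | i <- enum 'I_n].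
  exists (horner_mx H (map_poly r p)).
  rewrite map_horner_mx -/HC HE horner_mx_uconjC// horner_mx_diag.
  rewrite (_ : map_mx _ sp = D f)//.
  apply/matrixP => i j; rewrite !mxE ord1 lamE !horner_map /= ps//.
  by apply: map_f; rewrite mem_enum.
have [Phi PhiE] := choice exPhi.
have PhiI A f : map_mx emb A = invmx P *m diag_mx (D f) *m P -> A = Phi f.
  rewrite -PhiE => /matrixP E; apply/matrixP => i j; apply: (fmorph_inj emb).
  by have := E i j; rewrite !mxE.
exists Phi; split.
- move=> f; apply: PhiI; rewrite map_adj PhiE iP.
  rewrite !trmx_mul !map_mxM trmxCK /= tr_diag_mx mulmxA.
  rewrite (_ : map_mx _ (diag_mx (D f)) = diag_mx (D f))//.
  by apply/matrixP => i j; rewrite !mxE rmorphMn /= (CrealP (real_emb _)).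
- move=> f g; apply/esym/PhiI; rewrite map_mxM !PhiE.
  rewrite -[in RHS]mulmxA (_ : diag_mx (D (fun x => f x * g x)) = diag_mx (D f) *m diag_mx (D g)).
    by rewrite !mulmxA mulmxK.
  by apply/matrixP => i j; rewrite mul_diag_mx !mxE !rmorphM /= mulrnAr.
- move=> f g; apply/esym/PhiI; rewrite map_mxB !PhiE.
  rewrite -mulmxBl -mulmxBr -raddfB /=.
  rewrite (_ : D f - D g = D (fun x => f x - g x))//.
  by apply/matrixP => i j; rewrite !mxE !rmorphB.
- apply/esym/PhiI; rewrite -/HC HE (_ : D id = sp)//.
  by apply/matrixP => i j; rewrite !mxE ord1 lamE.
Qed.

End HermitianCalculus.

Section HermitianSquareRoot.
Variables (R : realType) (k : scalar_kind).
Local Notation F := (scalar R k).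

Definition to_complex (z : F) : R[i] := Complex (sRe z) (sIm z).

Lemma to_complex_is_zmod_morphism : zmod_morphism to_complex.
Proof. by move=> z w; rewrite /to_complex !raddfB. Qed.
HB.instance Definition _ :=
  GRing.isZmodMorphism.Build F R[i] to_complex to_complex_is_zmod_morphism.

Lemma to_complex_is_monoid_morphism : monoid_morphism to_complex.
Proof.
split; first by rewrite /to_complex sRe1 sIm1.
by move=> z w; rewrite /to_complex sReM sImM.
Qed.
HB.instance Definition _ :=
  GRing.isMonoidMorphism.Build F R[i] to_complex to_complex_is_monoid_morphism.

Lemma to_complex_conj z : to_complex (sconj z) = Num.conj (to_complex z).
Proof. by rewrite /to_complex sRe_sconj sIm_sconj. Qed.

Lemma to_complex_sreal (a : R) : to_complex (sreal k a) = (a%:C)%C.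
Proof. by rewrite /to_complex sRe_sreal sIm_sreal. Qed.

Variable m : nat.
Local Notation n := m.+1.
Local Notation M := 'M[F]_n.
Local Open Scope sesquilinear_scope.

(** [H = C^* C] has a square root once its negative part vanishes. With [chi] the
    indicator of the negative half-line, [chi(H) H chi(H)] is both positive, being
    [(C chi(H))^* (C chi(H))], and equal to minus the negative part. *)
Lemma hermitian_sqrt (C : M) : C \in unitmx ->
  exists2 A : M, hermitian_posdef A & A *m A = adjmx C *m C.
Proof.
move=> uC; pose H := adjmx C *m C.
have hH : adjmx H = H by rewrite adjmxM adjmxK.
have to_real (c : R[i]) : c \is Num.real -> exists a, c = to_complex (sreal k a).
  by case: c => a b; rewrite complex_real => /eqP ->; exists a;
    rewrite to_complex_sreal.
have real_to a : to_complex (sreal k a) \is Num.real.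
  by rewrite to_complex_sreal complex_real.
have [Phi [+ PhiM PhiB PhiH]] :=
  hermitian_calculus (r := @sreal R k) to_complex_conj to_real real_to hH.
move=> hPhi'; have hPhi f : adjmx (Phi f) = Phi f by exact: hPhi'.
pose pos (x : R) := Num.max x 0; pose neg (x : R) := pos x - x.
pose chi (x : R) : R := if x < 0 then 1 else 0.
pose rt (x : R) := Num.sqrt (neg x).
have neg_ge0 x : 0 <= neg x by rewrite /neg /pos subr_ge0 le_max lexx.
have negE : Phi neg = Phi rt *m Phi rt.
  rewrite -PhiM; congr Phi; apply/funext => x.
  by rewrite /rt -expr2 sqr_sqrtr.
have neg0 : Phi neg = 0.
  have E : Phi chi *m H *m Phi chi = - Phi neg.
    have -> : Phi neg = Phi (fun x => (x - x) - (chi x * x * chi x)).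
      congr Phi; apply/funext => x; rewrite /neg /pos /chi maxEle.
      by case: (ltgtP x 0) => // [x0|x0|->]; ring.
    by rewrite PhiB (PhiB id id) subrr sub0r opprK !PhiM PhiH.
  have rt0 (u : 'cV[F]_n) : Phi rt *m u = 0.
    apply/eqP; rewrite -vnorm_eq0 -sqrf_eq0 eq_le sqr_ge0 andbT.
    have : 0 <= vnorm (C *m (Phi chi *m u)) ^+ 2 by exact: sqr_ge0.
    have -> : vnorm (C *m (Phi chi *m u)) ^+ 2 = - vnorm (Phi rt *m u) ^+ 2.
      apply: (@sreal_inj R k); rewrite raddfN /= -!dotuu.
      rewrite dot_mulmx mulmxA -/H dot_mulmx hPhi (mulmxA H).
      rewrite (mulmxA (Phi chi) (H *m _)) (mulmxA (Phi chi) H) E.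
      by rewrite mulNmx dotNr [in RHS]dot_mulmx hPhi mulmxA -negE.
    by rewrite oppr_ge0.
  rewrite negE (_ : Phi rt = 0) ?mul0mx//; apply/matrixP => i j.
  have := rt0 (delta_mx j 0); rewrite -colE => /matrixP/(_ i 0).
  by rewrite !mxE.
(* the fourth root: [A] is a square of a Hermitian matrix, hence positive *)
pose q (x : R) := Num.sqrt (Num.sqrt (pos x)).
pose A := Phi q *m Phi q.
have pos_ge0 x : 0 <= pos x by rewrite /pos le_max lexx orbT.
have AA : A *m A = H.
  rewrite /A -!PhiM -PhiH; apply/eqP; rewrite -subr_eq0 -neg0 -PhiB; apply/eqP.
  congr Phi; apply/funext => x; congr (_ - _).
  by rewrite -!expr2 sqr_sqrtr ?sqrtr_ge0// sqr_sqrtr.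
have uH : H \in unitmx.
  by rewrite unitmx_mul uC andbT /adjmx unitmx_tr map_unitmx.
have uq : Phi q \in unitmx.
  by move: uH; rewrite -AA unitmx_mul => /andP[]; rewrite /A unitmx_mul => /andP[].
exists A => //; split.
  have hA : adjmx A = A by rewrite /A adjmxM hPhi.
  by move=> i j; rewrite -{1}hA !mxE.
move=> u u0; rewrite /A -mulmxA dot_mulmx hPhi dotuu.
rewrite -[X in X < _](raddf0 (@sreal R k)) ltr_sreal exprn_gt0// vnorm_gt0.
by apply: contra_neq u0 => qu; rewrite -(mulKmx uq u) qu mulmx0.
Qed.
End HermitianSquareRoot.

(** * The John ellipsoid *)

Section John.

(** Sylvester's identity in rank one, by computing the determinant of one block
    matrix through two triangular factorisations. *)
Lemma det_one_plus_rank1 (K : comNzRingType) n (u : 'cV[K]_n) (w : 'rV[K]_n) :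
  \det (1%:M + u *m w) = 1 + (w *m u) 0 0.
Proof.
pose L := block_mx 1%:M 0 u 1%:M : 'M[K]_(1 + n).
pose U := block_mx 1%:M (- w) 0 1%:M : 'M[K]_(1 + n).
have E1 : L *m block_mx 1%:M (- w) 0 (1%:M + u *m w) = block_mx 1%:M (- w) u 1%:M.
  rewrite mulmx_block ?(mul1mx, mulmx1, mul0mx, mulmx0, addr0, add0r).
  by rewrite mulmxN addrCA addNr addr0.
have E2 : U *m block_mx (1%:M + w *m u) 0 u 1%:M = block_mx 1%:M (- w) u 1%:M.
  rewrite mulmx_block ?(mul1mx, mulmx1, mul0mx, mulmx0, addr0, add0r).
  by rewrite mulNmx addrK.
have := congr1 determinant (etrans E1 (esym E2)).
rewrite !det_mulmx det_lblock det_ublock !det1 det_ublock det_lblock !det1.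
by rewrite !mul1r !mulr1 det_mx11 !mxE eqxx mulr1n.
Qed.

Lemma bernoulli_ineq (R : realDomainType) (x : R) m : x <= 1 ->
  1 - m%:R * x <= (1 - x) ^+ m.
Proof.
move=> x1; elim: m => [|m IH]; first by rewrite mul0r subr0 expr0.
have [x0|x0] := leP 0 x.
  rewrite exprS; apply: (le_trans _ (ler_wpM2l _ IH)); last by rewrite subr_ge0.
  have : 0 <= m%:R * x * x by rewrite !mulr_ge0.
  by rewrite -natr1; lra.
rewrite exprS; apply: (le_trans _ (ler_wpM2l _ IH)); last by rewrite subr_ge0.
have : 0 <= m%:R * (x * x) by rewrite mulr_ge0// -expr2 sqr_ge0.
by rewrite -natr1; lra.
Qed.

Lemma vnorm_rank1_update (R : realType) (k : scalar_kind) n (b g : R)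
    (w z : 'cV[scalar R k]_n) :
  vnorm (sreal k b *: w + (sreal k g * dot w z) *: z) ^+ 2 =
  b ^+ 2 * vnorm w ^+ 2 + (b * g *+ 2 + g ^+ 2 * vnorm z ^+ 2) * smod (dot w z) ^+ 2.
Proof.
rewrite vnormD_sqr !vnormZ smodM !smod_sreal !exprMn !real_normK ?num_real//.
rewrite dotZl dotZr rmorphM /= sconj_sreal.
have -> : sreal k b * (sreal k g * sconj (dot w z) * dot w z)
    = sreal k (b * g * smod (dot w z) ^+ 2).
  by rewrite 2!(rmorphM (@sreal R k)) /= -mulz_conj [dot w z * _]mulrC !mulrA.
by rewrite sRe_sreal; ring.
Qed.

Variables (R : realType) (k : scalar_kind) (m : nat).
Local Notation n := m.+1.
Local Notation F := (scalar R k).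
Local Notation V := 'cV[F]_n.
Variable N : V -> R.
Hypothesis sN : seminorm N.
Hypothesis N_eq0 : forall u, N u = 0 -> u = 0.

(** The ellipsoid is the image of the Euclidean ball; to be inner means to lie in
    the unit ball of [N]. *)
Definition inner_ellipsoid (B : 'M[F]_n) : Prop :=
  forall y, N (B *m y) <= vnorm y.

(** By duality, the condition is an intersection of conditions that are visibly
    closed in [B]. *)
Lemma inner_ellipsoidP B : inner_ellipsoid B <->
  forall y v, dual_ball N v -> smod (dot (B *m y) v) <= vnorm y.
Proof.
split=> [HB y v Dv|HB y]; first exact: le_trans (Dv _) (HB y).
have [v Dv vE] := hahn_banach (B *m y) sN.
by have := HB y v Dv; rewrite vE smod_sreal ger0_norm ?seminorm_ge0.
Qed.

Lemma max_inner_ellipsoid : exists B : 'M[F]_n,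
  [/\ inner_ellipsoid B, B \in unitmx &
      forall B', inner_ellipsoid B' -> smod (\det B') <= smod (\det B)].
Proof.
pose S := \sum_i N (basis_vec R k i).
have S0 : 0 <= S by apply: sumr_ge0 => i _; exact: seminorm_ge0.
pose e := (1 + S)^-1.
have e0 : 0 < e by rewrite invr_gt0; lra.
have Pe : inner_ellipsoid (sreal k e)%:M.
  move=> y; rewrite mul_scalar_mx seminormZ// smod_sreal gtr0_norm//.
  apply: (le_trans (ler_wpM2l (ltW e0) (seminorm_le_vnorm y sN))).
  rewrite -/S mulrA ler_piMl ?vnorm_ge0// /e ler_pdivrMl; lra.
have [c c0 cN] := norm_ge_vnorm sN N_eq0.
have [||||B PB Bmax] := @mx_extreme_value R k n n inner_ellipsoid
    (fun A => smod (\det A)) c.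
- by exists (sreal k e)%:M.
- move=> A PA i j; have := PA (basis_vec R k j).
  rewrite /basis_vec -colE => NA.
  have -> : A i j = (col j A) i 0 by rewrite mxE.
  apply: (le_trans (smod_coord_le _ _)); apply: (le_trans (cN _)).
  rewrite -[leRHS]mulr1 ler_wpM2l ?(ltW c0)//; apply: (le_trans NA).
  rewrite -(@ler_pXn2r _ 2) ?nnegrE ?vnorm_ge0// vnorm_sqr expr1n.
  rewrite (bigD1 j)//= big1 => [|l lj]; rewrite mxE eqxx ?andbT.
    by rewrite smod1 expr1n addr0.
  by rewrite (negbTE lj) smod0 expr0n.
- rewrite [X in closed X](_ : _ = \bigcap_(yv in [set yv : V * V | dual_ball N yv.2])
    [set x | smod (dot (mx_of_coords k x *m yv.1) yv.2) <= vnorm yv.1]).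
    apply: closed_bigI => -[y v] /= Dv.
    apply: (@closed_comp _ _ (fun x => smod (dot (mx_of_coords k x *m y) v)) [set z | z <= vnorm y]).
      move=> x _; apply: continuous_smod; apply: scontinuous_sum => i _.
      apply: scontinuousM; last exact: scontinuous_cst.
      rewrite (_ : (fun x => _) = (fun x => \sum_j mx_of_coords k x i j * y j 0)).
        apply: scontinuous_sum => j _; apply: scontinuousM.
          exact: scontinuous_mx_of_coords.
        exact: scontinuous_cst.
      by apply/funext => z; rewrite mxE.
    exact: closed_le.
  apply/seteqP; split=> x /=.
    by move=> /inner_ellipsoidP Hx [y v] /= Dv; exact: Hx.
  by move=> Hx; apply/inner_ellipsoidP => y v Dv; exact: (Hx (y, v)).
- apply: continuous_smod; apply: scontinuous_det => i j.
  exact: scontinuous_mx_of_coords.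
exists B; split=> //.
rewrite unitmxE unitfE -smod_eq0 gt_eqF//.
apply: lt_le_trans (Bmax _ Pe).
by rewrite det_scalar -rmorphXn /= smod_sreal gtr0_norm ?exprn_gt0.
Qed.

Lemma adjmx_dual_ball B v : inner_ellipsoid B -> dual_ball N v ->
  vnorm (adjmx B *m v) <= 1.
Proof.
move=> PB Dv; set w := adjmx B *m v.
have : vnorm w ^+ 2 <= vnorm w.
  have := (inner_ellipsoidP B).1 PB w v Dv.
  by rewrite dot_mulmx -/w dotuu smod_sreal ger0_norm// sqr_ge0.
have [->//|w0] := eqVneq (vnorm w) 0.
by rewrite expr2 ger_pMl// lt_def w0 vnorm_ge0.
Qed.

(** John's theorem. Let [z] be the point [u] of the unit ball in coordinates where
    the maximal ellipsoid is round, and [S = |z|^2 > n]. Stretch the ellipsoid along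
    [z] by [a] and shrink it in the orthogonal directions by [b], with
    [a^2 = 1 + e] and [b^2 = 1 - e / (S - 1)]. The pair is chosen so that
    [b^2 + (a^2 - b^2) / S = 1], which keeps the ellipsoid in the unit ball: a dual
    vector [w] satisfies both [|w| <= 1] and [|dot w z| <= 1]. The squared
    modulus of the determinant is multiplied by [a^2 b^(2m)], about [1 + e (1 - m / (S - 1))], which
    exceeds 1 for small [e] because [S - 1 > m = n - 1]. *)
Lemma john_bound B u : inner_ellipsoid B -> B \in unitmx ->
  (forall B', inner_ellipsoid B' -> smod (\det B') <= smod (\det B)) ->
  N u <= 1 -> vnorm (invmx B *m u) ^+ 2 <= n%:R.
Proof.
move=> PB uB Bmax Nu; rewrite leNgt; apply/negP.
set z := invmx B *m u; set S := vnorm z ^+ 2 => nS.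
have Bz : B *m z = u by rewrite mulKVmx.
have S1 : 0 < S - 1.
  rewrite subr_gt0; apply: le_lt_trans nS; by rewrite ler1n.
have S0 : 0 < S by lra.
pose q := m%:R / (S - 1).
have q0 : 0 <= q by rewrite divr_ge0// ltW.
have q1 : q < 1.
  by rewrite ltr_pdivrMr// mul1r ltrBrDr natr1.
pose e := Num.min ((1 - q) / 2) ((S - 1) / 2).
have e0 : 0 < e by rewrite lt_min; apply/andP; split; lra.
have e1 : e <= (1 - q) / 2 by rewrite ge_min lexx.
have e2 : e <= (S - 1) / 2 by rewrite ge_min lexx orbT.
pose t := 1 + e; pose b2 := 1 - e / (S - 1).
have b20 : 0 < b2 by rewrite subr_gt0 ltr_pdivrMr//; lra.
pose a := Num.sqrt t; pose b := Num.sqrt b2.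
have t0 : 0 < t by rewrite /t; lra.
have a0 : 0 < a by rewrite sqrtr_gt0.
have b0 : 0 < b by rewrite sqrtr_gt0.
have aE : a ^+ 2 = t by rewrite sqr_sqrtr// ltW.
have bE : b ^+ 2 = b2 by rewrite sqr_sqrtr// ltW.
pose g := (a - b) / S.
pose D : 'M[F]_n := (sreal k b)%:M + sreal k g *: (z *m adjmx z).
have DE y : D *m y = sreal k b *: y + (sreal k g * dot y z) *: z.
  rewrite mulmxDl mul_scalar_mx -scalemxAl -mulmxA -scalerA; congr (_ + _ *: _).
  apply/matrixP => i j; rewrite ord1 !mxE big_ord1 mulrC !mxE; congr (_ * _).
  by apply: eq_bigr => l _; rewrite !mxE mulrC.
have Dadj y w : dot (D *m y) w = dot y (D *m w).
  rewrite !DE dotDl dotDr !dotZl !dotZr [sconj (_ * dot w z)]rmorphM /=.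
  by rewrite !sconj_sreal -dotC -!mulrA [dot z w * _]mulrC.
have DP : inner_ellipsoid (B *m D).
  apply/inner_ellipsoidP => y v Dv.
  rewrite -mulmxA dot_mulmx Dadj; set w := adjmx B *m v.
  have w1 : vnorm w <= 1 by exact: adjmx_dual_ball.
  apply: (le_trans (dot_le _ _)); rewrite ler_piMr ?vnorm_ge0//.
  have wz : smod (dot w z) <= 1.
    by rewrite smod_dotC -dot_mulmx Bz (le_trans (Dv u)).
  rewrite -(@ler_pXn2r _ 2) ?nnegrE ?vnorm_ge0// expr1n.
  have -> : vnorm (D *m w) ^+ 2
      = b ^+ 2 * vnorm w ^+ 2 + (a ^+ 2 - b ^+ 2) / S * smod (dot w z) ^+ 2.
    rewrite DE vnorm_rank1_update -/S.
    congr (_ + _ * _); rewrite /g; field; exact: lt0r_neq0.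
  rewrite aE bE.
  have w2 : vnorm w ^+ 2 <= 1 by rewrite expr_le1 ?vnorm_ge0.
  have wz2 : smod (dot w z) ^+ 2 <= 1 by rewrite expr_le1 ?smod_ge0.
  have eS : 0 <= e / (S - 1) by rewrite divr_ge0 ?ltW.
  have tb : 0 <= (t - b2) / S.
    by apply: divr_ge0; [rewrite /t /b2; lra|exact: ltW].
  apply: (@le_trans _ _ (b2 * 1 + (t - b2) / S * 1)).
    by apply: lerD; apply: ler_wpM2l => //; exact: ltW.
  rewrite le_eqVlt; apply/orP; left; apply/eqP; rewrite /t /b2; field.
  by rewrite !lt0r_neq0.
have := Bmax _ DP; rewrite det_mulmx smodM ger_pMr ?lt_def ?smod_ge0 ?andbT ?smod_eq0; last first.
  by move: uB; rewrite unitmxE unitfE.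
have -> : \det D = sreal k (a * b ^+ m).
  have -> : D = sreal k b *: (1%:M + (sreal k (g / b) *: z) *m adjmx z).
    rewrite scalerDr scale_scalar_mx mulr1 -scalemxAl scalerA -rmorphM /=.
    by rewrite mulrCA divff ?lt0r_neq0// mulr1.
  rewrite detZ det_one_plus_rank1 -scalemxAr mxE.
  have -> : (adjmx z *m z) 0 0 = dot z z.
    by rewrite mxE; apply: eq_bigr => i _; rewrite !mxE mulrC.
  rewrite dotuu -/S -rmorphM /= -rmorphXn /= -[1](rmorph1 (@sreal R k)) -raddfD /=.
  rewrite -rmorphM /=; congr sreal; rewrite exprS /g; field.
  by rewrite !lt0r_neq0.
have ab0 : 0 < a * b ^+ m by rewrite mulr_gt0 ?exprn_gt0.
rewrite smod_sreal gtr0_norm// leNgt => /negP; apply.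
rewrite -(@ltr_pXn2r _ 2) ?nnegrE ?(ltW ab0)//.
rewrite expr1n exprMn exprAC aE bE.
have := @bernoulli_ineq R (e / (S - 1)) m.
have e3 : e / (S - 1) <= 1 by rewrite ler_pdivrMr//; lra.
move=> /(_ e3) /(ler_wpM2l (ltW t0)); apply: lt_le_trans.
have -> : m%:R * (e / (S - 1)) = q * e by rewrite /q; ring.
have qe : q * e <= e by rewrite ler_piMl ?ltW.
have : 0 < e * (1 - q - q * e) by apply: mulr_gt0 => //; lra.
by rewrite /t; lra.
Qed.

(** The matrix [B^-1] of a maximal inner ellipsoid has the required norm
    estimates; the positive square root of [(B^-1)^* B^-1] is Hermitian and gives
    the same norms. *)
Lemma john : exists2 A : 'M[F]_n, hermitian_posdef A &
  forall u, N u <= vnorm (A *m u) <= Num.sqrt n%:R * N u.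
Proof.
have [B [PB uB Bmax]] := max_inner_ellipsoid.
have uC : invmx B \in unitmx by rewrite unitmx_inv.
have [A hA AA] := hermitian_sqrt uC.
exists A => // u.
have -> : vnorm (A *m u) = vnorm (invmx B *m u).
  apply/eqP; rewrite -(@eqrXn2 _ 2) ?vnorm_ge0//; apply/eqP.
  apply: (@sreal_inj R k); rewrite -!dotuu !dot_mulmx !mulmxA -AA.
  have -> // : adjmx A = A.
  by apply/matrixP => i j; rewrite !mxE -hA.1.
apply/andP; split.
  by rewrite -{1}(mulKVmx uB u); exact: PB.
have [Nu0|Nu0] := eqVneq (N u) 0.
  by rewrite (N_eq0 Nu0) mulmx0 vnorm0 seminorm0// mulr0.
have Nu : 0 < N u by rewrite lt_def Nu0 seminorm_ge0.
have := @john_bound B (sreal k (N u)^-1 *: u) PB uB Bmax.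
rewrite seminormZ// smod_sreal gtr0_norm ?invr_gt0// mulVf// => /(_ (lexx _)).
rewrite -scalemxAr vnormZ smod_sreal gtr0_norm ?invr_gt0// => H.
rewrite -ler_pdivrMr// mulrC -(@ler_pXn2r _ 2) ?nnegrE ?sqrtr_ge0//.
  by rewrite sqr_sqrtr.
by rewrite mulr_ge0 ?vnorm_ge0// invr_ge0 ltW.
Qed.

End John.

(** * Bases of almost maximal volume *)

Section NearMaximalBasis.
Variables (R : realType) (k : scalar_kind) (n : nat).
Local Notation F := (scalar R k).
Local Notation V := 'cV[F]_n.

Definition replace_col (U : 'M[F]_n) (i : 'I_n) (y : V) : 'M[F]_n :=
  \matrix_(a, b) if b == i then y a 0 else U a b.

Lemma cramer (U : 'M[F]_n) i y : (\adj U *m y) i 0 = \det (replace_col U i y).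
Proof.
rewrite (expand_det_col _ i) mxE; apply: eq_bigr => a _.
rewrite mulrC !mxE eqxx; congr (_ * _).
rewrite /cofactor; congr (_ * \det _); apply/matrixP => b c; rewrite !mxE.
by rewrite eq_sym (negbTE (neq_lift _ _)).
Qed.

Lemma col_replace_col (U : 'M[F]_n) i y j :
  col j (replace_col U i y) = if j == i then y else col j U.
Proof.
by apply/matrixP => a b; rewrite ord1 !mxE; case: ifP; rewrite ?mxE.
Qed.

(** Take columns whose determinant exceeds half of the supremum. By Cramer's rule
    a coordinate of [y] is the quotient of the determinant with one column replaced
    by [y], which is again at most the supremum, by that of [U]. The multiples of
    the basis vectors only serve to make the supremum positive. *)
Lemma near_maximal_basis (K : set V) (M e : R) : 0 < e ->
  (forall u, K u -> forall i, smod (u i 0) <= M) ->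
  (forall i, K (sreal k e *: basis_vec R k i)) ->
  exists U : 'M[F]_n, [/\ U \in unitmx, forall j, K (col j U) &
    forall y, K y -> forall i, smod ((invmx U *m y) i 0) <= 2].
Proof.
move=> e0 KM Ke.
pose D := [set smod (\det U) | U in [set U : 'M[F]_n | forall j, K (col j U)]].
have De : D (e ^+ n).
  exists (sreal k e)%:M => /=.
    move=> j; have -> // : col j (sreal k e)%:M = sreal k e *: basis_vec R k j.
    by apply/matrixP => a b; rewrite ord1 !mxE andbT mulr_natr.
  by rewrite det_scalar -rmorphXn /= smod_sreal gtr0_norm ?exprn_gt0.
have Dub : ubound D (\sum_(s : 'S_n) \prod_(i < n) M).
  move=> _ [U KU <-]; apply: (le_trans (smod_sum _ _ _)).
  apply: ler_sum => s _; rewrite smodM smod_prod.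
  have -> : smod ((-1) ^+ s : F) = 1.
    by case: (odd_perm s); rewrite ?expr0 ?expr1 ?smodN smod1.
  rewrite mul1r; apply: ler_prod => i _; rewrite smod_ge0 /=.
  by have := KM _ (KU (s i)) i; rewrite mxE.
have hD : has_sup D by split; [exists (e ^+ n)|exists (\sum_(s : 'S_n) \prod_(i < n) M)].
have s0 : 0 < sup D.
  by apply: lt_le_trans (ub_le_sup hD.2 De); rewrite exprn_gt0.
have [_ [U KU <-] Us] := sup_adherent (divr_gt0 s0 (ltac:(by []) : 0 < 2 :> R)) hD.
have dU : 0 < smod (\det U) by apply: lt_trans Us; lra.
have uU : U \in unitmx by rewrite unitmxE unitfE -smod_eq0 gt_eqF.
exists U; split=> // y Ky i.
rewrite /invmx uU -scalemxAl mxE cramer smodM smodV ler_pdivrMl//.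
have : smod (\det (replace_col U i y)) <= sup D.
  apply: (ub_le_sup hD.2); exists (replace_col U i y) => //= j.
  by rewrite col_replace_col; case: ifP => // _; exact: KU.
by lra.
Qed.

End NearMaximalBasis.

(** * Measurable and integrable scalar functions *)

Section ScalarMeasurability.
Variables (R : realType) (k : scalar_kind).
Variables (disp : measure_display) (T : measurableType disp).
Variable mu : {measure set T -> \bar R}.
Local Notation F := (scalar R k).
Implicit Types (h g : T -> F) (D : set T).

Definition smeasurable h : Prop :=
  measurable_fun setT (fun x => sRe (h x)) /\
  measurable_fun setT (fun x => sIm (h x)).

Lemma smeasurable_cst (c : F) : smeasurable (fun=> c).
Proof. by split; exact: measurable_cst. Qed.

Lemma smeasurableD g h : smeasurable g -> smeasurable h ->
  smeasurable (fun x => g x + h x).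
Proof.
move=> [gr gi] [hr hi]; split.
  by under eq_fun do rewrite raddfD; exact: measurable_funD.
by under eq_fun do rewrite raddfD; exact: measurable_funD.
Qed.

Lemma smeasurableM g h : smeasurable g -> smeasurable h ->
  smeasurable (fun x => g x * h x).
Proof.
move=> [gr gi] [hr hi]; split.
  by under eq_fun do rewrite sReM; apply: measurable_funB; exact: measurable_funM.
by under eq_fun do rewrite sImM; apply: measurable_funD; exact: measurable_funM.
Qed.

Lemma smeasurable_sum (I : Type) (r : seq I) (h : I -> T -> F) :
  (forall i, smeasurable (h i)) -> smeasurable (fun x => \sum_(i <- r) h i x).
Proof.
move=> mh; elim: r => [|i r IH].
  by under eq_fun do rewrite big_nil; exact: smeasurable_cst.
by under eq_fun do rewrite big_cons; exact: smeasurableD.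
Qed.

Lemma smeasurable_sconj h : smeasurable h -> smeasurable (fun x => sconj (h x)).
Proof.
move=> [hr hi]; split; first by under eq_fun do rewrite sRe_sconj.
by under eq_fun do rewrite sIm_sconj; exact: measurable_funN.
Qed.

Lemma smeasurable_sreal (f : T -> R) : measurable_fun setT f ->
  smeasurable (fun x => sreal k (f x)).
Proof.
move=> mf; split; first by under eq_fun do rewrite sRe_sreal.
by under eq_fun do rewrite sIm_sreal; exact: measurable_cst.
Qed.

Lemma smeasurable_ifT (b : T -> bool) g h : measurable_fun setT b ->
  smeasurable g -> smeasurable h ->
  smeasurable (fun x => if b x then g x else h x).
Proof.
move=> mb [gr gi] [hr hi]; split.
  under eq_fun do rewrite (fun_if (@sRe R k)).
  exact: measurable_fun_ifT.
under eq_fun do rewrite (fun_if (@sIm R k)).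
exact: measurable_fun_ifT.
Qed.

Lemma measurable_fun_mem D : measurable D -> measurable_fun setT (fun x => x \in D).
Proof.
move=> mD; apply: (measurable_fun_bool true).
rewrite setTI (_ : _ @^-1` _ = D)//.
by apply/seteqP; split=> x /= => [/set_mem|/mem_set].
Qed.

Lemma smeasurable_if D g h : measurable D -> smeasurable g -> smeasurable h ->
  smeasurable (fun x => if x \in D then g x else h x).
Proof. by move=> mD; apply: smeasurable_ifT; exact: measurable_fun_mem. Qed.

Lemma measurable_smod h : smeasurable h -> measurable_fun setT (fun x => smod (h x)).
Proof.
move=> [hr hi]; under eq_fun do rewrite smodE.
apply: (measurableT_comp (continuous_measurable_fun (@sqrt_continuous R))).
by apply: measurable_funD; exact: measurable_funX.
Qed.

Lemma measurable_inv (f : T -> R) : measurable_fun setT f ->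
  (forall x, 0 <= f x) -> measurable_fun setT (fun x => (f x)^-1).
Proof.
move=> mf f0.
have -> : (fun x => (f x)^-1) = (fun x => if f x == 0 then 0 else expR (- ln (f x))).
  apply/funext => x; case: eqP => [->|/eqP fx]; first by rewrite invr0.
  by rewrite expRN lnK// posrE lt_def fx f0.
apply: measurable_fun_ifT; [exact: measurable_fun_eqr|exact: measurable_cst|].
apply: (measurableT_comp (@measurable_expR R)).
by apply: measurable_funN; apply: (measurableT_comp (@measurable_ln R)).
Qed.

Lemma smeasurable_sphase h : smeasurable h -> smeasurable (fun x => sphase (h x)).
Proof.
move=> mh; rewrite /sphase; under eq_fun do rewrite -smod_eq0.
have ms := measurable_smod mh.
apply: smeasurable_ifT; [exact: measurable_fun_eqr|exact: smeasurable_cst|].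
apply: smeasurableM; first exact: smeasurable_sconj.
by apply: smeasurable_sreal; apply: measurable_inv => // x; exact: smod_ge0.
Qed.

(** For Lebesgue measure on [Rd] these unfold to the same terms as [sintegrable]
    and [sintegral]; they allow the integration lemmas to be proved for any
    measure. *)
Definition mu_sintegrable D h : Prop :=
  mu.-integrable D (fun x => (sRe (h x))%:E) /\
  mu.-integrable D (fun x => (sIm (h x))%:E).

Definition mu_sintegral D h : F :=
  sMk k (Rintegral mu D (fun x => sRe (h x)))
        (Rintegral mu D (fun x => sIm (h x))).

Lemma sintegrableP D h : measurable D -> smeasurable h ->
  mu_sintegrable D h <-> (\int[mu]_(x in D) (smod (h x))%:E < +oo)%E.
Proof.
move=> mD [hr hi]; have ms : measurable_fun D (fun x => smod (h x)).
  by apply: measurable_funTS; exact: measurable_smod.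
split=> [[ir ii]|hoo].
  have := integrableD mD (integrable_abse ir) (integrable_abse ii).
  move=> /integrableP[_]; apply: le_lt_trans; apply: ge0_le_integral => //.
  - by move=> x _; rewrite lee_fin smod_ge0.
  - exact/measurable_EFinP.
  - by apply: measurableT_comp => //; apply: emeasurable_funD;
      apply: measurableT_comp => //; exact/measurable_EFinP/measurable_funTS.
  - by move=> x _; rewrite /= lee_fin ger0_norm ?addr_ge0// smod_le_ReIm.
have is_ : mu.-integrable D (fun x => (smod (h x))%:E).
  apply/integrableP; split; first exact/measurable_EFinP.
  rewrite (eq_integral (fun x => (smod (h x))%:E))// => x _.
  by rewrite gee0_abs// lee_fin smod_ge0.
split; apply: le_integrable is_ => //.
- exact/measurable_EFinP/measurable_funTS.
- by move=> x _; rewrite /= lee_fin [leRHS]ger0_norm ?smod_ge0// sRe_le_smod.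
- exact/measurable_EFinP/measurable_funTS.
- by move=> x _; rewrite /= lee_fin [leRHS]ger0_norm ?smod_ge0// sIm_le_smod.
Qed.

Lemma smod_integrable D h : measurable D -> smeasurable h -> mu_sintegrable D h ->
  mu.-integrable D (fun x => (smod (h x))%:E).
Proof.
move=> mD mh /(sintegrableP mD mh) hoo; apply/integrableP; split.
  by apply/measurable_EFinP/measurable_funTS; exact: measurable_smod.
rewrite (eq_integral (fun x => (smod (h x))%:E))// => x _.
by rewrite gee0_abs// lee_fin smod_ge0.
Qed.

Lemma sintegrableD D g h : measurable D -> mu_sintegrable D g -> mu_sintegrable D h ->
  mu_sintegrable D (fun x => g x + h x).
Proof.
move=> mD [gr gi] [hr hi]; split.
  by under eq_fun do rewrite raddfD EFinD; exact: integrableD.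
by under eq_fun do rewrite raddfD EFinD; exact: integrableD.
Qed.

Lemma sintegrableZ D (c : F) h : measurable D -> mu_sintegrable D h ->
  mu_sintegrable D (fun x => c * h x).
Proof.
move=> mD [hr hi]; split.
  under eq_fun do rewrite sReM EFinB !EFinM.
  by apply: integrableB => //; exact: integrableZl.
under eq_fun do rewrite sImM EFinD !EFinM.
by apply: integrableD => //; exact: integrableZl.
Qed.

Lemma sintegralD D g h : measurable D -> mu_sintegrable D g -> mu_sintegrable D h ->
  mu_sintegral D (fun x => g x + h x) = mu_sintegral D g + mu_sintegral D h.
Proof.
move=> mD [gr gi] [hr hi]; rewrite /mu_sintegral; apply: sextP.
  rewrite raddfD /= !sRe_sMk -RintegralD//.
  by apply: eq_Rintegral => x _; rewrite raddfD.
rewrite raddfD /= !sIm_sMk -mulrDr -RintegralD//; congr (_ * _).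
by apply: eq_Rintegral => x _; rewrite raddfD.
Qed.

Lemma sIm_sintegral D h : sIm (mu_sintegral D h) = Rintegral mu D (fun x => sIm (h x)).
Proof.
rewrite /mu_sintegral sIm_sMk /is_complex; case: k h => /= h; last by rewrite mul1r.
rewrite mul0r /Rintegral integral0_eq//.
Qed.

Lemma sRe_sintegral D h : sRe (mu_sintegral D h) = Rintegral mu D (fun x => sRe (h x)).
Proof. by rewrite /mu_sintegral sRe_sMk. Qed.

Lemma sintegralZ D (c : F) h : measurable D -> mu_sintegrable D h ->
  mu_sintegral D (fun x => c * h x) = c * mu_sintegral D h.
Proof.
move=> mD [hr hi].
have iZ (a : R) (f : T -> R) : mu.-integrable D (EFin \o f) ->
    mu.-integrable D (EFin \o (fun x => a * f x)).
  by move=> jf; rewrite /comp; under eq_fun do rewrite EFinM; exact: integrableZl.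
apply: sextP.
  rewrite sReM !sIm_sintegral !sRe_sintegral -!RintegralZl//.
  rewrite -RintegralB; [|by []|exact: iZ|exact: iZ].
  by apply: eq_Rintegral => x _; rewrite sReM.
rewrite sImM !sIm_sintegral !sRe_sintegral -!RintegralZl//.
rewrite -RintegralD; [|by []|exact: iZ|exact: iZ].
by apply: eq_Rintegral => x _; rewrite sImM.
Qed.

Lemma sintegral_sum D (I : Type) (r : seq I) (h : I -> T -> F) : measurable D ->
  (forall i, mu_sintegrable D (h i)) ->
  mu_sintegrable D (fun x => \sum_(i <- r) h i x) /\
  mu_sintegral D (fun x => \sum_(i <- r) h i x) = \sum_(i <- r) mu_sintegral D (h i).
Proof.
move=> mD ih; elim: r => [|i r [IH1 IH2]].
  have -> : (fun x => \sum_(i <- [::]) h i x) = (fun=> 0).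
    by apply/funext => x; rewrite big_nil.
  split.
    by split; rewrite raddf0; exact: integrable0.
  rewrite big_nil; apply: sextP; rewrite ?sRe_sintegral ?sIm_sintegral raddf0.
    by rewrite Rintegral_cst// mul0r.
  by rewrite Rintegral_cst// mul0r.
have -> : (fun x => \sum_(i <- i :: r) h i x) = (fun x => h i x + \sum_(i <- r) h i x).
  by apply/funext => x; rewrite big_cons.
split; first exact: sintegrableD.
by rewrite sintegralD// big_cons IH2.
Qed.

Lemma sintegral_sreal D (f : T -> R) :
  mu_sintegral D (fun x => sreal k (f x)) = sreal k (Rintegral mu D f).
Proof.
apply: sextP; rewrite ?sRe_sintegral ?sIm_sintegral ?sRe_sreal ?sIm_sreal.
  by apply: eq_Rintegral => x _; rewrite sRe_sreal.
by rewrite /Rintegral integral0_eq// => x _; rewrite sIm_sreal.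
Qed.

(** The usual rotation: multiplied by its phase the integral becomes its own real
    part. *)
Lemma smod_sintegral_le D h : measurable D -> smeasurable h -> mu_sintegrable D h ->
  ((smod (mu_sintegral D h))%:E <= \int[mu]_(x in D) (smod (h x))%:E)%E.
Proof.
move=> mD mh ih; pose s := sphase (mu_sintegral D h).
have -> : smod (mu_sintegral D h) = Rintegral mu D (fun x => sRe (s * h x)).
  by rewrite -sRe_sintegral sintegralZ// sphaseM sRe_sreal.
have ish := sintegrableZ s mD ih.
have iss := smod_integrable mD mh ih.
rewrite /Rintegral fineK; last exact: (integrable_fin_num mD ish.1).
apply: le_integral => //; first exact: ish.1.
move=> x _; rewrite lee_fin (le_trans (ler_norm _))// (le_trans (sRe_le_smod _))//.
by rewrite smodM smod_sphase mul1r.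
Qed.

End ScalarMeasurability.

(** * Simultaneous domination *)

Lemma invr_nat_lt (R : realType) (e : R) : 0 < e -> exists j : nat, j.+1%:R^-1 < e.
Proof.
move=> e0; exists (Num.truncn e^-1).
by rewrite invf_plt ?posrE// truncnS_gt.
Qed.

Section Domination.
Variables (R : realType) (disp : measure_display) (T : measurableType disp).
Variables (mu : {measure set T -> \bar R}) (D : set T).
Hypothesis mD : measurable D.
Implicit Types (f g h : T -> R).

Lemma ge0_integrable g : measurable_fun setT g -> (forall x, 0 <= g x) ->
  (\int[mu]_(x in D) (g x)%:E < +oo)%E -> mu.-integrable D (EFin \o g).
Proof.
move=> mg g0 goo; apply/integrableP; split.
  by apply/measurable_EFinP; exact: measurable_funTS.
rewrite (eq_integral (fun x => (g x)%:E))// => x _.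
by rewrite gee0_abs// lee_fin.
Qed.

Lemma integrable_EFin_Rintegral g : mu.-integrable D (EFin \o g) ->
  (\int[mu]_(x in D) (g x)%:E)%E = (Rintegral mu D g)%:E.
Proof. by move=> ig; rewrite fineK//; exact: integrable_fin_num ig. Qed.

Lemma ge0_Rintegral_eq0_ae g : measurable_fun setT g -> (forall x, 0 <= g x) ->
  (\int[mu]_(x in D) (g x)%:E <= 0)%E -> {ae mu, forall x, D x -> g x = 0}.
Proof.
move=> mg g0 Ig.
have mgD : measurable_fun D (EFin \o g).
  by apply/measurable_EFinP; exact: measurable_funTS.
have [H _] := ae_eq_integral_abs mu mD mgD.
have {H} : ae_eq mu D (EFin \o g) (cst 0%E).
  apply: H; apply/eqP; rewrite eq_le integral_ge0// andbT.
  rewrite (eq_integral (fun x => (g x)%:E))// => x _.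
  by rewrite /= ger0_norm.
by apply: filterS => x /= H Dx; have [] := H Dx.
Qed.

(** A family of non-negative functions that is stable under maxima and bounded
    in [L^1] has an integrable almost everywhere upper bound: the limit of an
    increasing sequence whose integrals tend to the supremum. A member of the
    family cannot exceed this limit on a set of positive measure, since its maximum
    with a late term of the sequence would have too large an integral. *)
Lemma max_stable_dominated (G : set (T -> R)) (M : R) :
  (forall g, G g -> measurable_fun setT g /\ forall x, 0 <= g x) ->
  (forall f g, G f -> G g -> G (fun x => Num.max (f x) (g x))) ->
  (forall g, G g -> (\int[mu]_(x in D) (g x)%:E <= M%:E)%E) ->
  G !=set0 ->
  exists h, [/\ measurable_fun setT h, forall x, 0 <= h x,
    mu.-integrable D (EFin \o h) &
    forall g, G g -> {ae mu, forall x, D x -> g x <= h x}].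
Proof.
move=> Gm Gmax GM [g00 Gg00].
have Gi g : G g -> mu.-integrable D (EFin \o g).
  move=> Gg; apply: ge0_integrable; [exact: (Gm g Gg).1|exact: (Gm g Gg).2|].
  by apply: le_lt_trans (GM g Gg) _; rewrite ltry.
pose I g := Rintegral mu D g.
have IM g : G g -> I g <= M.
  by move=> Gg; rewrite -lee_fin -integrable_EFin_Rintegral; [exact: GM|exact: Gi].
pose s := sup [set I g | g in G].
have Is g : G g -> I g <= s.
  move=> Gg; apply: ub_le_sup; last by exists g.
  by exists M => _ [g' Gg' <-]; exact: IM.
have exu (j : nat) : exists g, G g /\ s - j.+1%:R^-1 < I g.
  have hs : has_sup [set I g | g in G].
    split; first by exists (I g00), g00.
    by exists M => _ [g' Gg' <-]; exact: IM.
  have [_ [g Gg <-] gs] := sup_adherent (ltac:(by rewrite invr_gt0) : 0 < j.+1%:R^-1 :> R) hs.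
  by exists g.
have [u uP] := choice exu.
pose g_ := fix g_ (j : nat) : T -> R :=
  if j is i.+1 then fun x => Num.max (g_ i x) (u i.+1 x) else u 0%N.
have Gg_ j : G (g_ j).
  elim: j => [|j IH] /=; first exact: (uP _).1.
  by apply: Gmax => //; exact: (uP _).1.
have ug j x : u j x <= g_ j x by case: j => //= j; rewrite le_max lexx orbT.
have g_S j x : g_ j x <= g_ j.+1 x by rewrite /= le_max lexx.
have g_nd x : {homo (fun j => g_ j x) : i j / (i <= j)%N >-> i <= j}.
  by apply/nondecreasing_seqP => j; exact: g_S.
have Ig j : s - j.+1%:R^-1 < I (g_ j).
  apply: lt_le_trans (uP j).2 _; apply: le_Rintegral => //.
  - exact: Gi (uP j).1.
  - exact: Gi.
pose H x := limn (fun j => (g_ j x)%:E).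
have cH x : (fun j => (g_ j x)%:E) @ \oo --> H x.
  apply: ereal_nondecreasing_is_cvgn => i j ij; rewrite lee_fin; exact: g_nd.
have gH j x : ((g_ j x)%:E <= H x)%E.
  apply: lime_ge; first by apply/cvg_ex; eexists; exact: cH.
  by exists j => // i /= ij; rewrite lee_fin; exact: g_nd.
have H0 x : (0 <= H x)%E by apply: le_trans (gH 0%N x); rewrite lee_fin (Gm _ (Gg_ 0%N)).2.
have mH : measurable_fun setT H.
  apply: (@emeasurable_fun_cvg _ _ _ _ (fun j x => (g_ j x)%:E)).
    by move=> j; apply/measurable_EFinP; exact: (Gm _ (Gg_ j)).1.
  by move=> x _; exact: cH.
have IH : (\int[mu]_(x in D) H x <= M%:E)%E.
  have cv : (\int[mu]_(x in D) (g_ j x)%:E)%E @[j --> \oo] --> (\int[mu]_(x in D) H x)%E.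
    apply: cvg_monotone_convergence => //.
    - move=> j; apply/measurable_EFinP/measurable_funTS; exact: (Gm _ (Gg_ j)).1.
    - by move=> j x _; rewrite lee_fin (Gm _ (Gg_ j)).2.
    - by move=> x _ i j ij; rewrite lee_fin; exact: g_nd.
  rewrite -(cvg_lim _ cv)//; apply: lime_le; first by apply/cvg_ex; eexists; exact: cv.
  by apply: nearW => j; exact: GM.
have Hfin : {ae mu, forall x, D x -> H x \is a fin_num}.
  apply: integrable_ae => //; apply/integrableP; split; first exact: measurable_funTS.
  rewrite (eq_integral H) => [|x _]; last by rewrite gee0_abs.
  by apply: le_lt_trans IH _; rewrite ltry.
pose h x := fine (H x).
have mh : measurable_fun setT h.
  by apply: (measurableT_comp _ mH); exact: fine_measurable.
have h0 x : 0 <= h x by rewrite fine_ge0.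
have gh j : {ae mu, forall x, D x -> g_ j x <= h x}.
  apply: filterS Hfin => x HH Dx.
  by rewrite -lee_fin /h fineK ?HH.
have Ih : (\int[mu]_(x in D) (h x)%:E <= M%:E)%E.
  apply: le_trans IH; apply: ae_ge0_le_integral => //.
  - by move=> x _; rewrite lee_fin.
  - exact/measurable_EFinP/measurable_funTS.
  - exact: measurable_funTS.
  - by apply: filterS Hfin => x HH Dx; rewrite /h fineK ?HH.
exists h; split=> //.
  by apply: ge0_integrable => //; apply: le_lt_trans Ih _; rewrite ltry.
move=> f Gf.
pose p x := Num.max (f x - h x) 0.
have mp : measurable_fun setT p.
  apply: measurable_maxr; last exact: measurable_cst.
  by apply: measurable_funB => //; exact: (Gm f Gf).1.
have p0 x : 0 <= p x by rewrite le_max lexx orbT.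
suff : {ae mu, forall x, D x -> p x = 0}.
  apply: filterS => x px Dx; have := px Dx; rewrite /p => /eqP.
  by rewrite eq_maxr subr_le0.
apply: ge0_Rintegral_eq0_ae => //; apply/lee_addgt0Pr => e e0; rewrite add0e.
have [j je] : exists j : nat, j.+1%:R^-1 < e :> R.
  exact: invr_nat_lt.
apply: (@le_trans _ _ (j.+1%:R^-1)%:E); last by rewrite lee_fin ltW.
pose mx x := Num.max (f x) (g_ j x).
have Gmx : G mx by exact: Gmax.
apply: (@le_trans _ _ (\int[mu]_(x in D) (mx x - g_ j x)%:E)%E).
  apply: ae_ge0_le_integral => //.
  - by move=> x _; rewrite lee_fin.
  - exact/measurable_EFinP/measurable_funTS.
  - by move=> x _; rewrite lee_fin subr_ge0 le_max lexx orbT.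
  - apply/measurable_EFinP/measurable_funTS/measurable_funB.
      exact: (Gm _ Gmx).1.
    exact: (Gm _ (Gg_ j)).1.
  - apply: filterS (gh j) => x ghx Dx; rewrite lee_fin /p /mx ge_max.
    rewrite subr_ge0 le_max lexx orbT andbT.
    by apply: lerB; [rewrite le_max lexx|exact: ghx].
have iB : mu.-integrable D (EFin \o (fun x => mx x - g_ j x)).
  rewrite /comp; under eq_fun do rewrite EFinB.
  by apply: integrableB => //; exact: Gi.
rewrite integrable_EFin_Rintegral// lee_fin RintegralB//; [|exact: Gi|exact: Gi].
rewrite lerBlDl (le_trans (Is _ Gmx))// -lerBlDr ltW//; exact: Ig.
Qed.

End Domination.

(** * Closedness of the set of integrals *)

Section Minimisation.
Variable R : realType.

(** The infima of [J] over the sets [C m] increase with [m] to a limit [d]. Far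
    enough in the sequence, an almost-minimiser has a value at most [d + e], and
    the midpoint of two of them, which lies in the larger of the two sets, has one
    at least [d - e]. For a squared norm the left side of the last inequality is
    the squared distance, by the parallelogram law. *)
Lemma almost_minimisers (A : Type) (J : A -> R) (mid : A -> A -> A)
    (C : nat -> set A) (B : R) (e : nat -> R) :
  (forall m, C m !=set0) ->
  (forall m l, (m <= l)%N -> C l `<=` C m) ->
  (forall m f g, C m f -> C m g -> C m (mid f g)) ->
  (forall f, C 0%N f -> 0 <= J f <= B) ->
  (forall j, 0 < e j) -> (forall j, e j.+1 <= e j) ->
  exists f : nat -> A, (forall j, C j (f j)) /\
    forall j, 2 * J (f j) + 2 * J (f j.+1) - 4 * J (mid (f j) (f j.+1)) <= 8 * e j.
Proof.
move=> C0 Cdec Cmid JB e0 edec.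
have CB m f : C m f -> 0 <= J f <= B by move=> Cf; apply: JB; exact: (Cdec 0%N m).
pose D m := inf [set J f | f in C m].
have Dlb m f : C m f -> D m <= J f.
  move=> Cf; apply: ge_inf; last by exists f.
  by exists 0 => _ [g Cg <-]; have /andP[] := CB m g Cg.
have hasD : has_sup [set D m | m in [set: nat]].
  split; first by exists (D 0%N), 0%N.
  exists B => _ [m _ <-]; have [f Cf] := C0 m.
  by apply: (le_trans (Dlb m f Cf)); have /andP[] := CB m f Cf.
pose d := sup [set D m | m in [set: nat]].
have Dd m : D m <= d by apply: ub_le_sup; [exact: hasD.2|exists m].
have Dmono m l : (m <= l)%N -> D m <= D l.
  move=> ml; apply: lb_le_inf; first by have [f Cf] := C0 l; exists (J f), f.
  by move=> _ [f Cf <-]; apply: Dlb; exact: (Cdec m l).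
have exm j : exists m, (j <= m)%N /\ d - e j < D m.
  have [_ [m _ <-] dm] := sup_adherent (e0 j) hasD.
  exists (maxn j m); split; first exact: leq_maxl.
  by apply: lt_le_trans dm _; apply: Dmono; exact: leq_maxr.
have [m mP] := choice exm.
have exf j : exists f, C (m j) f /\ J f < d + e j.
  have hi : has_inf [set J f | f in C (m j)].
    split; first by have [f Cf] := C0 (m j); exists (J f), f.
    by exists 0 => _ [g Cg <-]; have /andP[] := CB _ g Cg.
  have [_ [f Cf <-] Jf] := inf_adherent (e0 j) hi.
  by exists f; split=> //; apply: lt_le_trans Jf _; rewrite lerD2r; exact: Dd.
have [f fP] := choice exf.
exists f; split; first by move=> j; apply: (Cdec _ (m j)) (fP j).1; exact: (mP j).1.
move=> j; have [Cj Jj] := fP j; have [Cj1 Jj1] := fP j.+1.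
pose l := minn (m j) (m j.+1).
have Dl : d - e j < D l.
  rewrite /l /minn; case: ifP => _; first exact: (mP j).2.
  apply: le_lt_trans (mP j.+1).2; exact: lerB.
have : D l <= J (mid (f j) (f j.+1)).
  apply: Dlb; apply: Cmid.
    by apply: (Cdec _ (m j)) => //; exact: geq_minl.
  by apply: (Cdec _ (m j.+1)) => //; exact: geq_minr.
have := edec j; lra.
Qed.

Lemma geometric_increments_cvg (a : R^nat) (L : R) :
  (forall j, `|a j.+1 - a j| <= L * 2^-1 ^+ j) -> cvgn a.
Proof.
move=> aL.
have L0 : 0 <= L.
  by have := aL 0%N; rewrite expr0 mulr1; apply: le_trans.
have cs : cvgn (series (telescope a)).
  apply: (@normed_cvg _ R^o).
  apply: (@series_le_cvg _ _ (geometric L 2^-1)).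
  - by move=> j; exact: normr_ge0.
  - by move=> j; exact: geometric_ge0.
  - by move=> j; exact: aL.
  - by apply: is_cvg_geometric_series; rewrite gtr0_norm ?invr_gt0// invf_lt1// ltr1n.
have -> : a = (fun j => a 0%N + series (telescope a) j).
  by apply/funext => j; exact: eq_sum_telescope.
by apply: is_cvgD => //; exact: is_cvg_cst.
Qed.

Variables (disp : measure_display) (T : measurableType disp).
Variables (mu : {measure set T -> \bar R}) (D : set T).
Hypothesis mD : measurable D.

(** The sum of the functions has a finite integral, hence is finite almost
    everywhere. *)
Lemma summable_integrals_ae_bounded (p : nat -> T -> R) (c : R) :
  (forall j, measurable_fun setT (p j)) -> (forall j x, 0 <= p j x) ->
  (forall j, (\int[mu]_(x in D) (p j x)%:E <= (c / (2 ^ (j + 1))%:R)%:E)%E) ->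
  {ae mu, forall x, D x -> exists K : R, forall j, p j x <= K}.
Proof.
move=> mp p0 Ip.
have mpE j : measurable_fun D (fun x => (p j x)%:E).
  exact/measurable_EFinP/measurable_funTS.
have p0E j x : D x -> (0 <= (p j x)%:E)%E by rewrite lee_fin.
pose P x := (\sum_(0 <= j <oo) (p j x)%:E)%E.
have P0 x : (0 <= P x)%E by apply: nneseries_ge0 => j _ _; rewrite lee_fin.
have IP : (\int[mu]_(x in D) P x < +oo)%E.
  rewrite /P integral_nneseries//.
  apply: (@le_lt_trans _ _ (\sum_(0 <= j <oo) (c / (2 ^ (j + 1))%:R)%:E)%E).
    apply: lee_nneseries => j _; last exact: Ip.
    by move=> _; apply: integral_ge0 => x; exact: p0E.
  by rewrite (cvg_lim _ (@cvg_geometric_eseries_half R c 0))// ltry.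
have mP : measurable_fun D P.
  by apply: ge0_emeasurable_sum => // j x Dx _; exact: p0E.
have : {ae mu, forall x, D x -> P x \is a fin_num}.
  apply: integrable_ae => //; apply/integrableP; split=> //.
  by rewrite (eq_integral P)// => x _; rewrite gee0_abs.
apply: filterS => x Px Dx; exists (fine (P x)) => j.
rewrite -lee_fin fineK; last exact: Px.
rewrite /P (@nneseriesD1 R _ j)//; last by move=> i _; rewrite lee_fin.
by rewrite leeDl// nneseries_ge0// => i _ _; rewrite lee_fin.
Qed.

End Minimisation.

Section AumannIntegral.
Variables (R : realType) (k : scalar_kind) (n : nat).
Variables (disp : measure_display) (T : measurableType disp).
Variables (mu : {measure set T -> \bar R}) (D : set T).
Hypothesis mD : measurable D.
Local Notation F := (scalar R k).
Local Notation V := 'cV[F]_n.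
Implicit Types (f g : T -> V).

Definition vmeasurable f : Prop := forall i, smeasurable (fun x => f x i 0).

Lemma measurable_vnorm f : vmeasurable f -> measurable_fun setT (fun x => vnorm (f x)).
Proof.
move=> mf; rewrite /vnorm; under eq_fun do rewrite sRe_dotuu.
apply: (measurableT_comp (continuous_measurable_fun (@sqrt_continuous R))).
by apply: measurable_sum => i; apply: measurable_funX; exact: measurable_smod.
Qed.

Lemma vmeasurableD f g : vmeasurable f -> vmeasurable g ->
  vmeasurable (fun x => f x + g x).
Proof.
by move=> mf mg i; under eq_fun do rewrite mxE; exact: smeasurableD.
Qed.

Lemma vmeasurableZ (a : T -> F) f : smeasurable a -> vmeasurable f ->
  vmeasurable (fun x => a x *: f x).
Proof.
by move=> ma mf i; under eq_fun do rewrite mxE; exact: smeasurableM.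
Qed.

Lemma sRe_coord_le f i x : `|sRe (f x i 0)| <= vnorm (f x).
Proof. exact: le_trans (sRe_le_smod _) (smod_coord_le _ _). Qed.

Lemma sIm_coord_le f i x : `|sIm (f x i 0)| <= vnorm (f x).
Proof. exact: le_trans (sIm_le_smod _) (smod_coord_le _ _). Qed.

Definition midpoint f g : T -> V := fun x => sreal k 2^-1 *: (f x + g x).

Lemma parallelogram (u v : V) :
  vnorm (u - v) ^+ 2 = 2 * vnorm u ^+ 2 + 2 * vnorm v ^+ 2
                       - 4 * vnorm (sreal k 2^-1 *: (u + v)) ^+ 2.
Proof.
rewrite vnormZ smod_sreal gtr0_norm ?invr_gt0// exprMn !vnormD_sqr.
rewrite -scaleN1r vnormZ smodN smod1 mul1r scaleN1r dotNr raddfN /=.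
by field.
Qed.

Lemma sreal_half_sub (a b c : F) :
  sreal k 2^-1 * (a + b) - c = sreal k 2^-1 * ((a - c) + (b - c)).
Proof.
by apply: sextP; rewrite ?(sReM, sImM, raddfB, raddfD) /= ?(sReM, sImM, raddfB, raddfD)
  ?sRe_sreal ?sIm_sreal /=; field.
Qed.

(** Total, so as to be measurable without discussion of where the limit exists. *)
Definition real_limit (a : nat -> T -> R) (x : T) : R :=
  fine (limn_esup (fun j => (a j x)%:E)).

Lemma measurable_real_limit (a : nat -> T -> R) :
  (forall j, measurable_fun setT (a j)) -> measurable_fun setT (real_limit a).
Proof.
move=> ma; apply: (measurableT_comp (@fine_measurable R _ measurableT)).
apply: measurable_fun_limn_esup => j; exact/measurable_EFinP.
Qed.

Lemma real_limitP (a : nat -> T -> R) x :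
  cvgn (fun j => a j x) -> a j x @[j --> \oo] --> real_limit a x.
Proof.
move=> ca; rewrite /real_limit.
have cE : (a j x)%:E @[j --> \oo] --> (limn (fun j => a j x))%:E.
  by apply: cvg_EFin => //; exact: nearW.
rewrite is_cvg_limn_esupE; last by apply/cvg_ex; eexists; exact: cE.
by rewrite (cvg_lim _ cE).
Qed.

Variable S : set (T -> V).
Hypothesis S_meas : forall f, S f -> vmeasurable f.
Hypothesis S_mid : forall f g, S f -> S g -> S (midpoint f g).
Hypothesis S_decomposable : forall f g (b : T -> bool), measurable_fun setT b ->
  S f -> S g -> S (fun x => if b x then f x else g x).
Variable M : R.
Hypothesis S_bounded :
  forall f, S f -> (\int[mu]_(x in D) (vnorm (f x))%:E <= M%:E)%E.
Hypothesis S_closed : forall (s : nat -> T -> V) f, (forall j, S (s j)) ->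
  vmeasurable f -> (forall x, ~ D x -> f x = 0) ->
  {ae mu, forall x, D x -> forall i,
     (sRe (s j x i 0) @[j --> \oo] --> sRe (f x i 0)) /\
     (sIm (s j x i 0) @[j --> \oo] --> sIm (f x i 0))} ->
  S f.

(** Selecting pointwise the longer of two functions realises the maximum of their
    norms. *)
Lemma selections_dominated : S !=set0 ->
  exists h : T -> R, [/\ measurable_fun setT h, forall x, 0 <= h x,
    mu.-integrable D (EFin \o h) &
    forall f, S f -> {ae mu, forall x, D x -> vnorm (f x) <= h x}].
Proof.
move=> [f0 Sf0].
have [||||h [mh h0 ih hS]] := @max_stable_dominated R disp T mu D mD
   [set (fun x => vnorm (f x)) | f in S] M.
- move=> _ [f Sf <-]; split; last by move=> x; exact: vnorm_ge0.
  by apply: measurable_vnorm; exact: S_meas.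
- move=> _ _ [f Sf <-] [g Sg <-].
  exists (fun x => if vnorm (f x) < vnorm (g x) then g x else f x).
    apply: S_decomposable => //; apply: measurable_fun_ltr;
      by apply: measurable_vnorm; exact: S_meas.
  by apply/funext => x; rewrite fun_if maxElt.
- by move=> _ [f Sf <-]; exact: S_bounded.
- by exists (fun x => vnorm (f0 x)), f0.
by exists h; split=> // f Sf; apply: hS; exists f.
Qed.

Lemma selection_sintegrable f i : S f -> mu_sintegrable mu D (fun x => f x i 0).
Proof.
move=> Sf; apply/sintegrableP => //; first exact: S_meas.
apply: (@le_lt_trans _ _ M%:E); last by rewrite ltry.
apply: le_trans (S_bounded Sf); apply: ge0_le_integral => //.
- by move=> x _; rewrite lee_fin smod_ge0.
- by apply/measurable_EFinP/measurable_funTS/measurable_smod; exact: S_meas.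
- by apply/measurable_EFinP/measurable_funTS/measurable_vnorm; exact: S_meas.
- by move=> x _; rewrite lee_fin smod_coord_le.
Qed.

(** Minimising a weighted [L^2] norm over the selections whose integrals are close
    to [w] produces, by the parallelogram law, an almost everywhere convergent
    sequence, to whose limit dominated convergence applies. The weight
    [1 / (1 + h)], with [h] dominating all selections, makes the norm finite. *)
Lemma aumann_integral_closed (w : V) :
  (forall e, 0 < e -> exists2 f, S f &
     forall i, smod (mu_sintegral mu D (fun x => f x i 0) - w i 0) <= e) ->
  exists2 f, S f & forall i, mu_sintegral mu D (fun x => f x i 0) = w i 0.
Proof.
move=> Sw.
have S0 : S !=set0 by have [f Sf _] := Sw 1 ltr01; exists f.
have [h [mh h0 ih hS]] := selections_dominated S0.
pose wt x := (1 + h x)^-1.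
have h1 x : 0 < 1 + h x by rewrite ltr_pwDl.
have wt0 x : 0 < wt x by rewrite invr_gt0.
have mwt : measurable_fun setT wt.
  apply: measurable_inv => [|x]; last exact: ltW.
  by apply: measurable_funD => //; exact: measurable_cst.
pose q f x := vnorm (f x) ^+ 2 * wt x.
have q0 f x : 0 <= q f x by rewrite mulr_ge0 ?sqr_ge0 ?ltW.
have mq f : vmeasurable f -> measurable_fun setT (q f).
  move=> mf; apply: measurable_funM => //; apply: measurable_funX.
  exact: measurable_vnorm.
have qh f : S f -> {ae mu, forall x, D x -> q f x <= h x}.
  move=> Sf; apply: filterS (hS f Sf) => x fh Dx.
  rewrite /q ler_pdivrMr// expr2.
  apply: (@le_trans _ _ (h x * h x)); last by rewrite ler_wpM2l// lerDr.
  by apply: ler_pM; rewrite ?vnorm_ge0 ?fh.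
have Iqh f : S f -> (\int[mu]_(x in D) (q f x)%:E <= \int[mu]_(x in D) (h x)%:E)%E.
  move=> Sf; apply: ae_ge0_le_integral => //.
  - by move=> x _; rewrite lee_fin.
  - by apply/measurable_EFinP/measurable_funTS/mq; exact: S_meas.
  - by move=> x _; rewrite lee_fin.
  - exact/measurable_EFinP/measurable_funTS.
  - by apply: filterS (qh f Sf) => x H Dx; rewrite lee_fin; exact: H.
have iq f : S f -> mu.-integrable D (EFin \o q f).
  move=> Sf; apply: ge0_integrable => //; first by apply: mq; exact: S_meas.
  by apply: le_lt_trans (Iqh f Sf) _; rewrite integrable_EFin_Rintegral// ltry.
pose J f := Rintegral mu D (q f).
pose C (m : nat) := [set f | S f /\
  forall i, smod (mu_sintegral mu D (fun x => f x i 0) - w i 0) <= m.+1%:R^-1].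
have [||||||f [Cf Jf]] := @almost_minimisers R (T -> V) J midpoint C
    (Rintegral mu D h) (fun j => 8^-1 ^+ j).
- by move=> m; have [|f Sf fw] := Sw m.+1%:R^-1; [rewrite invr_gt0|exists f].
- move=> m l ml f [Sf fw]; split=> // i; apply: le_trans (fw i) _.
  by rewrite lef_pV2 ?posrE// ler_nat ltnS.
- move=> m f g [Sf fw] [Sg gw]; split; first exact: S_mid.
  move=> i; have iff := selection_sintegrable i Sf.
  have igg := selection_sintegrable i Sg.
  have -> : (fun x => midpoint f g x i 0) = (fun x => sreal k 2^-1 * (f x i 0 + g x i 0)).
    by apply/funext => x; rewrite !mxE.
  rewrite sintegralZ//; last exact: sintegrableD.
  rewrite sintegralD//.
  set a := mu_sintegral _ _ _; set b := mu_sintegral _ _ _.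
  rewrite sreal_half_sub.
  rewrite smodM smod_sreal gtr0_norm ?invr_gt0// ler_pdivrMl//.
  by apply: (le_trans (smodD _ _)); rewrite mulr_natl mulr2n; exact: lerD (fw i) (gw i).
- move=> f [Sf _]; rewrite Rintegral_ge0/=; last by move=> x _; exact: q0.
  by rewrite -lee_fin -!integrable_EFin_Rintegral//; [exact: Iqh|exact: iq].
- by move=> j; rewrite exprn_gt0.
- by move=> j; rewrite exprS ler_piMl ?exprn_ge0// invf_le1// ler1n.
have Sf j : S (f j) := (Cf j).1.
have mf j : vmeasurable (f j) by exact: S_meas.
pose df j x := f j x - f j.+1 x.
have mdf j : vmeasurable (df j).
  move=> i; rewrite /df.
  under eq_fun do rewrite !mxE -[X in _ + X]mulN1r.
  apply: smeasurableD; first exact: mf.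
  by apply: smeasurableM; [exact: smeasurable_cst|exact: mf].
(* the defects decrease like [8^-j]; the factor [4^j] keeps them summable and
   turns an almost everywhere bound into geometric decay of the increments *)
have Idf j : (\int[mu]_(x in D) (4 ^+ j * q (df j) x)%:E <= (16 / (2 ^ (j + 1))%:R)%:E)%E.
  have qE x : q (df j) x = 2 * q (f j) x + 2 * q (f j.+1) x
                         - 4 * q (midpoint (f j) (f j.+1)) x.
    by rewrite /q /df /midpoint parallelogram; ring.
  have iqm := iq _ (S_mid (Sf j) (Sf j.+1)).
  have iZ (c : R) (g : T -> R) : mu.-integrable D (EFin \o g) -> mu.-integrable D (EFin \o (fun x => c * g x)).
    by move=> ig; rewrite /comp; under eq_fun do rewrite EFinM; exact: integrableZl.
  have i1 : mu.-integrable D (EFin \o (fun x => 2 * q (f j) x + 2 * q (f j.+1) x)).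
    rewrite /comp; under eq_fun do rewrite EFinD.
    by apply: integrableD => //; apply: iZ; exact: iq.
  have i2 : mu.-integrable D (EFin \o q (df j)).
    rewrite /comp; under eq_fun do rewrite qE EFinB.
    by apply: integrableB => //; exact: iZ.
  rewrite (integrable_EFin_Rintegral mD); last exact: iZ.
  rewrite lee_fin RintegralZl//.
  have -> : Rintegral mu D (q (df j)) = 2 * J (f j) + 2 * J (f j.+1) - 4 * J (midpoint (f j) (f j.+1)).
    rewrite /J -!RintegralZl//; [|exact: iq|exact: iq].
    rewrite -RintegralD//; [|exact/iZ/iq|exact/iZ/iq].
    rewrite -RintegralB//; last exact: iZ.
    by apply: eq_Rintegral => x _; exact: qE.
  apply: (@le_trans _ _ (4 ^+ j * (8 * 8^-1 ^+ j))).
    by rewrite ler_wpM2l// exprn_ge0.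
  rewrite mulrCA -exprMn (_ : 4 * 8^-1 = 2^-1 :> R); last by field.
  rewrite natrX exprD expr1 invfM exprVn.
  have z0 : 0 < (2 ^- j : R) by rewrite invr_gt0 exprn_gt0.
  by lra.
have cvf : {ae mu, forall x, D x -> forall i,
    cvgn (fun j => sRe (f j x i 0)) /\ cvgn (fun j => sIm (f j x i 0))}.
  have := @summable_integrals_ae_bounded R disp T mu D mD
    (fun j x => 4 ^+ j * q (df j) x) 16.
  have m4 j : measurable_fun setT (fun x => 4 ^+ j * q (df j) x).
    by apply: measurable_funM; [exact: measurable_cst|exact: mq].
  have p4 j x : 0 <= 4 ^+ j * q (df j) x by rewrite mulr_ge0// exprn_ge0.
  move=> /(_ m4 p4 Idf); apply: filterS => x HK Dx i.
  have [K KP] := HK Dx.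
  have dfK j : vnorm (df j x) <= Num.sqrt (K * (1 + h x)) * 2^-1 ^+ j.
    have K0 : 0 <= K by apply: le_trans (KP 0%N).
    rewrite -(@ler_pXn2r _ 2) ?nnegrE ?vnorm_ge0 ?mulr_ge0 ?sqrtr_ge0 ?exprn_ge0//.
    rewrite exprMn [Num.sqrt (K * _) ^+ 2]sqr_sqrtr; last by rewrite mulr_ge0// ltW.
    rewrite exprAC.
    have := KP j; rewrite /q mulrA ler_pdivrMr// => H.
    rewrite (_ : 2^-1 ^+ 2 = 4^-1 :> R); last by field.
    by rewrite exprVn ler_pdivlMr ?exprn_gt0// mulrC.
  split; apply: (@geometric_increments_cvg _ _ (Num.sqrt (K * (1 + h x)))) => j.
    apply: le_trans (dfK j); rewrite distrC -raddfB /=.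
    have -> : f j x i 0 - f j.+1 x i 0 = df j x i 0 by rewrite !mxE.
    exact: sRe_coord_le.
  apply: le_trans (dfK j); rewrite distrC -raddfB /=.
  have -> : f j x i 0 - f j.+1 x i 0 = df j x i 0 by rewrite !mxE.
  exact: sIm_coord_le.
pose fre i := real_limit (fun j x => sRe (f j x i 0)).
pose fim i := real_limit (fun j x => sIm (f j x i 0)).
pose fl x : V := if x \in D then \col_i sMk k (fre i x) (fim i x) else 0.
have mfl : vmeasurable fl.
  move=> i; rewrite /fl.
  have -> : (fun x => (if x \in D then \col_i0 sMk k (fre i0 x) (fim i0 x) else 0 : V) i 0)
    = (fun x => if x \in D then sMk k (fre i x) (fim i x) else 0).
    by apply/funext => x; case: ifP; rewrite mxE.
  apply: smeasurable_if; [exact: mD| |exact: smeasurable_cst].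
  split.
    under eq_fun do rewrite sRe_sMk.
    by apply: measurable_real_limit => j; exact: (mf j i).1.
  under eq_fun do rewrite sIm_sMk.
  apply: measurable_funM; first exact: measurable_cst.
  by apply: measurable_real_limit => j; exact: (mf j i).2.
have cvfl : {ae mu, forall x, D x -> forall i,
     (sRe (f j x i 0) @[j --> \oo] --> sRe (fl x i 0)) /\
     (sIm (f j x i 0) @[j --> \oo] --> sIm (fl x i 0))}.
  apply: filterS cvf => x H Dx i; have [cr ci] := H Dx i.
  rewrite /fl mem_set// mxE sRe_sMk sIm_sMk; split; first exact: real_limitP.
  have -> : (fun j => sIm (f j x i 0)) = (fun j => is_complex R k * sIm (f j x i 0)).
    by apply/funext => j; rewrite is_complex_sIm.
  by apply: cvgMl_tmp; exact: real_limitP.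
have Sfl : S fl.
  apply: (S_closed Sf) => // x Dx; rewrite /fl memNset//.
exists fl => // i.
have dom j : {ae mu, forall x, D x -> vnorm (f j x) <= h x} by exact: hS.
have domall : {ae mu, forall x, forall j, D x -> vnorm (f j x) <= h x}.
  exact: ae_foralln.
have sintlim j : smod (mu_sintegral mu D (fun x => f j x i 0) - w i 0) <= j.+1%:R^-1 := (Cf j).2 i.
have lim_part (a : nat -> T -> R) (al : T -> R) (b : R) :
    (forall j, measurable_fun setT (a j)) -> measurable_fun setT al ->
    (forall j x, `|a j x| <= vnorm (f j x)) ->
    {ae mu, forall x, D x -> a j x @[j --> \oo] --> al x} ->
    (forall j, mu.-integrable D (EFin \o a j)) ->
    (forall j, `|Rintegral mu D (a j) - b| <= j.+1%:R^-1) ->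
    Rintegral mu D al = b.
  move=> ma mal af aal ia ab.
  have mE (g : T -> R) : measurable_fun setT g -> measurable_fun D (fun x => (g x)%:E : \bar R).
    by move=> mg; exact/measurable_EFinP/measurable_funTS.
  have [] := @dominated_convergence _ _ _ mu D mD (fun j x => (a j x)%:E)
     (fun x => (al x)%:E) (fun x => (h x)%:E).
  - by move=> j; exact: mE.
  - exact: mE.
  - by apply: filterS aal => x H Dx; apply: cvg_EFin; [exact: nearW|exact: H].
  - exact: ih.
  - by apply: filterS domall => x H j Dx; rewrite lee_fin (le_trans (af j x))// H.
  move=> ial _ cI.
  have c1 : Rintegral mu D (a j) @[j --> \oo] --> Rintegral mu D al.
    apply: fine_cvg; rewrite -integrable_EFin_Rintegral//.
  have c2 : Rintegral mu D (a j) @[j --> \oo] --> b.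
    apply/cvgrPdist_le => e e0; have [m me] := invr_nat_lt e0.
    exists m => // j /= mj; rewrite distrC (le_trans (ab j))//.
    by apply: le_trans (ltW me); rewrite lef_pV2 ?posrE// ler_nat ltnS.
  exact: (cvg_unique _ c1 c2).
apply: sextP.
  rewrite sRe_sintegral; apply: (lim_part (fun j x => sRe (f j x i 0))).
  - by move=> j; exact: (mf j i).1.
  - exact: (mfl i).1.
  - by move=> j x; exact: sRe_coord_le.
  - by apply: filterS cvfl => x H Dx; exact: (H Dx i).1.
  - by move=> j; exact: (selection_sintegrable i (Sf j)).1.
  - move=> j; rewrite -sRe_sintegral -raddfB.
    exact: le_trans (sRe_le_smod _) (sintlim j).
rewrite sIm_sintegral; apply: (lim_part (fun j x => sIm (f j x i 0))).
- by move=> j; exact: (mf j i).2.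
- exact: (mfl i).2.
- by move=> j x; exact: sIm_coord_le.
- by apply: filterS cvfl => x H Dx; exact: (H Dx i).2.
- by move=> j; exact: (selection_sintegrable i (Sf j)).2.
- move=> j; rewrite -sIm_sintegral -raddfB.
  exact: le_trans (sIm_le_smod _) (sintlim j).
Qed.

End AumannIntegral.

(** * Topology of the vector space and convex bodies *)

Section VectorTopology.
Variables (R : realType) (k : scalar_kind) (n : nat).
Local Notation F := (scalar R k).
Local Notation V := 'cV[F]_n.
Implicit Types (u v w : V) (K E : set V).

Definition close_to (e : R) v u : Prop := forall i, smod (u i 0 - v i 0) < e.

(** The topology of [V] comes from the norm of the scalar field, whose values lie
    in [F]; here it is described by real radii. *)
Lemma nbhs_close v (B : set V) :
  nbhs v B <-> exists2 e : R, 0 < e & close_to e v `<=` B.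
Proof.
have ballE (e : F) u : 0 < e -> ball v e u <-> close_to (sRe e) v u.
  move=> e0; have eE : e = sreal k (sRe e) by apply: ge0_sreal; exact: ltW.
  split=> [H i|H].
    have := H.2 i 0; rewrite /ball /= normE [X in _ < X]eE ltr_sreal.
    by rewrite -smodN opprB.
  split=> // i j; rewrite ord1 /ball /= normE [X in _ < X]eE ltr_sreal.
  by rewrite -smodN opprB; exact: H.
split=> [/nbhs_ballP[e /= e0 eB]|[e e0 eB]].
  exists (sRe e).
    have := e0; rewrite {1}(ge0_sreal (ltW e0)) -[X in X < _](raddf0 (@sreal R k)).
    by rewrite ltr_sreal.
  by move=> u /(ballE e u e0); exact: eB.
have e0' : 0 < sreal k e by rewrite -[X in X < _](raddf0 (@sreal R k)) ltr_sreal.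
apply/nbhs_ballP; exists (sreal k e) => //= u /(ballE _ u e0').
by rewrite sRe_sreal; exact: eB.
Qed.

Lemma closed_approxP K : closed K <->
  forall v, (forall e : R, 0 < e -> exists2 u, K u & close_to e v u) -> K v.
Proof.
split=> [cK v H|H v clv].
  apply: cK => B /nbhs_close[e e0 eB].
  by have [u Ku uv] := H e e0; exists u; split=> //; exact: eB.
apply: H => e e0; have [|u [Ku uv]] := clv (close_to e v).
  by apply/nbhs_close; exists e.
by exists u.
Qed.

Lemma open_closeP E : open E <->
  forall v, E v -> exists2 e : R, 0 < e & close_to e v `<=` E.
Proof.
rewrite openE; split=> H v Ev; first by apply/nbhs_close; exact: H.
by apply/nbhs_close; exact: H.
Qed.

Lemma closed_limit K (s : nat -> V) v : closed K -> (forall j, K (s j)) ->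
  (forall i, (sRe (s j i 0) @[j --> \oo] --> sRe (v i 0)) /\
             (sIm (s j i 0) @[j --> \oo] --> sIm (v i 0))) -> K v.
Proof.
move=> cK Ks sv; apply: ((closed_approxP K).1 cK) => e e0.
have e2 : 0 < e / 2 by rewrite divr_gt0.
have : \forall j \near \oo, forall i, smod (s j i 0 - v i 0) < e.
  apply: filter_forall => i; have [/cvgrPdist_lt/(_ _ e2) cr /cvgrPdist_lt/(_ _ e2) ci] := sv i.
  near=> j; rewrite -smodN opprB; apply: (le_lt_trans (smod_le_ReIm _)).
  rewrite !raddfB /= [e]splitr ltrD//; near: j; [exact: cr|exact: ci].
by case=> N _ /(_ N (leqnn N)) H; exists (s N).
Unshelve. all: end_near. Qed.

Lemma vec_eq_approx v w :
  (forall e : R, 0 < e -> forall i, smod (v i 0 - w i 0) <= e) -> v = w.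
Proof.
move=> H; apply/matrixP => i j; rewrite ord1; apply/eqP.
rewrite -subr_eq0 -smod_eq0 eq_le smod_ge0 andbT.
by apply/ler_addgt0Pr => e e0; rewrite add0r; exact: H.
Qed.

Lemma closed_zero : closed [set (0 : V)].
Proof.
apply/closed_approxP => v H /=; apply: vec_eq_approx => e e0 i.
by have [u /= -> uv] := H e e0; rewrite -smodN opprB ltW//; exact: uv.
Qed.

Lemma smod_le_approx (z : F) (c : R) :
  (forall e : R, 0 < e -> exists2 w : F, smod w <= c & smod (w - z) <= e) -> smod z <= c.
Proof.
move=> H; apply/ler_addgt0Pr => e e0; have [w wc wz] := H e e0.
rewrite -[z](subrK w) addrC (le_trans (smodD _ _))// lerD//.
by rewrite -smodN opprB.
Qed.

Lemma segK_sub (a : F) u : smod a <= 1 -> segK (a *: u) `<=` segK u.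
Proof.
move=> a1 _ [b /= b1 <-]; exists (b * a); last by rewrite scalerA.
by move: b1; rewrite /= !le_norm1 smodM => b1; rewrite mulr_ile1// smod_ge0.
Qed.

Lemma segK_self u : segK u u.
Proof. by exists 1; rewrite ?scale1r//= normr1. Qed.

Lemma segKP u v : segK u `<=` segK v -> exists2 a : F, smod a <= 1 & u = a *: v.
Proof. by move=> /(_ _ (segK_self u)) [a /=]; rewrite le_norm1; exists a. Qed.

(** A limit of multiples of [u] is a multiple of [u]: its coefficient is read off
    at a coordinate where [u] does not vanish. *)
Lemma closed_segK u : closed (segK u).
Proof.
apply/closed_approxP => v H.
have [u0|u0] := eqVneq u 0.
  exists 0; first by rewrite /= normr0 ler01.
  rewrite u0 scaler0.
  apply: vec_eq_approx => e e0 i; have [_ [a _ <-]] := H e e0.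
  by rewrite u0 scaler0 => /(_ i)/ltW.
have [i ui] : exists i, u i 0 != 0.
  apply/existsP; apply: contra_neqT u0; rewrite negb_exists => /forallP H0.
  by apply/matrixP => i j; rewrite ord1 mxE; apply/eqP; have := H0 i; rewrite negbK.
have sui : 0 < smod (u i 0) by rewrite lt_def smod_ge0 smod_eq0 ui.
pose a := v i 0 / u i 0.
have aa e : 0 < e -> exists b : F,
    [/\ smod b <= 1, smod (b - a) <= e & forall l, smod (b * u l 0 - v l 0) <= e].
  move=> e0; pose e' := Num.min e (e * smod (u i 0)).
  have e'0 : 0 < e' by rewrite lt_min e0 mulr_gt0.
  have [_ [b /= b1 <-] uv] := H e' e'0; exists b; split.
  - by rewrite -le_norm1.
  - have := uv i; rewrite mxE => /ltW.
    have -> : b * u i 0 - v i 0 = (b - a) * u i 0 by rewrite mulrBl divfK.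
    rewrite smodM -ler_pdivlMr// => /le_trans; apply.
    by rewrite ler_pdivrMr// ge_min lexx orbT.
  - by move=> l; have := uv l; rewrite mxE => /ltW/le_trans; apply; rewrite ge_min lexx.
exists a.
  rewrite /= le_norm1; apply: smod_le_approx => e e0.
  by have [b [b1 ba _]] := aa e e0; exists b.
apply: vec_eq_approx => e e0 l; rewrite mxE.
have c0 : 0 < 1 + smod (u l 0) by rewrite ltr_pwDl ?smod_ge0.
have [b [_ ba bv]] := aa (e / (1 + smod (u l 0))) (divr_gt0 e0 c0).
have -> : a * u l 0 - v l 0 = (a - b) * u l 0 + (b * u l 0 - v l 0).
  by rewrite mulrBl addrA subrK.
apply: (le_trans (smodD _ _)); rewrite smodM -smodN opprB.
apply: (@le_trans _ _ (e / (1 + smod (u l 0)) * smod (u l 0) + e / (1 + smod (u l 0)))).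
  by rewrite lerD// ler_wpM2r ?smod_ge0.
by rewrite -[X in _ + X]mulr1 -mulrDr [_ + 1]addrC divfK// gt_eqF.
Qed.

Lemma calK_segK u : calK (segK u).
Proof.
split.
- by exists u; exact: segK_self.
- exact: closed_segK.
- move=> _ _ t [a /= a1 <-] [b /= b1 <-] /andP[t0 t1].
  exists (t * a + (1 - t) * b); last by rewrite scalerDl !scalerA.
  rewrite /= (le_trans (ler_normD _ _))// !normrM (ger0_norm t0).
  rewrite [`|1 - t|]ger0_norm ?subr_ge0//.
  apply: (@le_trans _ _ (t * 1 + (1 - t) * 1)); last by rewrite !mulr1 addrC subrK.
  by apply: lerD; apply: ler_wpM2l => //; rewrite subr_ge0.
- move=> _ a [b /= b1 <-] a1; exists (a * b); last by rewrite scalerA.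
  by rewrite /= normrM a1 mul1r.
Qed.

Lemma calK_zero : calK [set (0 : V)].
Proof.
split; [by exists 0|exact: closed_zero| |].
- by move=> u v t /= -> -> _; rewrite !scaler0 addr0.
- by move=> u a /= -> _; rewrite scaler0.
Qed.

Lemma half_itv : 0 <= sreal k (2^-1 : R) <= 1.
Proof.
rewrite -(raddf0 (@sreal R k)) -(rmorph1 (@sreal R k)) !ler_sreal.
by rewrite invr_ge0 invf_le1// ler0n ler1n.
Qed.

Lemma calK_midpoint K u v : calK K -> K u -> K v -> K (sreal k 2^-1 *: (u + v)).
Proof.
case=> _ _ convK _ Ku Kv; rewrite scalerDr.
have hE : sreal k 2^-1 = 1 - sreal k (2^-1 : R).
  by rewrite -(rmorph1 (@sreal R k)) -raddfB /=; congr sreal; field.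
rewrite {2}hE; by apply: convK => //; exact: half_itv.
Qed.

Lemma calK_0 K : calK K -> K 0.
Proof.
move=> cK; have [[u Ku] _ _ symK] := cK.
have -> : 0 = sreal k 2^-1 *: (u + (-1) *: u) by rewrite scaleN1r subrr scaler0.
apply: calK_midpoint => //; apply: symK => //.
by rewrite normrN normr1.
Qed.

(** This is what makes the segment map [x |-> segK (f x)] measurable. *)
Lemma open_segK_meets E : open E -> open [set u : V | segK u `&` E !=set0].
Proof.
move=> /open_closeP oE; apply/open_closeP => u [_ [[a /= a1 <-] Eau]].
have [e e0 eE] := oE _ Eau; exists e => // v uv.
exists (a *: v); split; first by exists a.
apply: eE => i; rewrite !mxE -mulrBr smodM.
apply: le_lt_trans (uv i); rewrite ler_piMl ?smod_ge0//.
by rewrite -le_norm1.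
Qed.

Lemma rational_box E v : open E -> E v ->
  exists (q : {ffun 'I_n -> rat * rat}) (m : nat),
    let B := [set u : V | forall i,
      `|sRe (u i 0) - ratr (q i).1| < m.+1%:R^-1 /\
      `|sIm (u i 0) - ratr (q i).2| < m.+1%:R^-1] in B v /\ B `<=` E.
Proof.
move=> /open_closeP oE Ev; have [e e0 eE] := oE v Ev.
have [m me] := invr_nat_lt (divr_gt0 e0 (ltac:(by []) : 0 < 4 :> R)).
have m0 : 0 < m.+1%:R^-1 :> R by rewrite invr_gt0.
have approx (x : R) : exists q : rat, `|x - ratr q| < m.+1%:R^-1.
  have [q] := @rat_in_itvoo R (x - m.+1%:R^-1) x (ltac:(by rewrite ltrBlDr ltrDl)).
  rewrite in_itv /= => /andP[q1 q2]; exists q.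
  by rewrite gtr0_norm ?subr_gt0// ltrBlDl -ltrBlDr.
have [qr qrP] := choice (fun i => approx (sRe (v i 0))).
have [qi qiP] := choice (fun i => approx (sIm (v i 0))).
exists [ffun i => (qr i, qi i)], m; split=> [i|u H].
  by rewrite ffunE; split; [exact: qrP|exact: qiP].
apply: eE => i; apply: (le_lt_trans (smod_le_ReIm _)); rewrite !raddfB /=.
have [ur ui] := H i; rewrite ffunE /= in ur ui.
have dist (x y q : R) : `|x - q| < m.+1%:R^-1 -> `|y - q| < m.+1%:R^-1 -> `|x - y| < e / 2.
  move=> xq yq; have -> : x - y = (x - q) - (y - q) by rewrite opprB addrA subrK.
  apply: (le_lt_trans (ler_normB _ _)).
  have -> : e / 2 = e / 4 + e / 4 by field.
  by apply: ltrD; apply: lt_trans me.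
by rewrite [e]splitr ltrD//; [exact: dist (qrP i)|exact: dist (qiP i)].
Qed.

(** An open set is a countable union of boxes with rational data. *)
Lemma measurable_preimage_open (disp : measure_display) (T : measurableType disp)
    (f : T -> V) E : vmeasurable f -> open E -> measurable (f @^-1` E).
Proof.
move=> mf oE.
pose box (qm : {ffun 'I_n -> rat * rat} * nat) := [set u : V | forall i,
      `|sRe (u i 0) - ratr (qm.1 i).1| < qm.2.+1%:R^-1 /\
      `|sIm (u i 0) - ratr (qm.1 i).2| < qm.2.+1%:R^-1].
have mbox qm : measurable (f @^-1` box qm).
  have mitv (g : T -> R) (c r : R) : measurable_fun setT g ->
      measurable [set x | `|g x - c| < r].
    move=> mg; have -> : [set x | `|g x - c| < r] = g @^-1` `]c - r, c + r[.
      apply/seteqP; split=> x /=; rewrite in_itv /= ltr_distl//.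
    by rewrite -[X in measurable X]setTI; apply: mg => //; exact: measurable_itv.
  rewrite (_ : _ @^-1` _ = \bigcap_(i in [set: 'I_n])
    ([set x | `|sRe (f x i 0) - ratr (qm.1 i).1| < qm.2.+1%:R^-1] `&`
     [set x | `|sIm (f x i 0) - ratr (qm.1 i).2| < qm.2.+1%:R^-1])).
    apply: fin_bigcap_measurable => // i _; apply: measurableI; apply: mitv.
      exact: (mf i).1.
    exact: (mf i).2.
  by apply/seteqP; split=> x H i; [move=> _; exact: H|exact: (H i I)].
rewrite (_ : _ @^-1` _ = \bigcup_j
    (if unpickle j is Some qm then [set x | box qm `<=` E] `&` f @^-1` box qm else set0)).
  apply: bigcupT_measurable => j; case: (unpickle j) => // qm.
  have [H|H] := pselect (box qm `<=` E).
    by rewrite (_ : [set x | _] = setT) ?setTI//; apply/seteqP; split.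
  by rewrite (_ : [set x | _] = set0) ?set0I//; apply/seteqP; split.
apply/seteqP; split=> x /=.
  move=> Ex; have [q [m [H1 H2]]] := rational_box oE Ex.
  by exists (pickle (q, m)) => //; rewrite pickleK.
by case=> j _; case: (unpickle j) => // qm [H /H].
Qed.

End VectorTopology.

(** * The pairing of two function spaces *)

Section Pairing.
Variables (R : realType) (k : scalar_kind) (n : nat).
Variables (disp : measure_display) (T : measurableType disp).
Variable mu : {measure set T -> \bar R}.
Local Notation F := (scalar R k).
Local Notation V := 'cV[F]_n.
Implicit Types f g h : T -> V.

Lemma vmeasurable_coord f i : vmeasurable f -> smeasurable (fun x => f x i 0).
Proof. exact. Qed.

Lemma vmeasurable_if (D : set T) f g : measurable D ->
  vmeasurable f -> vmeasurable g -> vmeasurable (fun x => if x \in D then f x else g x).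
Proof.
move=> mD mf mg i.
rewrite (_ : (fun x => _) = (fun x => if x \in D then f x i 0 else g x i 0)).
  exact: smeasurable_if.
by apply/funext => x; case: ifP.
Qed.

Lemma vmeasurable_dot f g : vmeasurable f -> vmeasurable g ->
  smeasurable (fun x => dot (f x) (g x)).
Proof.
move=> mf mg; apply: smeasurable_sum => i; apply: smeasurableM; first exact: mf.
by apply: smeasurable_sconj; exact: mg.
Qed.

Definition mu_pairing f g : \bar R := (\int[mu]_x (smod (dot (f x) (g x)))%:E)%E.
Local Notation pairing := mu_pairing.

Lemma pairingC f g : pairing f g = pairing g f.
Proof. by apply: eq_integral => x _; rewrite smod_dotC. Qed.

Lemma measurable_pairing f g : vmeasurable f -> vmeasurable g ->
  measurable_fun setT (fun x => (smod (dot (f x) (g x)))%:E).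
Proof.
move=> mf mg; apply/measurable_EFinP.
exact: (measurable_smod (vmeasurable_dot mf mg)).
Qed.

Lemma pairing_ge0 f g : (0 <= pairing f g)%E.
Proof. by apply: integral_ge0 => x _; rewrite lee_fin smod_ge0. Qed.

Lemma pairing_ae_le f g f' g' : vmeasurable f -> vmeasurable g ->
  vmeasurable f' -> vmeasurable g' ->
  {ae mu, forall x, smod (dot (f x) (g x)) <= smod (dot (f' x) (g' x))} ->
  (pairing f g <= pairing f' g')%E.
Proof.
move=> mf mg mf' mg' H; apply: ae_ge0_le_integral => //.
- by move=> x _; rewrite lee_fin smod_ge0.
- exact: measurable_pairing.
- by move=> x _; rewrite lee_fin smod_ge0.
- exact: measurable_pairing.
- by apply: filterS H => x H _; rewrite lee_fin.
Qed.

Lemma pairingDr f g h : vmeasurable f -> vmeasurable g -> vmeasurable h ->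
  (pairing f (fun x => (g x + h x)%R) <= pairing f g + pairing f h)%E.
Proof.
move=> mf mg mh; rewrite /pairing -ge0_integralD//.
- apply: ge0_le_integral => //.
  + by move=> x _; rewrite lee_fin smod_ge0.
  + by apply: measurable_pairing => //; exact: vmeasurableD.
  + by apply: emeasurable_funD; exact: measurable_pairing.
  + by move=> x _; rewrite -EFinD lee_fin dotDr smodD.
- by move=> x _; rewrite lee_fin smod_ge0.
- exact: measurable_pairing.
- by move=> x _; rewrite lee_fin smod_ge0.
- exact: measurable_pairing.
Qed.

Lemma pairingZl (a : F) f g : vmeasurable f -> vmeasurable g ->
  pairing (fun x => a *: f x) g = ((smod a)%:E * pairing f g)%E.
Proof.
move=> mf mg; rewrite /pairing -ge0_integralZl_EFin//.
- by apply: eq_integral => x _; rewrite dotZl smodM EFinM.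
- by move=> x _; rewrite lee_fin smod_ge0.
- exact: measurable_pairing.
- exact: smod_ge0.
Qed.

Lemma pairingZr (a : F) f g : vmeasurable f -> vmeasurable g ->
  pairing f (fun x => a *: g x) = ((smod a)%:E * pairing f g)%E.
Proof. by move=> mf mg; rewrite pairingC pairingZl// pairingC. Qed.

Lemma pairing0_ae f g : vmeasurable f -> vmeasurable g -> (pairing f g <= 0)%E ->
  mu_sintegrable mu setT (fun x => dot (f x) (g x)) /\
  mu_sintegral mu setT (fun x => dot (f x) (g x)) = 0.
Proof.
move=> mf mg fg0; have ms := vmeasurable_dot mf mg.
have i1 : mu_sintegrable mu setT (fun x => dot (f x) (g x)).
  by apply/sintegrableP => //; apply: le_lt_trans fg0 _; rewrite ltry.
split=> //; apply/eqP; rewrite -smod_eq0 eq_le smod_ge0 andbT -lee_fin.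
by apply: le_trans fg0; exact: smod_sintegral_le.
Qed.

Lemma pairing_ae0 f g : vmeasurable g -> {ae mu, forall x, f x = 0} ->
  vmeasurable f -> (pairing f g <= 0)%E.
Proof.
move=> mg f0 mf; rewrite -[leRHS](integral0 mu setT).
apply: ae_ge0_le_integral => //.
- by move=> x _; rewrite lee_fin smod_ge0.
- exact: measurable_pairing.
- by apply: filterS f0 => x -> _; rewrite dot0l smod0.
Qed.

Lemma sintegral_indicator (D G : set T) (c : F) : measurable D -> measurable G ->
  (mu D < +oo)%E ->
  mu_sintegral mu D (fun x => if x \in G then c else 0)
    = c * sreal k (fine (mu (G `&` D))).
Proof.
move=> mD mG Doo.
rewrite (_ : (fun x => _) = (fun x => c * sreal k (\1_G x))); last first.
  by apply/funext => x; rewrite indicE; case: (x \in G);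
    rewrite ?rmorph1 ?raddf0 ?mulr1 ?mulr0.
have iG : mu.-integrable D (EFin \o (\1_G : T -> R)).
  apply: ge0_integrable => //; rewrite integral_indic//.
  apply: le_lt_trans Doo; apply: le_measure; rewrite ?inE//.
  exact: measurableI.
rewrite sintegralZ//.
  by rewrite sintegral_sreal /Rintegral integral_indic.
split; first by under eq_fun do rewrite sRe_sreal.
by under eq_fun do rewrite sIm_sreal; exact: integrable0.
Qed.

Lemma pairing_restrict (D : set T) f v : measurable D ->
  pairing f (fun x => if x \in D then v else 0)
    = (\int[mu]_(x in D) (smod (dot (f x) v))%:E)%E.
Proof.
move=> mD; rewrite [RHS]integral_mkcond; apply: eq_integral => x _.
by rewrite patchE; case: ifP => // _; rewrite dot0r smod0.
Qed.

End Pairing.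

(** * Selections of set-valued maps *)

Section Selections.
Variables (R : realType) (k : scalar_kind) (n : nat).
Variables (disp : measure_display) (T : measurableType disp).
Variable mu : {measure set T -> \bar R}.
Local Notation F := (scalar R k).
Local Notation V := 'cV[F]_n.
Implicit Types (f g : T -> V) (S : T -> set V) (D : set T).

(** For Lebesgue measure and a cube this unfolds to [S0 (truncK D S)]. *)
Definition selection S D : set (T -> V) :=
  [set f | vmeasurable f /\
     {ae mu, forall x, (if x \in D then S x else [set 0]) (f x)}].

Lemma calK_trunc S D x : (forall x, calK (S x)) -> calK (if x \in D then S x else [set 0]).
Proof. by move=> cS; case: ifP => // _; exact: calK_zero. Qed.

Lemma vmeasurable_cst (u : V) : vmeasurable (fun _ : T => u).
Proof. by move=> i; exact: smeasurable_cst. Qed.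

Lemma selection_zero S D : (forall x, calK (S x)) -> selection S D (fun=> 0).
Proof.
move=> cS; split; first exact: vmeasurable_cst.
by apply: aeW => x; apply: calK_0; exact: calK_trunc.
Qed.

Lemma selection_convex S D f g (t : F) : (forall x, calK (S x)) -> 0 <= t <= 1 ->
  selection S D f -> selection S D g ->
  selection S D (fun x => t *: f x + (1 - t) *: g x).
Proof.
move=> cS t01 [mf fS] [mg gS]; split.
  by apply: vmeasurableD; apply: vmeasurableZ => //; exact: smeasurable_cst.
apply: filterS2 fS gS => x fx gx; have [_ _ convK _] := calK_trunc D x cS.
exact: convK.
Qed.

Lemma selection_unimodular S D f (a : F) : (forall x, calK (S x)) -> `|a| = 1 ->
  selection S D f -> selection S D (fun x => a *: f x).
Proof.
move=> cS a1 [mf fS]; split.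
  by apply: vmeasurableZ => //; exact: smeasurable_cst.
apply: filterS fS => x fx; have [_ _ _ symK] := calK_trunc D x cS.
exact: symK.
Qed.

Lemma selection_integrals_closed S D (M : R) (w : V) : measurable D ->
  (forall x, calK (S x)) ->
  (forall f, selection S D f -> (\int[mu]_(x in D) (vnorm (f x))%:E <= M%:E)%E) ->
  (forall e : R, 0 < e -> exists2 f, selection S D f &
     forall i, smod (mu_sintegral mu D (fun x => f x i 0) - w i 0) <= e) ->
  exists2 f, selection S D f & forall i, mu_sintegral mu D (fun x => f x i 0) = w i 0.
Proof.
move=> mD cS SM Sw.
apply: (@aumann_integral_closed R k n disp T mu D mD (selection S D) _ _ _ M SM _ w Sw).
- by move=> f [].
- move=> f g [mf fS] [mg gS]; split.
    apply: vmeasurableZ; first exact: smeasurable_cst.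
    exact: vmeasurableD.
  apply: filterS2 fS gS => x fx gx; apply: calK_midpoint => //.
  exact: calK_trunc.
- move=> f g b mb [mf fS] [mg gS]; split.
    move=> i; rewrite (_ : (fun x => _) = (fun x => if b x then f x i 0 else g x i 0)).
      by apply: smeasurable_ifT.
    by apply/funext => x; case: ifP.
  by apply: filterS2 fS gS => x fx gx; case: (b x).
- move=> s f Ss mf f0 sf; split=> //.
  have Sall : {ae mu, forall x, forall j, (if x \in D then S x else [set 0]) (s j x)}.
    by apply: ae_foralln => j; exact: (Ss j).2.
  apply: filterS2 Sall sf => x Sx cvx; case: ifPn => xD; last first.
    by apply: f0 => Dx; move/negP: xD; apply; exact: mem_set.
  have Dx : D x by exact: set_mem.
  have [_ clS _ _] := cS x.
  apply: (closed_limit clS (s := fun j => s j x)) => [j|i]; last exact: cvx.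
  by have := Sx j; rewrite xD.
Qed.

Lemma int_vnorm_le_pairings D f : measurable D -> vmeasurable f ->
  {ae mu, forall x, ~ D x -> f x = 0} ->
  (\int[mu]_x (vnorm (f x))%:E <=
   \sum_i mu_pairing mu f (fun x => if x \in D then basis_vec R k i else 0%R))%E.
Proof.
move=> mD mf f0.
have me i : vmeasurable (fun x => if x \in D then basis_vec R k i else (0 : V)).
  by apply: vmeasurable_if => //; exact: vmeasurable_cst.
have mp i := measurable_pairing mf (me i).
rewrite /mu_pairing -ge0_integral_sum//; last first.
  by move=> i x _; rewrite lee_fin smod_ge0.
apply: ae_ge0_le_integral => //.
- by move=> x _; rewrite lee_fin vnorm_ge0.
- by apply/measurable_EFinP; exact: measurable_vnorm.
- by move=> x _; apply: sume_ge0 => i _; rewrite lee_fin smod_ge0.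
- by apply: emeasurable_sum => i; exact: mp.
- apply: filterS f0 => x f0 _; rewrite sumEFin lee_fin.
  have [Dx|nDx] := pselect (D x); last first.
    by rewrite f0// vnorm0 sumr_ge0// => i _; exact: smod_ge0.
  rewrite mem_set//; apply: (le_trans (vnorm_le_sum _)).
  by apply: ler_sum => i _; rewrite dot_basis.
Qed.

Lemma int_vnorm_restrict D f : measurable D -> vmeasurable f ->
  (\int[mu]_(x in D) (vnorm (f x))%:E <= \int[mu]_x (vnorm (f x))%:E)%E.
Proof.
move=> mD mf; apply: ge0_subset_integral => //.
  by apply/measurable_EFinP; exact: measurable_vnorm.
by move=> x _; rewrite lee_fin vnorm_ge0.
Qed.

Lemma coord_integrable D f g (M : R) i : measurable D -> vmeasurable f ->
  vmeasurable g -> (forall x, D x -> g x = f x) ->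
  (\int[mu]_x (vnorm (g x))%:E <= M%:E)%E -> mu_sintegrable mu D (fun x => f x i 0).
Proof.
move=> mD mf mg gf gM; have mfi := vmeasurable_coord i mf.
apply/(sintegrableP _ mD mfi); apply: le_lt_trans (ltry M).
apply: le_trans gM; apply: le_trans (int_vnorm_restrict mD mg).
apply: ge0_le_integral => //.
- by move=> x _; rewrite lee_fin smod_ge0.
- by apply/measurable_EFinP/measurable_funTS; exact: measurable_smod.
- by apply/measurable_EFinP/measurable_funTS; exact: measurable_vnorm.
- by move=> x Dx; rewrite lee_fin gf// smod_coord_le.
Qed.

Lemma vmeasurable_mulmx (A : 'M[F]_n) f :
  vmeasurable f -> vmeasurable (fun x => A *m f x).
Proof.
move=> mf j; rewrite (_ : (fun x => _) = fun x => \sum_l A j l * f x l 0).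
  apply: smeasurable_sum => l; apply: smeasurableM; last exact: mf.
  exact: smeasurable_cst.
by apply/funext => x; rewrite mxE.
Qed.

End Selections.

(** * Averages over cubes and dual pairs *)

Section Averages.
Variables (R : realType) (k : scalar_kind) (n d : nat).
Local Notation F := (scalar R k).
Local Notation V := 'cV[F]_n.
Local Notation Rd := (Rd R d).
Local Notation mu := (@leb R d).
Implicit Types (u v : V) (f g : Rd -> V) (Q : cube R d).

Definition opposite_corner Q : d.-tuple R := [tuple tnth (corner Q) i + side Q | i < d].

Lemma cube_box Q : cube_set Q = box (corner Q) (opposite_corner Q).
Proof.
apply/seteqP; split=> x H i; have := H i; by rewrite /= tnth_mktuple.
Qed.

Lemma measurable_cube Q : measurable (Q : set Rd).
Proof.
rewrite cube_box; apply: sub_caratheodory; apply: sub_sigma_algebra.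
exact: measurable_box.
Qed.

Lemma leb_cube Q : leb (Q : set Rd) = (side Q ^+ d)%:E.
Proof.
rewrite cube_box leb_box => [|i]; last by rewrite tnth_mktuple lerDl ltW// side_gt0.
rewrite (eq_bigr (fun=> side Q)) => [|i _]; last by rewrite tnth_mktuple addrC addKr.
by rewrite prodr_const card_ord.
Qed.

Lemma vol_gt0 Q : 0 < vol Q.
Proof. by rewrite /vol leb_cube /= exprn_gt0// side_gt0. Qed.

Lemma leb_cube_vol Q : leb (Q : set Rd) = (vol Q)%:E.
Proof. by rewrite /vol leb_cube. Qed.

Lemma avg_coord Q f i :
  avg Q f i 0 = sreal k (vol Q)^-1 * mu_sintegral mu Q (fun x => f x i 0).
Proof. by rewrite mxE. Qed.

Lemma vintegrableZ Q (a : F) f : vintegrable Q f -> vintegrable Q (fun x => a *: f x).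
Proof.
move=> vf i; have := sintegrableZ a (measurable_cube Q) (vf i).
have -> // : (fun x => (a *: f x) i 0) = (fun x => a * f x i 0).
by apply/funext => x; rewrite mxE.
Qed.

Lemma avgD Q f g : vintegrable Q f -> vintegrable Q g ->
  avg Q (fun x => f x + g x) = avg Q f + avg Q g.
Proof.
move=> vf vg; apply/matrixP => i j; rewrite ord1 [RHS]mxE !avg_coord -mulrDr.
have fE : (fun x => (f x + g x) i 0) = (fun x => f x i 0 + g x i 0).
  by apply/funext => x; rewrite mxE.
by rewrite fE (sintegralD (measurable_cube Q) (vf i) (vg i)).
Qed.

Lemma avgZ Q (a : F) f : vintegrable Q f ->
  avg Q (fun x => a *: f x) = a *: avg Q f.
Proof.
move=> vf; apply/matrixP => i j; rewrite ord1 [RHS]mxE !avg_coord mulrCA.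
have fE : (fun x => (a *: f x) i 0) = (fun x => a * f x i 0).
  by apply/funext => x; rewrite mxE.
by rewrite fE (sintegralZ a (measurable_cube Q) (vf i)).
Qed.

Lemma dot_integrable Q f v : vintegrable Q f ->
  mu_sintegrable mu Q (fun x => dot (f x) v) /\
  sreal k (vol Q) * dot (avg Q f) v = mu_sintegral mu Q (fun x => dot (f x) v).
Proof.
move=> vf; have mQ := measurable_cube Q.
have vfi i : mu_sintegrable mu Q (fun x => sconj (v i 0) * f x i 0).
  by apply: sintegrableZ => //; exact: vf.
have [i1 i2] := sintegral_sum (index_enum 'I_n) mQ vfi.
have dE : (fun x => dot (f x) v) = (fun x => \sum_i sconj (v i 0) * f x i 0).
  by apply/funext => x; apply: eq_bigr => i _; rewrite mulrC.
rewrite dE; split=> //; rewrite i2 /dot mulr_sumr; apply: eq_bigr => i _.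
rewrite avg_coord sintegralZ//; last exact: vf.
rewrite mulrA mulrA -rmorphM /= divff ?rmorph1 ?mul1r 1?mulrC//.
by rewrite gt_eqF// vol_gt0.
Qed.

Lemma rd_measurableD f g : vmeasurable f -> vmeasurable g -> vmeasurable (fun x => f x + g x).
Proof. exact: vmeasurableD. Qed.

Lemma rd_measurableZ (a : Rd -> F) f : smeasurable a -> vmeasurable f -> vmeasurable (fun x => a x *: f x).
Proof. exact: vmeasurableZ. Qed.

Lemma rd_measurable_cst u : vmeasurable (fun _ : Rd => u).
Proof. move=> i; exact: (@smeasurable_cst R k _ Rd (u i 0)). Qed.

Lemma rd_measurable_if (D : set Rd) f g : measurable D -> vmeasurable f -> vmeasurable g ->
  vmeasurable (fun x => if x \in D then f x else g x).
Proof. exact: vmeasurable_if. Qed.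

Lemma rd_measurable_ind (D : set Rd) u : measurable D -> vmeasurable (ind D u).
Proof. by move=> mD; apply: rd_measurable_if => //; exact: rd_measurable_cst. Qed.

(** The lattice-like structure that a directional Banach function space shares with
    its Koethe dual. *)
Record ideal_space (X : fspace R k n d) : Prop := IdealSpace {
  is_meas : forall f, X f -> vmeasurable f ;
  is_zero : X (fun=> 0) ;
  is_add : forall f g, X f -> X g -> X (fun x => f x + g x) ;
  is_scale : forall (a : F) f, X f -> X (fun x => a *: f x) ;
  is_ge0 : forall f, X f -> 0 <= fnorm X f ;
  is_eq0 : forall f, X f -> fnorm X f = 0 -> {ae mu, forall x, f x = 0} ;
  is_normD : forall f g, X f -> X g ->
    fnorm X (fun x => f x + g x) <= fnorm X f + fnorm X g ;
  is_normZ : forall (a : F) f, X f -> fnorm X (fun x => a *: f x) = smod a * fnorm X f ;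
  is_ideal : forall f g, X f -> vmeasurable g ->
    {ae mu, forall x, segK (g x) `<=` segK (f x)} -> X g /\ fnorm X g <= fnorm X f }.

Local Notation pairing := (mu_pairing mu).

(** Each space is the Koethe dual of the other. The relation is symmetric, so that
    a statement about [X] and its dual yields the one with the roles exchanged. *)
Record dual_pair (X Y : fspace R k n d) : Prop := DualPair {
  dp_left : ideal_space X ;
  dp_right : ideal_space Y ;
  dp_holder : forall f g, X f -> Y g -> (pairing f g <= (fnorm X f * fnorm Y g)%:E)%E ;
  dp_dual_right : forall g (C : R), vmeasurable g -> 0 <= C ->
    (forall f, X f -> (pairing f g <= (C * fnorm X f)%:E)%E) -> Y g /\ fnorm Y g <= C ;
  dp_dual_left : forall f (C : R), vmeasurable f -> 0 <= C ->
    (forall g, Y g -> (pairing f g <= (C * fnorm Y g)%:E)%E) -> X f /\ fnorm X f <= C }.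

Lemma dual_pair_sym X Y : dual_pair X Y -> dual_pair Y X.
Proof.
case=> iX iY H DR DL; split=> //.
- by move=> f g Yf Xg; rewrite pairingC mulrC; exact: H.
- by move=> g C mg C0 Hg; apply: DL => // f Yf; rewrite pairingC; exact: Hg.
- by move=> g C mg C0 Hg; apply: DR => // f Yf; rewrite pairingC; exact: Hg.
Qed.

Lemma avg_ind Q (G : set Rd) u : measurable G -> G `<=` (Q : set Rd) ->
  avg Q (ind G u) = sreal k (fine (leb G) / vol Q) *: u.
Proof.
move=> mG GQ; apply/matrixP => i j; rewrite ord1 avg_coord [RHS]mxE.
have -> : (fun x => ind G u x i 0) = (fun x => if x \in G then u i 0 else 0).
  by apply/funext => x; rewrite /ind; case: ifP => // _; rewrite mxE.
have Qoo : (mu (Q : set Rd) < +oo)%E by rewrite [mu _]leb_cube_vol ltry.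
rewrite (sintegral_indicator (u i 0) (measurable_cube Q) mG Qoo) (setIidl GQ).
by rewrite rmorphM /= [LHS]mulrCA [LHS]mulrC [sreal k _ * _ in LHS]mulrC.
Qed.

End Averages.

(** * The Koethe dual *)

Section IdealSpaces.
Variables (R : realType) (k : scalar_kind) (n d : nat).
Local Notation F := (scalar R k).
Local Notation V := 'cV[F]_n.
Local Notation Rd := (Rd R d).
Local Notation mu := (@leb R d).
Local Notation pairing := (mu_pairing mu).
Opaque vmeasurable smeasurable mu_pairing.
Implicit Types (u v : V) (f g : Rd -> V) (Q : cube R d) (X Y : fspace R k n d).

Lemma leb_aeW (P : Rd -> Prop) : (forall x, P x) -> {ae mu, forall x, P x}.
Proof. by move=> HP; near=> x; exact: HP. Unshelve. all: end_near. Qed.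

Lemma dbfs_ideal_space X : directional_bfs X -> ideal_space X.
Proof. by case=> *; split. Qed.

Lemma ideal_ae X f g : ideal_space X -> X f -> vmeasurable g ->
  {ae mu, forall x, g x = f x} -> X g /\ fnorm X g <= fnorm X f.
Proof.
move=> iX Xf mg gf; apply: is_ideal => //.
by apply: filterS gf => x ->.
Qed.

Lemma ideal_multiplier X (a : Rd -> F) f : ideal_space X -> X f ->
  smeasurable a -> (forall x, smod (a x) <= 1) ->
  X (fun x => a x *: f x) /\ fnorm X (fun x => a x *: f x) <= fnorm X f.
Proof.
move=> iX Xf ma a1; apply: is_ideal => //.
  exact: rd_measurableZ ma (is_meas iX Xf).
by apply: leb_aeW => x; exact: segK_sub.
Qed.

Lemma ideal_sum X (I : Type) (r : seq I) (f : I -> Rd -> V) : ideal_space X ->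
  (forall i, X (f i)) -> X (fun x => \sum_(i <- r) f i x) /\
  fnorm X (fun x => \sum_(i <- r) f i x) <= \sum_(i <- r) fnorm X (f i).
Proof.
move=> iX Xf; elim: r => [|i r [IH1 IH2]].
  have -> : (fun x => \sum_(i <- [::]) f i x) = (fun=> 0) :> (Rd -> V).
    by apply/funext => x; rewrite big_nil.
  split; first exact: is_zero.
  rewrite big_nil; have := is_normZ iX 0 (is_zero iX).
  rewrite smod0 mul0r; have -> // : (fun x : Rd => 0 *: 0) = (fun=> 0 : V).
    by apply/funext => x; rewrite scaler0.
  by move=> ->.
have -> : (fun x => \sum_(i <- i :: r) f i x) = (fun x => f i x + \sum_(i <- r) f i x).
  by apply/funext => x; rewrite big_cons.
split; first exact: is_add.
rewrite big_cons; apply: (le_trans (is_normD iX (Xf i) IH1)).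
by rewrite lerD2l.
Qed.

Lemma indD (D : set Rd) u v : ind D (u + v) = (fun x => ind D u x + ind D v x).
Proof. by apply/funext => x; rewrite /ind; case: ifP; rewrite ?addr0. Qed.

Lemma indZ (D : set Rd) (a : F) u : ind D (a *: u) = (fun x => a *: ind D u x).
Proof. by apply/funext => x; rewrite /ind; case: ifP; rewrite ?scaler0. Qed.

Lemma ind_coords (D : set Rd) u :
  ind D u = (fun x => \sum_i ind D (u i 0 *: basis_vec R k i) x).
Proof.
apply/funext => x; rewrite /ind; case: ifP => _; last by rewrite big1.
apply/matrixP => i j; rewrite ord1 summxE (bigD1 i)//= big1 ?addr0.
  by rewrite !mxE !eqxx /= mulr1.
by move=> l li; rewrite !mxE eq_sym (negbTE li) mulr0.
Qed.

Lemma contains_indicators_basis X : ideal_space X ->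
  (forall Q i, X (ind Q (basis_vec R k i))) -> contains_indicators X.
Proof.
move=> iX Xe Q u; rewrite ind_coords; apply: (ideal_sum _ iX _).1 => i.
by rewrite indZ; apply: is_scale.
Qed.

Lemma ind_seminorm X Q : ideal_space X -> contains_indicators X ->
  seminorm (fun u => fnorm X (ind Q u)).
Proof.
move=> iX cX; split=> [u v|a u]; first by rewrite indD; apply: is_normD.
by rewrite indZ; apply: is_normZ.
Qed.

Lemma ind_norm_eq0 X Q u : ideal_space X -> contains_indicators X ->
  fnorm X (ind Q u) = 0 -> u = 0.
Proof.
move=> iX cX /(is_eq0 iX (cX Q u)) [N [mN N0 sub]].
apply: contrapT => u0.
have QN : (Q : set Rd) `<=` N.
  move=> x Qx; apply: sub => /=; rewrite /ind mem_set//.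
have : (leb (Q : set Rd) <= leb N)%E.
  by apply: le_measure => //; rewrite inE//; exact: measurable_cube.
by rewrite [X in (_ <= X)%E]N0 leb_cube_vol lee_fin leNgt vol_gt0.
Qed.

(** On the functions [1_Q u] the norm is a norm of [u], since cubes have positive
    measure; it is therefore equivalent to the Euclidean one. *)
Lemma ind_norm_ge X Q : ideal_space X -> contains_indicators X ->
  exists2 c : R, 0 < c & forall u, vnorm u <= c * fnorm X (ind Q u).
Proof.
move=> iX cX; apply: norm_ge_vnorm; first exact: ind_seminorm.
by move=> u; exact: ind_norm_eq0.
Qed.

Lemma kothe_le X g (C : R) : vmeasurable g -> 0 <= C ->
  (forall f, X f -> (pairing f g <= (C * fnorm X f)%:E)%E) ->
  kothe X g /\ fnorm (kothe X) g <= C.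
Proof.
move=> mg C0 HC.
have kC : (kothe_norm X g <= C%:E)%E.
  by apply: ge_ereal_sup => _ [f [Xf f1] <-]; have := HC f Xf; rewrite f1 mulr1.
split; first by split=> //; apply: le_lt_trans kC _; rewrite ltry.
rewrite /=; move: kC; case: (kothe_norm X g) => [r| |] //=.
Qed.

Lemma kothe_ge0 X g : 0 <= fnorm (kothe X) g.
Proof.
rewrite /= /kothe_norm; set U := [set f | _].
have [->|/set0P[f [Xf f1]]] := eqVneq U set0.
  by rewrite image_set0 ereal_sup0.
apply: fine_ge0; apply: le_trans (pairing_ge0 mu f g) _.
apply: ereal_sup_ubound; by exists f.
Qed.

(** When [f] has norm 0 it vanishes almost everywhere, and so does the pairing;
    otherwise [f] can be normalised. *)
Lemma kothe_holder X f g : ideal_space X -> X f -> kothe X g ->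
  (pairing f g <= (fnorm X f * fnorm (kothe X) g)%:E)%E.
Proof.
move=> iX Xf [mg goo]; have mf := is_meas iX Xf.
have [f0|f0] := eqVneq (fnorm X f) 0.
  rewrite f0 mul0r; apply: pairing_ae0 => //; exact: is_eq0 iX _ Xf f0.
have fp : 0 < fnorm X f by rewrite lt_def f0 is_ge0.
pose f1 := fun x => sreal k (fnorm X f)^-1 *: f x.
have Xf1 : X f1 by apply: is_scale.
have nf1 : fnorm X f1 = 1.
  by rewrite is_normZ// smod_sreal gtr0_norm ?invr_gt0// mulVf.
have fE : f = (fun x => sreal k (fnorm X f) *: f1 x).
  by apply/funext => x; rewrite /f1 scalerA -rmorphM /= divff// rmorph1 scale1r.
have k1 : (pairing f1 g <= kothe_norm X g)%E.
  by apply: ereal_sup_ubound; exists f1.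
rewrite {1}fE pairingZl//; last exact: is_meas iX _ Xf1.
rewrite smod_sreal gtr0_norm// EFinM.
apply: lee_wpmul2l; first by rewrite lee_fin ltW.
rewrite /= fineK// ge0_fin_numE//.
by apply: le_trans k1; exact: pairing_ge0.
Qed.

(** Definiteness of the norm of the dual is the non-degeneracy of [X]; the other
    properties follow from those of the pairing. *)
Lemma kothe_ideal_space X : directional_bfs X -> ideal_space (kothe X).
Proof.
move=> bX; have iX := dbfs_ideal_space bX.
have H := kothe_holder iX.
have Y0 g : kothe X g -> vmeasurable g by case.
have Yscale (a : F) g : kothe X g ->
    kothe X (fun x => a *: g x) /\
    fnorm (kothe X) (fun x => a *: g x) <= smod a * fnorm (kothe X) g.
  move=> Yg; apply: kothe_le.
  - by apply: rd_measurableZ; [exact: smeasurable_cst|exact: Y0].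
  - by rewrite mulr_ge0 ?smod_ge0 ?kothe_ge0.
  - move=> f Xf; rewrite pairingZr; [|exact: is_meas iX _ Xf|exact: Y0].
    rewrite -mulrA EFinM lee_wpmul2l ?lee_fin ?smod_ge0// mulrC.
    exact: H.
split.
- exact: Y0.
- apply: (@kothe_le X _ 0 _ _ _).1 => // [|f Xf]; first exact: rd_measurable_cst.
  rewrite mul0r pairingC; apply: pairing_ae0; [exact: is_meas iX _ Xf| |exact: rd_measurable_cst].
  exact: leb_aeW.
- move=> f g Yf Yg; apply: (@kothe_le X _ (fnorm (kothe X) f + fnorm (kothe X) g) _ _ _).1.
  + by apply: rd_measurableD; exact: Y0.
  + by rewrite addr_ge0 ?kothe_ge0.
  + move=> h Xh; apply: (le_trans (pairingDr _ _ _ _)); [exact: is_meas iX _ Xh|exact: Y0|exact: Y0|].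
    by rewrite mulrDl EFinD leeD// mulrC; exact: H.
- by move=> a f Yf; exact: (Yscale a f Yf).1.
- by move=> f _; exact: kothe_ge0.
- move=> g Yg g0; apply: (dbfs_nondegenerate bX); first exact: Y0.
  move=> f Xf; apply: pairing0_ae; [exact: is_meas iX _ Xf|exact: Y0|].
  by have := H f g Xf Yg; rewrite g0 mulr0.
- move=> f g Yf Yg; apply: (kothe_le _ _ _).2.
  + by apply: rd_measurableD; exact: Y0.
  + by rewrite addr_ge0 ?kothe_ge0.
  + move=> h Xh; apply: (le_trans (pairingDr _ _ _ _)); [exact: is_meas iX _ Xh|exact: Y0|exact: Y0|].
    by rewrite mulrDl EFinD leeD// mulrC; exact: H.
- move=> a f Yf; apply/eqP; rewrite eq_le (Yscale a f Yf).2 /=.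
  have [->|a0] := eqVneq a 0; first by rewrite smod0 mul0r kothe_ge0.
  have [Yaf _] := Yscale a f Yf.
  have := (Yscale a^-1 _ Yaf).2.
  have -> : (fun x => a^-1 *: (a *: f x)) = f.
    by apply/funext => x; rewrite scalerA mulVf// scale1r.
  by rewrite smodV ler_pdivlMl// lt_def smod_ge0 smod_eq0 a0.
- move=> f g Yf mg gf; apply: kothe_le => //; first exact: kothe_ge0.
  move=> h Xh; have mh := is_meas iX Xh.
  rewrite mulrC; apply: (le_trans _ (H h f Xh Yf)).
  apply: pairing_ae_le => //; first exact: Y0.
  apply: filterS gf => x /segKP[a a1 ->].
  by rewrite dotZr smodM smod_sconj ler_piMl ?smod_ge0.
Qed.

Lemma kothe_dual_pair X : directional_bfs X -> kothe_reflexive X ->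
  dual_pair X (kothe X).
Proof.
move=> bX [rX rn]; have iX := dbfs_ideal_space bX.
have iY := kothe_ideal_space bX.
split=> //.
- by move=> f g Xf Yg; exact: kothe_holder.
- by move=> g C mg C0 HC; exact: kothe_le.
- move=> f C mf C0 HC.
  have [Zf Zn] : kothe (kothe X) f /\ fnorm (kothe (kothe X)) f <= C.
    by apply: kothe_le => // g Yg; rewrite pairingC; exact: HC.
  have Xf : X f by rewrite -rX.
  by rewrite -rn.
Qed.

End IdealSpaces.

(** * Bounds for the averaging operators *)

Section AveragingOperators.
Variables (R : realType) (k : scalar_kind) (n d : nat).
Local Notation F := (scalar R k).
Local Notation V := 'cV[F]_n.
Local Notation Rd := (Rd R d).
Local Notation mu := (@leb R d).
Local Notation pairing := (mu_pairing mu).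
Implicit Types (u v : V) (f g : Rd -> V) (Q : cube R d) (X Y : fspace R k n d).

Lemma pairing_ind f Q v :
  pairing f (ind Q v) = (\int[mu]_(x in Q) (smod (dot (f x) v))%:E)%E.
Proof. exact: pairing_restrict (measurable_cube Q). Qed.

Lemma measurable_ind Q u : vmeasurable (ind Q u : Rd -> V).
Proof. exact: rd_measurable_ind (measurable_cube Q). Qed.

Lemma pair_vintegrable X Y f Q : dual_pair X Y -> contains_indicators Y -> X f ->
  vintegrable Q f.
Proof.
move=> XY cY Xf i; have mf := is_meas (dp_left XY) Xf.
have mQ := measurable_cube Q.
suff : mu_sintegrable mu Q (fun x => f x i 0) by [].
apply: (sintegrableP _ mQ (vmeasurable_coord i mf)).2.
have -> : (\int[mu]_(x in Q) (smod (f x i 0))%:E)%E = pairing f (ind Q (basis_vec R k i)).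
  by rewrite pairing_ind; apply: eq_integral => x _; rewrite dot_basis.
by apply: le_lt_trans (dp_holder XY Xf (cY Q _)) _; rewrite ltry.
Qed.

(** The left side is the modulus of the integral of [dot f v] over [Q], so this is
    Hoelder's inequality against [1_Q v]. *)
Lemma dot_avg_le X Y f Q v : dual_pair X Y -> contains_indicators Y -> X f ->
  vol Q * smod (dot (avg Q f) v) <= fnorm X f * fnorm Y (ind Q v).
Proof.
move=> XY cY Xf; have vf := pair_vintegrable Q XY cY Xf.
have [idot Idot] := dot_integrable v vf.
have -> : vol Q * smod (dot (avg Q f) v) = smod (sreal k (vol Q) * dot (avg Q f) v).
  by rewrite smodM smod_sreal gtr0_norm// vol_gt0.
rewrite Idot -lee_fin; apply: le_trans (dp_holder XY Xf (cY Q v)).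
rewrite pairing_ind.
have md := vmeasurable_dot (is_meas (dp_left XY) Xf) (rd_measurable_cst d v).
exact: smod_sintegral_le (measurable_cube Q) md idot.
Qed.

(** Conversely the norm of [1_Q v] in the dual is determined by averages: after
    multiplication by a unimodular function the integrand is non-negative. *)
Lemma ind_dual_norm_le X Y Q v (C : R) : dual_pair X Y -> 0 <= C ->
  (forall f, X f -> vintegrable Q f) ->
  (forall f, X f -> vol Q * smod (dot (avg Q f) v) <= C * fnorm X f) ->
  Y (ind Q v) /\ fnorm Y (ind Q v) <= C.
Proof.
move=> XY C0 vX HC; apply: (dp_dual_right XY (measurable_ind Q v) C0).
move=> f Xf; have mf := is_meas (dp_left XY) Xf.
have md : smeasurable (fun x => dot (f x) v).
  exact: vmeasurable_dot mf (rd_measurable_cst d v).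
pose s x := sphase (dot (f x) v).
have s1 x : smod (s x) <= 1 by rewrite smod_sphase.
have [Xsf nsf] := ideal_multiplier (dp_left XY) Xf (smeasurable_sphase md) s1.
pose sf x := s x *: f x.
have [_ Idot] := dot_integrable v (vX _ Xsf).
apply: (@le_trans _ _ (vol Q * smod (dot (avg Q sf) v))%:E); last first.
  rewrite lee_fin; apply: (le_trans (HC _ Xsf)).
  by rewrite ler_wpM2l.
have -> : vol Q * smod (dot (avg Q sf) v) = smod (sreal k (vol Q) * dot (avg Q sf) v).
  by rewrite smodM smod_sreal gtr0_norm// vol_gt0.
rewrite Idot.
have -> : (fun x => dot (s x *: f x) v) = (fun x => sreal k (smod (dot (f x) v))).
  by apply/funext => x; rewrite dotZl sphaseM.
rewrite sintegral_sreal smod_sreal.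
rewrite pairing_ind ger0_norm; last by apply: Rintegral_ge0 => x _; exact: smod_ge0.
have [idot _] := dot_integrable v (vX _ Xf).
have mQ := measurable_cube Q.
by rewrite -(integrable_EFin_Rintegral mQ (smod_integrable mQ md idot)).
Qed.

Lemma TQ_boundsP X Y Q C : dual_pair X Y -> contains_indicators X ->
  contains_indicators Y ->
  TQ_bounds X Q C <->
  0 <= C /\ forall f, X f -> fnorm X (ind Q (avg Q f)) <= C * fnorm X f.
Proof.
move=> XY cX cY; split=> -[C0 H]; split=> // f Xf; first by have [] := H f Xf.
split; [exact: pair_vintegrable XY cY Xf|exact: cX|exact: H].
Qed.

(** Up to the factor [|Q|], [dot (avg f) (avg g)] is the integral of both
    [dot (T_Q f) g] and [dot f (T_Q g)]. *)
Lemma TQ_bounds_dual X Y Q C : dual_pair X Y -> contains_indicators X ->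
  contains_indicators Y -> TQ_bounds X Q C -> TQ_bounds Y Q C.
Proof.
move=> XY cX cY /(TQ_boundsP Q C XY cX cY)[C0 H].
apply/(TQ_boundsP Q C (dual_pair_sym XY) cY cX); split=> // g Yg.
have g0 := is_ge0 (dp_right XY) Yg.
apply: (ind_dual_norm_le XY _ _ _).2.
- exact: mulr_ge0.
- by move=> f Xf; exact: pair_vintegrable XY cY Xf.
- move=> f Xf; rewrite smod_dotC.
  apply: (le_trans (dot_avg_le Q (avg Q f) (dual_pair_sym XY) cX Yg)).
  by rewrite mulrC mulrAC ler_wpM2r// H.
Qed.

(** Stated for a pair, the two conditions on pairs of vectors become one, applied
    to [(X, Y)] and to [(Y, X)]. *)
Definition test_consts X Y : set R :=
  [set C | 0 < C /\ forall Q u, exists2 v, v != 0 &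
     (vol Q)^-1 * fnorm X (ind Q u) * fnorm Y (ind Q v) <= C * smod (dot u v)].

(** A vector [v] that norms [u] in the sense of Hahn-Banach satisfies
    [|Q| |dot (avg f) v| <= |Q| C |f|] by the bound of [T_Q], which bounds the norm
    of [1_Q v]. *)
Lemma TQ_bounds_test X Y C : dual_pair X Y -> contains_indicators X ->
  contains_indicators Y -> (0 < n)%N ->
  0 < C -> (forall Q, TQ_bounds X Q C) -> test_consts X Y C.
Proof.
move=> XY cX cY n0 C0 HC; split=> // Q u.
have sN := ind_seminorm Q (dp_left XY) cX.
have [_ H] := (TQ_boundsP Q C XY cX cY).1 (HC Q).
have V0 := vol_gt0 Q.
have [->|u0] := eqVneq u 0.
  exists (basis_vec R k (Ordinal n0)).
    rewrite -vnorm_gt0; apply: lt_le_trans (smod_coord_le _ (Ordinal n0)).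
    by rewrite mxE !eqxx smod1.
  by rewrite dot0l smod0 mulr0 (seminorm0 sN) mulr0 mul0r.
have [v Dv vE] := hahn_banach u sN.
have Nu : 0 < fnorm X (ind Q u).
  rewrite lt_def (seminorm_ge0 _ sN) andbT; apply: contra_neq u0.
  exact: ind_norm_eq0 (dp_left XY) cX.
exists v.
  apply/eqP => v0; move: Nu.
  by rewrite -[X in _ < X](@sRe_sreal R k) -vE v0 dot0r raddf0 ltxx.
rewrite vE smod_sreal gtr0_norm// -mulrA mulrCA [leRHS]mulrC ler_pM2l//.
rewrite ler_pdivrMl//; apply: (ind_dual_norm_le XY _ _ _).2.
- by rewrite mulr_ge0 ?ltW.
- by move=> f Xf; exact: pair_vintegrable XY cY Xf.
- move=> f Xf; rewrite -mulrA ler_pM2l//.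
  exact: le_trans (Dv _) (H f Xf).
Qed.

(** Apply the condition to [u = avg Q f], where the right side is again controlled
    by Hoelder's inequality, and cancel the norm of [1_Q v]. *)
Lemma test_TQ_bounds X Y C : dual_pair X Y -> contains_indicators X ->
  contains_indicators Y -> test_consts X Y C -> forall Q, TQ_bounds X Q C.
Proof.
move=> XY cX cY [C0 H] Q; apply/(TQ_boundsP Q C XY cX cY); split; first exact: ltW.
move=> f Xf; have [v v0 Hv] := H Q (avg Q f).
have V0 := vol_gt0 Q.
have Mv : 0 < fnorm Y (ind Q v).
  rewrite lt_def is_ge0 ?andbT; [|exact: dp_right XY|exact: cY].
  apply: contra_neq v0; exact: ind_norm_eq0 (dp_right XY) cY.
rewrite -(ler_pM2r Mv) -(ler_pM2l (ltac:(by rewrite invr_gt0) : 0 < (vol Q)^-1)).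
rewrite mulrA; apply: (le_trans Hv).
rewrite -mulrA mulrCA ler_pM2l// ler_pdivlMl//.
exact: dot_avg_le XY cY Xf.
Qed.

(** A bound for the averaging operator is at least one, since it fixes [1_Q u]. *)
Lemma TQ_bounds_ge1 X Y Q C : dual_pair X Y -> contains_indicators X ->
  contains_indicators Y -> (0 < n)%N -> TQ_bounds X Q C -> 1 <= C.
Proof.
move=> XY cX cY n0 /(TQ_boundsP Q C XY cX cY)[C0 H].
pose u := basis_vec R k (Ordinal n0).
have V0 := vol_gt0 Q.
have u0 : u != 0.
  rewrite -vnorm_gt0; apply: lt_le_trans (smod_coord_le _ (Ordinal n0)).
  by rewrite mxE !eqxx smod1.
have Nu : 0 < fnorm X (ind Q u).
  rewrite lt_def is_ge0 ?andbT; [|exact: dp_left XY|exact: cX].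
  apply: contra_neq u0; exact: ind_norm_eq0 (dp_left XY) cX.
have := H _ (cX Q u).
have -> : avg Q (ind Q u) = u.
  rewrite avg_ind//; last exact: measurable_cube.
  by rewrite -/(vol Q) divff ?gt_eqF// rmorph1 scale1r.
by rewrite ler_pMl.
Qed.

Lemma exists_reducing X Q : ideal_space X -> contains_indicators X -> (0 < n)%N ->
  is_reducing X Q (reducing_mx X Q).
Proof.
move=> iX cX n0; rewrite /reducing_mx; case: xgetP => // H0.
have sN := ind_seminorm Q iX cX.
have [A hA AN] : exists2 A : 'M[F]_n, hermitian_posdef A &
   forall u, fnorm X (ind Q u) <= vnorm (A *m u) <= Num.sqrt n%:R * fnorm X (ind Q u).
  have N0 u := @ind_norm_eq0 _ _ _ _ X Q u iX cX.
  move: sN N0; case: (n) n0 X iX cX H0 => // m _ X' iX' cX' _ sN N0.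
  exact: (john sN N0).
exact: (H0 A (conj hA AN)).
Qed.

Lemma hermitian_adj (A : 'M[F]_n) : hermitian_posdef A -> adjmx A = A.
Proof. by move=> [hA _]; apply/matrixP => i j; rewrite !mxE -hA. Qed.

Lemma opnorm_ub (A : 'M[F]_n) (c : R) : 0 <= c ->
  (mx_opnorm A <= c%:E)%E <-> forall u, vnorm (A *m u) <= c * vnorm u.
Proof.
move=> c0; split=> [H u|H].
  have [->|u0] := eqVneq u 0; first by rewrite mulmx0 !vnorm0 mulr0.
  have nu : 0 < vnorm u by rewrite vnorm_gt0.
  have := le_trans (ereal_sup_ubound _) H.
  move=> /(_ (vnorm (A *m (sreal k (vnorm u)^-1 *: u)))%:E).
  rewrite lee_fin -scalemxAr vnormZ smod_sreal gtr0_norm ?invr_gt0//.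
  rewrite ler_pdivrMl// mulrC [c * _]mulrC; apply.
  rewrite mulrC; exists (sreal k (vnorm u)^-1 *: u); last by rewrite -scalemxAr vnormZ smod_sreal gtr0_norm ?invr_gt0.
  by rewrite /= vnormZ smod_sreal gtr0_norm ?invr_gt0// mulVf// gt_eqF.
apply: ge_ereal_sup => _ [u /= u1 <-]; rewrite lee_fin.
by apply: (le_trans (H u)); rewrite ler_piMr.
Qed.

Lemma vnorm_le_of_dot (z : V) (c : R) : 0 <= c ->
  smod (dot z z) <= c * vnorm z -> vnorm z <= c.
Proof.
move=> c0; rewrite dotuu smod_sreal ger0_norm ?sqr_ge0//.
have [->//|z0] := eqVneq (vnorm z) 0.
by rewrite expr2 ler_pM2r// lt_def z0 vnorm_ge0.
Qed.

(** [B A] is estimated at [w]: the norm of [1_Q (A w)] in [Y] is a supremum of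
    [|dot (A (avg f)) w|], controlled by the norm of [T_Q f]. This uses the upper
    estimate of each matrix once, for a total of [n]; the adjoint of [B A] is
    [A B]. *)
Lemma reducing_upper X Y Q C A B : dual_pair X Y -> contains_indicators X ->
  contains_indicators Y -> is_reducing X Q A -> is_reducing Y Q B ->
  TQ_bounds X Q C -> ((vol Q)^-1%:E * mx_opnorm (A *m B) <= (n%:R * C)%:E)%E.
Proof.
move=> XY cX cY [hA rA] [hB rB] /(TQ_boundsP Q C XY cX cY)[C0 H].
have V0 := vol_gt0 Q.
have nn : Num.sqrt n%:R * Num.sqrt n%:R = n%:R :> R by rewrite -expr2 sqr_sqrtr.
have K0 : 0 <= n%:R * C * vol Q by rewrite !mulr_ge0// ltW.
suff : (mx_opnorm (A *m B) <= (n%:R * C * vol Q)%:E)%E.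
  move=> /(@lee_wpmul2l _ (vol Q)^-1%:E); rewrite lee_fin invr_ge0 ltW// => /(_ isT).
  by rewrite -EFinM mulrC mulfK// gt_eqF.
apply/opnorm_ub => // u.
set z := A *m B *m u.
have Baz w : vnorm (B *m (A *m w)) <= n%:R * C * vol Q * vnorm w.
  have /andP[_ BN] := rB (A *m w); apply: (le_trans BN).
  have : fnorm Y (ind Q (A *m w)) <= vol Q * Num.sqrt n%:R * C * vnorm w.
    apply: (ind_dual_norm_le XY _ _ _).2.
    - by rewrite !mulr_ge0 ?vnorm_ge0 ?sqrtr_ge0// ltW.
    - by move=> f Xf; exact: pair_vintegrable XY cY Xf.
    - move=> f Xf; rewrite -!mulrA ler_pM2l//.
      rewrite -[A in A *m w]hermitian_adj// -dot_mulmx.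
      apply: (le_trans (dot_le _ _)).
      have /andP[_ AN] := rA (avg Q f).
      apply: (@le_trans _ _ (Num.sqrt n%:R * (C * fnorm X f) * vnorm w)).
        rewrite ler_wpM2r ?vnorm_ge0//; apply: (le_trans AN).
        by rewrite ler_wpM2l ?sqrtr_ge0// H.
      by rewrite le_eqVlt; apply/orP; left; apply/eqP; ring.
  move=> /(ler_wpM2l (sqrtr_ge0 n%:R)) /le_trans; apply.
  by rewrite -{3}nn le_eqVlt; apply/orP; left; apply/eqP; ring.
apply: vnorm_le_of_dot; first by rewrite mulr_ge0 ?vnorm_ge0.
rewrite {1}/z -mulmxA dot_mulmx (hermitian_adj hA) dot_mulmx (hermitian_adj hB).
apply: (le_trans (dot_le _ _)).
by rewrite mulrC mulrAC ler_wpM2r ?vnorm_ge0.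
Qed.

(** Only the lower estimates of the matrices enter, so no power of [n] is lost:
    [|A a|^2 = dot a (A (A a))] for [a = avg f] is tested by Hoelder's inequality
    against [1_Q (A (A a))]. *)
Lemma reducing_lower X Y Q c A B : dual_pair X Y -> contains_indicators X ->
  contains_indicators Y -> is_reducing X Q A -> is_reducing Y Q B -> 0 <= c ->
  ((vol Q)^-1%:E * mx_opnorm (A *m B) <= c%:E)%E -> TQ_bounds X Q c.
Proof.
move=> XY cX cY [hA rA] [hB rB] c0 Hc.
have V0 := vol_gt0 Q.
have K0 : 0 <= c * vol Q by rewrite mulr_ge0// ltW.
have {}Hc : (mx_opnorm (A *m B) <= (c * vol Q)%:E)%E.
  have := @lee_wpmul2l _ (vol Q)%:E _ _ _ Hc.
  rewrite lee_fin ltW// => /(_ isT).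
  by rewrite muleA -EFinM divff ?gt_eqF// mul1e -EFinM mulrC.
have {}Hc := (opnorm_ub _ K0).1 Hc.
have BA w : vnorm (B *m (A *m w)) <= c * vol Q * vnorm w.
  apply: vnorm_le_of_dot; first by rewrite mulr_ge0 ?vnorm_ge0.
  set y := B *m (A *m w).
  rewrite {1}/y dot_mulmx (hermitian_adj hB) dot_mulmx (hermitian_adj hA).
  rewrite mulmxA; apply: (le_trans (dot_le _ _)).
  by rewrite mulrC mulrAC ler_wpM2r ?vnorm_ge0.
apply/(TQ_boundsP Q c XY cX cY); split=> // f Xf.
have /andP[AN _] := rA (avg Q f); apply: (le_trans AN).
have f0 := is_ge0 (dp_left XY) Xf.
apply: vnorm_le_of_dot; first exact: mulr_ge0.
rewrite {1}dot_mulmx (hermitian_adj hA) -(ler_pM2l V0).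
apply: (le_trans (dot_avg_le Q _ XY cY Xf)).
have /andP[BN _] := rB (A *m (A *m avg Q f)).
apply: (@le_trans _ _ (fnorm X f * (c * vol Q * vnorm (A *m avg Q f)))).
  by rewrite ler_wpM2l// (le_trans BN).
by rewrite le_eqVlt; apply/orP; left; apply/eqP; ring.
Qed.

End AveragingOperators.

(** * Averages of convex-set valued maps *)

Section ConvexBodies.
Variables (R : realType) (k : scalar_kind) (n d : nat).
Local Notation F := (scalar R k).
Local Notation V := 'cV[F]_n.
Local Notation Rd := (Rd R d).
Local Notation mu := (@leb R d).
Local Notation pairing := (mu_pairing mu).
Implicit Types (u v : V) (f g : Rd -> V) (Q : cube R d) (X Y : fspace R k n d).
Local Notation truncK := Defs.truncK.
Implicit Types (S : Rd -> set V) (K : set V).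

Opaque vmeasurable smeasurable mu_pairing.

Lemma trunc_sub Q S f : (forall x, calK (S x)) -> S0 (truncK Q S) f -> S0 S f.
Proof.
move=> cS [mf Sf]; split=> //; apply: filterS Sf => x; rewrite /truncK.
by case: ifP => // _ ->; exact: calK_0.
Qed.

Lemma trunc_ae0 Q S f : S0 (truncK Q S) f -> {ae mu, forall x, ~ (Q : set Rd) x -> f x = 0}.
Proof.
move=> [_ Sf]; apply: filterS Sf => x Sf nQ; move: Sf; rewrite /truncK.
by case: ifPn => // /set_mem.
Qed.

Lemma trunc_L1_bounded X Y Q S : dual_pair X Y -> contains_indicators Y -> XK X S ->
  L1_boundedK (truncK Q S).
Proof.
move=> XY cY [[cS _] XS [M HM]].
exists (\sum_(i < n) M * fnorm Y (ind Q (basis_vec R k i))) => f Sf.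
have Sf' := trunc_sub cS Sf; have Xf := XS _ Sf'.
have mf := is_meas (dp_left XY) Xf.
apply: (le_trans (int_vnorm_le_pairings (measurable_cube Q) mf (trunc_ae0 Sf))).
rewrite -sumEFin; apply: lee_sum => i _.
apply: (le_trans (dp_holder XY Xf (cY Q _))); rewrite lee_fin.
exact: ler_wpM2r (is_ge0 (dp_right XY) (cY Q _)) _ _ (HM _ Sf').
Qed.

Lemma sintegral_avg Q f i :
  mu_sintegral mu Q (fun x => f x i 0) = sreal k (vol Q) * avg Q f i 0.
Proof.
by rewrite avg_coord mulrA -rmorphM /= divff ?rmorph1 ?mul1r// gt_eqF// vol_gt0.
Qed.

(** Convexity and symmetry pass from the values of [S] to selections and their
    averages. Closedness is the theorem on integrals of selections. *)
Lemma calK_avgK X Y Q S : dual_pair X Y -> contains_indicators Y -> XK X S ->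
  calK (avgK Q S).
Proof.
move=> XY cY XS; have [[cS _] XS' _] := XS.
have vS f : S0 (truncK Q S) f -> vintegrable Q f.
  by move=> Sf; exact: pair_vintegrable XY cY (XS' _ (trunc_sub cS Sf)).
have V0 := vol_gt0 Q.
split.
- by exists (avg Q (fun=> 0)), (fun=> 0) => //; exact: selection_zero.
- apply/closed_approxP => w Hw.
  have [M HM] := trunc_L1_bounded Q XY cY XS.
  have Sw : forall e : R, 0 < e -> exists2 f, selection mu S Q f &
     forall i, smod (mu_sintegral mu Q (fun x => f x i 0)
        - (sreal k (vol Q) *: w) i 0) <= e.
    move=> e e0; have [_ [f Sf <-] cl] := Hw (e / vol Q) (divr_gt0 e0 V0).
    exists f => // i; rewrite sintegral_avg [in X in _ - X]mxE -mulrBr smodM smod_sreal.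
    by rewrite gtr0_norm// -ler_pdivlMl// mulrC ltW// cl.
  have SM f : selection mu S Q f -> (\int[mu]_(x in Q) (vnorm (f x))%:E <= M%:E)%E.
    by move=> Sf; apply: le_trans (HM _ Sf); exact: int_vnorm_restrict (measurable_cube Q) Sf.1.
  have [f Sf fE] := selection_integrals_closed (measurable_cube Q) cS SM Sw.
  exists f => //; apply/matrixP => i j; rewrite ord1 avg_coord fE mxE mulrA.
  by rewrite -rmorphM /= mulVf ?rmorph1 ?mul1r// gt_eqF.
- move=> _ _ t [f Sf <-] [g Sg <-] t01.
  exists (fun x => t *: f x + (1 - t) *: g x); first exact: selection_convex.
  by rewrite avgD ?avgZ//; try apply: vintegrableZ; exact: vS.
- move=> _ a [f Sf <-] a1; exists (fun x => a *: f x).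
    exact: selection_unimodular.
  by rewrite avgZ//; exact: vS.
Qed.

(** Such a map takes two values, so the set of points where it meets [E] is [Q],
    its complement, everything or nothing. *)
Lemma L0K_trunc_cst Q K : calK K -> L0K (truncK Q (fun=> K)).
Proof.
move=> cK; split; first by move=> x; exact: calK_trunc.
move=> E _; have mQ := measurable_cube Q.
have [P|nP] := pselect (K `&` E !=set0); have [Z|nZ] := pselect (E 0).
- rewrite (_ : [set x | _] = setT); first exact: measurableT.
  apply/seteqP; split=> // x _ /=; rewrite /truncK; case: ifP => // _.
  by exists 0.
- rewrite (_ : [set x | _] = Q)//.
  apply/seteqP; split=> x /=; rewrite /truncK.
    by case: ifPn => [/set_mem//|_ [y [/= ->]]].
  by move=> Qx; rewrite mem_set.
- rewrite (_ : [set x | _] = ~` Q); first exact: measurableC.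
  apply/seteqP; split=> x /=; rewrite /truncK.
    by move=> + Qx; rewrite mem_set.
  by move=> nQ; rewrite memNset//; exists 0.
- rewrite (_ : [set x | _] = set0); first exact: measurable0.
  apply/seteqP; split=> x //=; rewrite /truncK.
  by case: ifPn => // _ [y [/= ->]].
Qed.

Lemma XK_norm_le X S (C : R) : (forall f, S0 S f -> fnorm X f <= C) ->
  (XK_norm X S <= C%:E)%E.
Proof. by move=> H; apply: ub_ereal_sup => _ [f Sf <-]; rewrite lee_fin H. Qed.

Lemma XK_norm_fin X S : ideal_space X -> XK X S -> exists B : R,
  [/\ XK_norm X S = B%:E, 0 <= B & forall f, S0 S f -> fnorm X f <= B].
Proof.
move=> iX [[cS _] XS [M HM]].
have S0z : S0 S (fun=> 0).
  split; first exact: rd_measurable_cst.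
  by apply: leb_aeW => x; exact: calK_0.
have ub f : S0 S f -> ((fnorm X f)%:E <= XK_norm X S)%E.
  by move=> Sf; apply: ereal_sup_ubound; exists f.
have le := XK_norm_le HM.
have ge : (0 <= XK_norm X S)%E.
  have z0 := is_ge0 iX (is_zero iX).
  by apply: le_trans (ub _ S0z); rewrite lee_fin.
have fin : XK_norm X S \is a fin_num by rewrite ge0_fin_numE// (le_lt_trans le)// ltry.
exists (fine (XK_norm X S)); split; first by rewrite fineK.
- exact: fine_ge0.
- by move=> f Sf; rewrite -lee_fin fineK//; exact: ub.
Qed.

(** The selection [g] is expanded in vectors [U] of almost maximal volume in the
    [e]-neighbourhood [Ke] of the average, with coefficients of modulus at most 2.
    The neighbourhood replaces the average itself because the latter may have
    empty interior, and then contains no basis. *)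
Lemma S0_TQK_norm X Y Q C S g e : dual_pair X Y -> contains_indicators X ->
  contains_indicators Y -> TQ_bounds X Q C -> XK X S -> 0 < e ->
  forall B : R, (forall f, S0 S f -> fnorm X f <= B) ->
  S0 (TQK Q S) g -> X g /\ fnorm X g <=
    n%:R * (2 * (C * B + e * \sum_i fnorm X (ind Q (basis_vec R k i)))).
Proof.
move=> XY cX cY /(TQ_boundsP Q C XY cX cY)[C0 HC] XS e0 B HB [mg Sg].
have iX := dp_left XY; have [[cS _] XS' _] := XS.
have sN := ind_seminorm Q iX cX.
set E := \sum_i _; set N := fun u => fnorm X (ind Q u) in sN *.
have Kn u : avgK Q S u -> N u <= C * B.
  move=> [f Sf <-]; have Sf' := trunc_sub cS Sf.
  by apply: (le_trans (HC _ (XS' _ Sf'))); rewrite ler_wpM2l// HB.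
have cK := calK_avgK Q XY cY XS.
pose Ke := [set w | exists2 u, avgK Q S u & forall i, smod ((w - u) i 0) <= e].
have KeN w : Ke w -> N w <= C * B + e * E.
  move=> [u Ku wu]; rewrite -[w](subrK u) addrC.
  apply: (le_trans (seminormD sN _ _)); rewrite lerD ?Kn//.
  apply: (le_trans (seminorm_le_sum _ sN)); rewrite mulr_sumr.
  by apply: ler_sum => i _; rewrite ler_wpM2r// (seminorm_ge0 _ sN).
have KKe u : avgK Q S u -> Ke u.
  by move=> Ku; exists u => // i; rewrite subrr mxE smod0 ltW.
have [c c0 Hc] := ind_norm_ge Q iX cX.
have [U [Uu KU Uco]] : exists U : 'M[F]_n, [/\ U \in unitmx, forall j, Ke (col j U) &
    forall y, Ke y -> forall i, smod ((invmx U *m y) i 0) <= 2].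
  apply: (@near_maximal_basis _ _ _ Ke (c * (C * B + e * E)) e) => //.
    move=> u Ku i; apply: (le_trans (smod_coord_le _ _)).
    by apply: (le_trans (Hc u)); rewrite ler_pM2l// KeN.
  move=> i; exists 0; first exact: calK_0.
  move=> j; rewrite subr0 !mxE eqxx andbT smodM smod_sreal gtr0_norm//.
  by case: (j == i); rewrite /= ?smod1 ?smod0 ?mulr1 ?mulr0// ltW.
pose a j x := (invmx U *m g x) j 0.
have ma j : smeasurable (a j) by exact: vmeasurable_coord (vmeasurable_mulmx (invmx U) mg).
pose h j x := a j x *: ind Q (col j U) x.
have hX j : X (h j) /\ fnorm X (h j) <= 2 * (C * B + e * E).
  have X2 := cX Q (sreal k 2 *: col j U).
  have [] := @is_ideal _ _ _ _ X iX _ (h j) X2.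
  - exact: rd_measurableZ (ma j) (measurable_ind Q _).
  - apply: filterS Sg => x; rewrite /h /TQK /truncK /ind.
    case: ifP => _ gx; last by rewrite scaler0.
    have -> : a j x *: col j U = (a j x * sreal k 2^-1) *: (sreal k 2 *: col j U).
      by rewrite scalerA -mulrA -rmorphM /= mulVf// rmorph1 mulr1.
    apply: segK_sub; rewrite smodM smod_sreal gtr0_norm// ler_pdivrMr// mul1r.
    by apply: Uco; exact: KKe.
  - move=> Xh /le_trans nh; split=> //; apply: nh.
    have -> : fnorm X (ind Q (sreal k 2 *: col j U)) = N (sreal k 2 *: col j U) by [].
    by rewrite (seminormZ sN) smod_sreal gtr0_norm// ler_pM2l// KeN.
have [Xs ns] := ideal_sum (index_enum 'I_n) iX (fun j => (hX j).1).
have [] := ideal_ae iX Xs mg _.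
  apply: filterS Sg => x; rewrite /h /TQK /truncK /ind.
  case: ifP => _ gx.
    rewrite -{1}[g x](mulKVmx Uu); apply/matrixP => i l; rewrite ord1 mxE summxE.
    by apply: eq_bigr => j _; rewrite [RHS]mxE [X in _ = _ * X]mxE [RHS]mulrC.
  by rewrite gx big1// => j _; rewrite scaler0.
move=> Xg ng; split=> //; apply: (le_trans ng); apply: (le_trans ns).
apply: (le_trans (ler_sum _ (fun j _ => (hX j).2))).
by rewrite sumr_const card_ord [leRHS]mulr_natl.
Qed.

(** Let the radius of the neighbourhood tend to 0. *)
Lemma TQ_bounds_TQK X Y Q C : dual_pair X Y -> contains_indicators X ->
  contains_indicators Y -> TQ_bounds X Q C -> TQK_bounds X Q (2 * n%:R * C).
Proof.
move=> XY cX cY HC; have iX := dp_left XY; have C0 := HC.1.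
split; first by rewrite !mulr_ge0.
move=> S XS; have [B [nB B0 HB]] := XK_norm_fin iX XS.
have Xg g : S0 (TQK Q S) g -> X g.
  by move=> Sg; have [] := S0_TQK_norm XY cX cY HC XS ltr01 HB Sg.
have ng g : S0 (TQK Q S) g -> fnorm X g <= 2 * n%:R * C * B.
  move=> Sg; apply/ler_addgt0Pr => e e0.
  set E := \sum_i fnorm X (ind Q (basis_vec R k i)).
  have E0 : 0 <= E by apply: sumr_ge0 => i _; have := is_ge0 iX (cX Q (basis_vec R k i)).
  pose D := n%:R * 2 * (E + 1).
  have D0 : 0 <= D by rewrite !mulr_ge0// addr_ge0.
  have e1 : 0 < e / (D + 1) by rewrite divr_gt0// ltr_wpDl.
  have [_] := S0_TQK_norm XY cX cY HC XS e1 HB Sg; rewrite -/E => /le_trans; apply.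
  rewrite mulrDr mulrDr lerD//; first by rewrite le_eqVlt; apply/orP; left; apply/eqP; ring.
  have -> : n%:R * (2 * (e / (D + 1) * E)) = e * (n%:R * 2 * E / (D + 1)) by ring.
  rewrite ger_pMr// ler_pdivrMr ?ltr_wpDl// mul1r /D.
  by rewrite ler_wpDr// ler_wpM2l ?mulr_ge0// lerDl.
split.
- exact: trunc_L1_bounded XY cY XS.
- split=> //; first exact: L0K_trunc_cst (calK_avgK Q XY cY XS).
  by exists (2 * n%:R * C * B).
- by rewrite nB -EFinM; exact: XK_norm_le.
Qed.

Lemma XK_segK X f : ideal_space X -> X f ->
  XK X (fun x => segK (f x)) /\
  forall g, S0 (fun x => segK (f x)) g -> fnorm X g <= fnorm X f.
Proof.
move=> iX Xf; have mf := is_meas iX Xf.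
have H g : S0 (fun x => segK (f x)) g -> X g /\ fnorm X g <= fnorm X f.
  move=> [mg Sg]; apply: (is_ideal iX) => //; apply: filterS Sg => x [a a1 <-].
  by apply: segK_sub; rewrite -le_norm1.
split; last by move=> g /H[].
split; last 2 first.
- by move=> g /H[].
- by exists (fnorm X f) => g /H[].
split; first by move=> x; exact: calK_segK.
move=> E oE; exact: measurable_preimage_open mf (open_segK_meets oE).
Qed.

(** [f] restricted to [Q] is a selection of its own segments, so [T_Q f] is one of
    their average; the norm of the segments is that of [f] by the ideal property. *)
Lemma TQK_bounds_TQ X Q C : ideal_space X -> TQK_bounds X Q C -> TQ_bounds X Q C.
Proof.
move=> iX [C0 H]; split=> // f Xf.
have [XS nS] := XK_segK iX Xf; have [L1 XT nT] := H _ XS.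
set S := fun x => segK (f x) in XS nS L1 XT nT.
have mf := is_meas iX Xf; have mQ := measurable_cube Q.
pose h := fun x => if x \in (Q : set Rd) then f x else 0.
have hE x : (Q : set Rd) x -> h x = f x by move=> Qx; rewrite /h mem_set.
have Sh : S0 (truncK Q S) h.
  split; first exact: rd_measurable_if mQ mf (rd_measurable_cst d 0).
  apply: leb_aeW => x; rewrite /truncK /h; case: ifP => // _; exact: segK_self.
have Ah : avg Q h = avg Q f.
  apply/matrixP => i j; rewrite ord1 !avg_coord; congr (_ * _).
  by rewrite /mu_sintegral; congr sMk; apply: eq_Rintegral => x /set_mem Qx; rewrite hE.
have vf : vintegrable Q f.
  move=> i; have [M HM] := L1.
  exact: coord_integrable i mQ mf Sh.1 hE (HM _ Sh).
have St : S0 (TQK Q S) (TQ Q f).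
  split; first exact: measurable_ind.
  apply: leb_aeW => x; rewrite /TQK /truncK /TQ /ind; case: ifP => // _.
  by exists h.
have [_ XT' _] := XT.
split=> //; first exact: XT'.
rewrite -lee_fin; apply: (@le_trans _ _ (XK_norm X (TQK Q S))).
  by apply: ereal_sup_ubound; exists (TQ Q f).
apply: (le_trans nT); rewrite EFinM; apply: lee_wpmul2l; first by rewrite lee_fin.
exact: XK_norm_le.
Qed.

(** [T_Q] maps [1_G e_i] to a positive multiple of [1_Q e_i], which gives the
    functions in [X]. Those in [Y] follow by duality: averages of functions of [X]
    are bounded vectors, since [T_Q] is bounded and [1_Q u] controls [u]. *)
Lemma TQ_maps_indicators X Y : dual_pair X Y -> componentwise_saturated X ->
  (forall Q, TQ_maps X Q) -> contains_indicators X /\ contains_indicators Y.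
Proof.
move=> XY satX TX; have iX := dp_left XY.
have cX : contains_indicators X.
  apply: contains_indicators_basis => // Q i; have V0 := vol_gt0 Q.
  have Q0 : (0 < mu (Q : set Rd))%E by rewrite [mu _]leb_cube_vol lte_fin.
  have [G [mG GQ G0 XG]] := satX i _ (measurable_cube Q) Q0.
  have [C [C0 HC]] := TX Q; have [_ + _] := HC _ XG.
  rewrite /TQ avg_ind// => XQ.
  have Goo : (mu G < +oo)%E.
    apply: (@le_lt_trans _ _ (mu (Q : set Rd))); last by rewrite [mu _]leb_cube_vol ltry.
    by apply: le_measure; rewrite ?inE//; exact: measurable_cube.
  have c0 : 0 < fine (leb G) / vol Q.
    by rewrite divr_gt0// fine_gt0// G0.
  have := is_scale iX (sreal k (fine (leb G) / vol Q)^-1) XQ.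
  by rewrite -indZ scalerA -rmorphM /= mulVf ?gt_eqF// rmorph1 scale1r.
split=> // Q v; have [C [C0 HC]] := TX Q.
have [c c0 Hc] := ind_norm_ge Q iX cX; have V0 := vol_gt0 Q.
apply: (ind_dual_norm_le (C := vol Q * (c * C * vnorm v)) XY _ _ _).1.
- by rewrite !mulr_ge0// ?vnorm_ge0// ltW.
- by move=> f Xf; have [] := HC f Xf.
- move=> f Xf; rewrite -mulrA ler_pM2l//; have [_ _ nf] := HC f Xf.
  apply: (le_trans (dot_le _ _)); rewrite mulrAC ler_wpM2r ?vnorm_ge0//.
  by apply: (le_trans (Hc _)); rewrite -mulrA ler_pM2l.
Qed.

End ConvexBodies.

(** * The equivalences *)

Section Equivalences.
Variables (R : realType) (k : scalar_kind) (n d : nat).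
Local Notation F := (scalar R k).
Local Notation V := 'cV[F]_n.
Local Notation Rd := (Rd R d).
Local Notation mu := (@leb R d).
Implicit Types (u v : V) (Q : cube R d) (X Y : fspace R k n d) (C : R).

Opaque vmeasurable smeasurable mu_pairing.

Definition unit_cube : cube R d := Cube (nseq_tuple d 0) ltr01.

Lemma TQ_norm_le X Q C : TQ_bounds X Q C -> (TQ_norm X Q <= C%:E)%E.
Proof. by move=> HC; apply: ereal_inf_lbound; exists C. Qed.

Lemma TQ_norm_ge0 X Q : (0 <= TQ_norm X Q)%E.
Proof. by apply/ereal_infP => _ [C [C0 _] <-]; rewrite lee_fin. Qed.

(** The infimum of the bounds is a bound. *)
Lemma TQ_bounds_of_norm X Y Q C : dual_pair X Y -> contains_indicators X ->
  contains_indicators Y -> 0 <= C -> (TQ_norm X Q <= C%:E)%E -> TQ_bounds X Q C.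
Proof.
move=> XY cX cY C0 HC; apply/(TQ_boundsP Q C XY cX cY); split=> // f Xf.
have f0 := is_ge0 (dp_left XY) Xf.
apply/ler_addgt0Pr => e e0; pose r := e / (fnorm X f + 1).
have r0 : 0 < r by rewrite divr_gt0// ltr_wpDl.
have : (TQ_norm X Q < (C + r)%:E)%E by apply: le_lt_trans HC _; rewrite lte_fin ltrDl.
move=> /ereal_inf_lt[_ [C' HC' <-]]; rewrite lte_fin => C'r.
have [_ H] := (TQ_boundsP Q C' XY cX cY).1 HC'.
apply: (le_trans (H f Xf)); apply: (@le_trans _ _ ((C + r) * fnorm X f)).
  by rewrite ler_wpM2r// ltW.
rewrite mulrDl lerD2l /r mulrAC -mulrA ger_pMr// ler_pdivrMr ?ltr_wpDl//.
by rewrite mul1r lerDl.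
Qed.

Lemma A_const_le X C : (forall Q, TQ_bounds X Q C) -> (A_const X <= C%:E)%E.
Proof. by move=> H; apply: ub_ereal_sup => _ [Q _ <-]; exact: TQ_norm_le. Qed.

Lemma A_const_ge0 X : (0 <= A_const X)%E.
Proof.
apply: le_trans (TQ_norm_ge0 X unit_cube) _.
by apply: ereal_sup_ubound; exists unit_cube.
Qed.

Lemma A_const_attained X Y : dual_pair X Y -> contains_indicators X ->
  contains_indicators Y -> (A_const X < +oo)%E ->
  exists2 a : R, A_const X = a%:E & forall Q, TQ_bounds X Q a.
Proof.
move=> XY cX cY Aoo; have A0 := A_const_ge0 X.
have Afin : A_const X \is a fin_num by rewrite ge0_fin_numE.
exists (fine (A_const X)); first by rewrite fineK.
move=> Q; apply: TQ_bounds_of_norm XY cX cY (fine_ge0 A0) _.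
by rewrite fineK//; apply: ereal_sup_ubound; exists Q.
Qed.

Lemma A_const_dual X Y : dual_pair X Y -> contains_indicators X ->
  contains_indicators Y -> (A_const Y <= A_const X)%E.
Proof.
move=> XY cX cY; apply: ub_ereal_sup => _ [Q _ <-].
apply: (@le_trans _ _ (TQ_norm X Q)); last by apply: ereal_sup_ubound; exists Q.
apply: le_ereal_inf => _ [C HC <-]; exists C => //.
exact: TQ_bounds_dual XY cX cY HC.
Qed.

Lemma A_const_le_AK X : ideal_space X -> (A_const X <= AK_const X)%E.
Proof.
move=> iX; apply: ub_ereal_sup => _ [Q _ <-].
apply: (@le_trans _ _ (TQK_norm X Q)); last by apply: ereal_sup_ubound; exists Q.
apply: le_ereal_inf => _ [C HC <-]; exists C => //.
exact: TQK_bounds_TQ iX HC.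
Qed.

Lemma AK_const_le X Y C : dual_pair X Y -> contains_indicators X ->
  contains_indicators Y -> (forall Q, TQ_bounds X Q C) ->
  (AK_const X <= (2 * n%:R * C)%:E)%E.
Proof.
move=> XY cX cY HC; apply: ub_ereal_sup => _ [Q _ <-].
apply: ereal_inf_lbound; exists (2 * n%:R * C) => //.
exact: TQ_bounds_TQK XY cX cY (HC Q).
Qed.

Lemma C2_consts_test X : C2_consts X = test_consts (kothe X) X.
Proof.
have E Q u v C : ((vol Q)^-1 * fnorm X (ind Q u) * fnorm (kothe X) (ind Q v)
       <= C * smod (dot u v)) = ((vol Q)^-1 * fnorm (kothe X) (ind Q v) * fnorm X (ind Q u)
       <= C * smod (dot v u)) by rewrite mulrAC smod_dotC.
apply/seteqP; split=> C [C0 H]; split=> // Q v; have [u u0 Hu] := H Q v;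
  by exists u => //; rewrite ?E// -E.
Qed.

Hypothesis n_gt0 : (0 < n)%N.

Lemma AR_const_le X C : dual_pair X (kothe X) -> contains_indicators X ->
  contains_indicators (kothe X) -> (forall Q, TQ_bounds X Q C) ->
  (AR_const X <= (n%:R * C)%:E)%E.
Proof.
move=> XY cX cY HC; apply: ub_ereal_sup => _ [Q _ <-].
apply: (reducing_upper XY cX cY _ _ (HC Q)).
  exact: exists_reducing (dp_left XY) cX n_gt0.
exact: exists_reducing (dp_right XY) cY n_gt0.
Qed.

Lemma AR_const_ge0 X : (0 <= AR_const X)%E.
Proof.
pose Q := unit_cube.
apply: (@le_trans _ _ ((vol Q)^-1%:E *
   mx_opnorm (reducing_mx X Q *m reducing_mx (kothe X) Q))%E); last first.
  by apply: ereal_sup_ubound; exists Q.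
apply: mule_ge0; first by rewrite lee_fin invr_ge0 ltW// vol_gt0.
apply: ereal_sup_ubound; exists 0; first by rewrite /= vnorm0.
by rewrite mulmx0 vnorm0.
Qed.

Lemma A_const_le_AR X : dual_pair X (kothe X) -> contains_indicators X ->
  contains_indicators (kothe X) -> (AR_const X < +oo)%E ->
  exists2 c : R, AR_const X = c%:E & forall Q, TQ_bounds X Q c.
Proof.
move=> XY cX cY ARoo; have A0 := AR_const_ge0 X.
have Afin : AR_const X \is a fin_num by rewrite ge0_fin_numE.
exists (fine (AR_const X)); first by rewrite fineK.
move=> Q; apply: (reducing_lower XY cX cY _ _ (fine_ge0 A0) _).
- exact: exists_reducing (dp_left XY) cX n_gt0.
- exact: exists_reducing (dp_right XY) cY n_gt0.
- by rewrite fineK//; apply: ereal_sup_ubound; exists Q.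
Qed.

(** The common form to which all the conditions are reduced. *)
Definition bounded_averages X Y := [/\ contains_indicators X, contains_indicators Y &
  exists C, forall Q, TQ_bounds X Q C].

Lemma bounded_averages_dual X Y : dual_pair X Y ->
  bounded_averages X Y -> bounded_averages Y X.
Proof.
move=> XY [cX cY [C HC]]; split=> //; exists C => Q.
exact: TQ_bounds_dual XY cX cY (HC Q).
Qed.

Lemma bounded_averagesP X Y : dual_pair X Y ->
  bounded_averages X Y <-> [/\ contains_indicators X, contains_indicators Y,
      (forall Q, TQ_maps X Q) & (A_const X < +oo)%E].
Proof.
move=> XY; split=> [[cX cY [C HC]]|[cX cY _ Aoo]]; split=> //.
- by move=> Q; exists C.
- by apply: le_lt_trans (A_const_le HC) _; rewrite ltry.
- by have [a _ Ha] := A_const_attained XY cX cY Aoo; exists a.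
Qed.

Lemma bounded_averages_inAK X Y : dual_pair X Y -> componentwise_saturated X ->
  bounded_averages X Y <-> inAK X.
Proof.
move=> XY satX; split=> [[cX cY [C HC]]|[TX AKoo]].
  split; last by apply: le_lt_trans (AK_const_le XY cX cY HC) _; rewrite ltry.
  by move=> Q; exists (2 * n%:R * C); exact: TQ_bounds_TQK XY cX cY (HC Q).
have TX' Q : TQ_maps X Q.
  by have [C HC] := TX Q; exists C; exact: TQK_bounds_TQ (dp_left XY) HC.
have [cX cY] := TQ_maps_indicators XY satX TX'.
apply/(bounded_averagesP XY); split=> //.
exact: le_lt_trans (A_const_le_AK (dp_left XY)) AKoo.
Qed.

Lemma bounded_averages_inAR X : dual_pair X (kothe X) ->
  bounded_averages X (kothe X) <-> inAR X.
Proof.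
move=> XY; split=> [[cX cY [C HC]]|[cX cY ARoo]]; split=> //.
  by apply: le_lt_trans (AR_const_le XY cX cY HC) _; rewrite ltry.
by have [c _ Hc] := A_const_le_AR XY cX cY ARoo; exists c.
Qed.

Lemma bounded_averages_test X Y : dual_pair X Y ->
  bounded_averages X Y <-> [/\ contains_indicators X, contains_indicators Y &
     test_consts X Y !=set0].
Proof.
move=> XY; split=> [[cX cY [C HC]]|[cX cY [C HC]]]; split=> //; exists C.
  apply: (TQ_bounds_test XY cX cY n_gt0 _ HC); apply: lt_le_trans ltr01 _.
  exact: TQ_bounds_ge1 XY cX cY n_gt0 (HC unit_cube).
exact: test_TQ_bounds XY cX cY HC.
Qed.

Lemma smallest_test_const X Y (a : R) : dual_pair X Y -> contains_indicators X ->
  contains_indicators Y -> A_const X = a%:E -> (forall Q, TQ_bounds X Q a) ->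
  is_smallest a (test_consts X Y).
Proof.
move=> XY cX cY aE Ha; split.
  apply: (TQ_bounds_test XY cX cY n_gt0 _ Ha); apply: lt_le_trans ltr01 _.
  exact: TQ_bounds_ge1 XY cX cY n_gt0 (Ha unit_cube).
move=> C HC; rewrite -lee_fin -aE; apply: A_const_le.
exact: test_TQ_bounds XY cX cY HC.
Qed.

End Equivalences.

Theorem theorem5p2 (R : realType) (n : nat) (n_gt0 : (0 < n)%N) :
  exists2 c : R, 0 < c &
  forall (k : scalar_kind) (d : nat) (X : fspace R k n d),
    (0 < d)%N ->
    directional_bfs X -> kothe_reflexive X ->
    componentwise_saturated X -> componentwise_saturated (kothe X) ->
    [<-> inA X;
         inA (kothe X);
         inAK X;
         inAK (kothe X);
         inAR X;
         C1_cond X;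
         C2_cond X]
    /\
    (inA X ->
      (exists a : R, [/\ A_const X = a%:E,
                         A_const (kothe X) = a%:E,
                         is_smallest a (C1_consts X) &
                         is_smallest a (C2_consts X)])
      /\
      (forall p q : \bar R,
         p \in [:: A_const X; AR_const X; AK_const X; AK_const (kothe X)] ->
         q \in [:: A_const X; AR_const X; AK_const X; AK_const (kothe X)] ->
         (p <= c%:E * q)%E)).
Proof.
(* every constant lies between [A_const X] and [2 n] times it *)
exists (2 * n%:R); first by rewrite mulr_gt0 ?ltr0n.
move=> k d X _ bX rX satX satY.
have XY := kothe_dual_pair bX rX; have YX := dual_pair_sym XY.
have cXX : contains_indicators (kothe (kothe X)) = contains_indicators X.
  by rewrite /contains_indicators rX.1.
set Y := kothe X in XY YX cXX satY *.
have BA : bounded_averages X Y <-> bounded_averages Y X.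
  by split; apply: bounded_averages_dual.
have E0 : bounded_averages X Y <-> inA X := bounded_averagesP XY.
have E1 : bounded_averages X Y <-> inA Y.
  by rewrite BA /inA cXX; exact: bounded_averagesP.
have E2 : bounded_averages X Y <-> inAK X := bounded_averages_inAK XY satX.
have E3 : bounded_averages X Y <-> inAK Y.
  by rewrite BA; exact: bounded_averages_inAK.
have E4 : bounded_averages X Y <-> inAR X := bounded_averages_inAR n_gt0 XY.
have E5 : bounded_averages X Y <-> C1_cond X := bounded_averages_test n_gt0 XY.
have E6 : bounded_averages X Y <-> C2_cond X.
  rewrite BA /C2_cond C2_consts_test (bounded_averages_test n_gt0 YX).
  by split=> -[].
split.
  by tfae; rewrite -?E0 -?E1 -?E2 -?E3 -?E4 -?E5 -?E6.
move=> AX; have [cX cY _ Aoo] := AX.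
have [a aE Ha] := A_const_attained XY cX cY Aoo.
have bE : A_const Y = a%:E.
  by apply/eqP; rewrite eq_le -aE !(A_const_dual _ cX cY, A_const_dual _ cY cX).
have Hb Q : TQ_bounds Y Q a := TQ_bounds_dual XY cX cY (Ha Q).
have a0 : 0 <= a := (Ha (unit_cube R d)).1.
split.
  exists a; split=> //; first exact: smallest_test_const.
  by rewrite C2_consts_test; exact: smallest_test_const.
have ARle := AR_const_le n_gt0 XY cX cY Ha.
have ARge : (a%:E <= AR_const X)%E.
  have [|c -> Hc] := A_const_le_AR n_gt0 XY cX cY.
    by apply: le_lt_trans ARle _; rewrite ltry.
  by rewrite -aE; exact: A_const_le.
have n1 : 1 <= n%:R :> R by rewrite ler1n.
have bounds q : q \in [:: A_const X; AR_const X; AK_const X; AK_const Y] ->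
    (a%:E <= q)%E /\ (q <= (2 * n%:R)%:E * a%:E)%E.
  rewrite !inE => /or4P[] /eqP ->; rewrite -EFinM.
  - rewrite aE; split=> //; rewrite lee_fin ler_peMl//.
    by rewrite (le_trans n1)// ler_peMl ?ler1n// (le_trans _ n1).
  - split=> //; apply: (le_trans ARle); rewrite lee_fin -mulrA ler_peMl ?ler1n//.
    by rewrite mulr_ge0.
  - split; last exact: AK_const_le XY cX cY Ha.
    by rewrite -aE; exact: A_const_le_AK (dp_left XY).
  - split; last exact: AK_const_le YX cY cX Hb.
    by rewrite -bE; exact: A_const_le_AK (dp_left YX).
move=> p q /bounds[_ pa] /bounds[aq _]; apply: (le_trans pa).
by apply: lee_wpmul2l => //; rewrite lee_fin mulr_ge0.
Qed.
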